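(* Let $s\ge 1$, let $1\leq\lambda_1<\lambda_2<\dots<\lambda_s\le n$ and $d_1,\dots,d_s\ge 1$ be integers, and let $\mathbf m=x_{\lambda_1}^{d_1}x_{\lambda_2}^{d_2}\cdots x_{\lambda_s}^{d_s}$. Write $I_i=(x_1,x_2,\dots,x_i)$. There exists a shellable polyhedral cell complex $Q(\mathbf m)$ that supports a minimal free resolution of the principal Borel fixed ideal $$I=\langle\mathbf m\rangle=\prod_{j=1}^{s}I_{\lambda_j}^{d_j}.$$ Moreover, $Q(\mathbf m)$ is a subcomplex of $P_d(x_1,\dots,x_n)$, where $d=\deg(\mathbf m)$. In particular, $Q(\mathbf m)$ is the union of all the convex polytopes (i.e. the faces) of the polyhedral cell complex $P_d(x_1,\dots,x_n)$ with (all) vertices in $\langle\mathbf m\rangle$.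
   Context: $\Bbbk$ is a field with $\operatorname{char}(\Bbbk)=0$, $S=\Bbbk[x_1,\dots,x_n]$. For a monomial ideal $I$, $G(I)$ denotes its unique minimal set of monomial generators. For a monomial $\mathbf m=x_1^{a_1}\cdots x_n^{a_n}$, $e(\mathbf m)=(a_1,\dots,a_n)$. A monomial ideal $I$ is Borel fixed if for every $\mathbf m\in G(I)$, every $x_t$ dividing $\mathbf m$ and every $1\le s<t$, the monomial $\frac{\mathbf m}{x_t}x_s$ is in $I$. The ideal $\langle\mathbf m\rangle$ is the smallest Borel fixed ideal $I$ with $\mathbf m\in G(I)$; such ideals are called principal Borel fixed. A polyhedral cell complex is a nonempty finite collection $X$ of convex polytopes (called faces) in some $\mathbb R^N$ such that every face of a polytope in $X$ is in $X$, and the intersection of any two polytopes in $X$ is a face of both. It is in particular a regular cell complex. Cellular resolutions: let $X$ be a regular cell complex whose vertices are labelled bijectively by the elements of $G(I)$. Each nonempty face $F$ is labelled by $\mathbf m_F$, the least common multiple of the labels of its vertices, and has degree $e(\mathbf m_F)$. Let $\epsilon_X$ be an incidence function on $X$ (with values $\pm1$ on pairs $(F,F')$ with $F'$ a codimension-one face of $F$, and $0$ otherwise). The cellular complex $\mathbf F_X$ is the $\mathbb Z^n$-graded free $S$-module $\bigoplus_{\varnothing\ne F\in X}SF$, with $F$ in degree $e(\mathbf m_F)$ and in homological degree $\dim F$, with differential $\partial F=\sum_{\varnothing\neq F'\in X}\epsilon_X(F,F')\frac{\mathbf m_F}{\mathbf m_{F'}}F'$. One says $X$ supports a (minimal) free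 resolution of $I$ if $\mathbf F_X$ is a (minimal) free resolution of $I$. The complex $P_d(x_1,\dots,x_n)$: for $1\le a\le b\le n$ let $\Delta(x_a,\dots,x_b)$ be the simplex with vertices the unit vectors of $\mathbb R^n$ indexed by $a,\dots,b$ (labelled $x_a,\dots,x_b$), with all its faces. Define recursively $P_1(x_a,\dots,x_b)=\Delta(x_a,\dots,x_b)$ and $$P_{d+1}(x_a,\dots,x_b)=\bigcup_{k=a}^{b}\Delta(x_a,\dots,x_k)\times P_d(x_k,\dots,x_b),$$ where a product cell $F\times G$ is realized in $\mathbb R^n$ as the Minkowski sum $F+G$, its vertex corresponding to a pair of vertices labelled $\mathbf u,\mathbf v$ being labelled $\mathbf u\mathbf v$ (so it is the point $e(\mathbf u\mathbf v)$). Thus $P_d(x_1,\dots,x_n)$ is a polyhedral cell complex subdividing the simplex with vertices $e(x_1^d),\dots,e(x_n^d)$, its vertices being the exponent vectors of all monomials of degree $d$; a vertex is said to be in an ideal if its label is. Shellable is meant in the usual sense for pure polytopal complexes: the maximal faces can be ordered $F_1,\dots,F_t$ (a shelling) such that either they are all points, or the boundary complex of $F_1$ has a shelling and for every $1<j\le t$ the set $F_j\cap(F_1\cup\dots\cup F_{j-1})$ is nonempty and is the union of an initial segment of the maximal faces in some shelling of the boundary complex of $F_j$. *)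

(* Defs.v *)
From HB Require Import structures.
From mathcomp Require Import all_boot all_order all_algebra.
From mathcomp Require Import boolp classical_sets functions cardinality fsbigop.
From mathcomp Require Import reals.
From mathcomp Require Import mpoly.

Set Implicit Arguments.
Unset Strict Implicit.
Unset Printing Implicit Defensive.

Import Order.TTheory GRing.Theory Num.Theory.

Local Open Scope classical_set_scope.
Local Open Scope ring_scope.

(* Variables are numbered from 0: the variable x_i of the usual notation is   *)
(* 'X_(i-1). *)

(** * Ideals of a polynomial ring *)

Section Ideals.
Variables (k : fieldType) (n : nat).
Local Notation S := {mpoly k[n]}.
Implicit Types (I J : set S) (A : set 'X_{1..n}) (m : 'X_{1..n}).

Definition is_ideal I : Prop :=
  [/\ I 0, forall f g, I f -> I g -> I (f + g) & forall f g, I g -> I (f * g)].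

Definition ideal_gen (B : set S) : set S := smallest is_ideal B.

Definition ideal_mul I J : set S := ideal_gen [set f * g | f in I & g in J].

Definition ideal_exp I (d : nat) : set S := iter d (ideal_mul I) [set: S].

(* The ideal generated by the variables of index at most i; this is           *)
(* (x_1, ..., x_(i+1)) in 1-based notation. *)
Definition var_ideal (i : 'I_n) : set S :=
  ideal_gen [set f | exists2 j : 'I_n, (j <= i)%N & f = 'X_j].

Definition irrelevant_ideal : set S := ideal_gen (range (fun j : 'I_n => 'X_j)).

Definition monomial_gen A : set S := ideal_gen [set 'X_[m] | m in A].

Definition monomial_ideal I : Prop := exists A, I = monomial_gen A.

(* G(I), as the least set of monomials that generates the monomial ideal I.   *)
Definition mingens I : set 'X_{1..n} :=
  \bigcap_(A in [set A | monomial_gen A = I]) A.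

Definition borel_fixed I : Prop :=
  monomial_ideal I /\
  forall m, mingens I m -> forall t s : 'I_n, (0 < m t)%N -> (s < t)%N ->
    I 'X_[m - U_(t) + U_(s)].

Definition is_principal_borel m I : Prop :=
  [/\ borel_fixed I, mingens I m &
      forall J, borel_fixed J -> mingens J m -> I `<=` J].

End Ideals.

(** * Polytopes and polyhedral cell complexes *)

Section Polytopes.
Variables (R : realType) (n : nat).
Local Notation V := 'rV[R]_n.
Implicit Types (F G P : set V) (X : set (set V)) (s : seq (set V)).

Definition conv_hull (J : finType) (p : J -> V) : set V :=
  [set x | exists w : J -> R,
    [/\ forall j, 0 <= w j, \sum_j w j = 1 & x = \sum_j w j *: p j]].

(* The empty set is a polytope. *)
Definition polytope P : Prop := exists (N : nat) (p : 'I_N -> V), P = conv_hull p.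

(* F is cut out of P by a valid linear inequality x.u <= c; both the empty    *)
(* set and P itself are faces of P. *)
Definition face_of F P : Prop :=
  exists (u : 'cV[R]_n) (c : R),
    (forall x, P x -> (x *m u) ord0 ord0 <= c) /\
    F = [set x | P x /\ (x *m u) ord0 ord0 = c].

Definition vertices P : set V := [set v | face_of [set v] P].

Definition aff_indep (N : nat) (p : 'I_N -> V) : Prop :=
  forall a : 'I_N -> R, \sum_i a i = 0 -> \sum_i a i *: p i = 0 ->
    forall i, a i = 0.

(* The largest number of affinely independent points in F, minus one; in      *)
(* particular the empty set has dimension -1. *)
Definition pdim F : int :=
  (\max_(N < n.+2 | `[< exists p : 'I_N -> V,
      (forall i, F (p i)) /\ aff_indep p >]) N)%:Z - 1.

Definition polyhedral_complex X : Prop :=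
  [/\ finite_set X, X !=set0, forall P, X P -> polytope P,
      forall P F, X P -> face_of F P -> X F &
      forall P P', X P -> X P' ->
        face_of (P `&` P') P /\ face_of (P `&` P') P'].

Definition complex_vertices X : set V := [set v | X [set v]].

Definition maximal_faces X : set (set V) :=
  [set F | X F /\ forall G, X G -> F `<=` G -> G = F].

Definition boundary_complex P : set (set V) := [set F | face_of F P /\ F <> P].

Definition pure X : Prop :=
  forall F G, maximal_faces X F -> maximal_faces X G -> pdim F = pdim G.

Definition orders_maximal_faces s X : Prop :=
  uniq s /\ [set` s] = maximal_faces X.

Inductive shelling : set (set V) -> seq (set V) -> Prop :=
| shelling_points X s :
    orders_maximal_faces s X ->
    (forall F, F \in s -> exists v, F = [set v]) ->
    shelling X s
| shelling_polytopes X F1 s :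
    orders_maximal_faces (F1 :: s) X ->
    (exists b, shelling (boundary_complex F1) b) ->
    (forall j, (0 < j <= size s)%N ->
       let Fj := nth set0 (F1 :: s) j in
       let meet := Fj `&` \bigcup_(i in `I_j) nth set0 (F1 :: s) i in
       meet !=set0 /\
       exists b, shelling (boundary_complex Fj) b /\
         exists2 e : nat, (e <= size b)%N &
           meet = \bigcup_(i in `I_e) nth set0 b i) ->
    shelling X (F1 :: s).

Definition shellable X : Prop := pure X /\ exists s, shelling X s.

Definition minkowski_sum F G : set V := [set x + y | x in F & y in G].

(* The simplex on the unit vectors of index between a and b, with its faces.  *)
Definition simplex_complex (a b : nat) : set (set V) :=
  [set F | face_of F
     (conv_hull (fun i : {i : 'I_n | (a <= i <= b)%N} => delta_mx ord0 (val i)))].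

(* P_d(x_a, ..., x_b), for d > 0; the value at d = 0 is a placeholder. *)
Fixpoint Pcomplex (d a b : nat) : set (set V) :=
  match d with
  | 0 => set0
  | 1 => simplex_complex a b
  | d'.+1 =>
      \bigcup_(k in [set k | (a <= k <= b)%N])
        [set minkowski_sum F G | F in simplex_complex a k & G in Pcomplex d' k b]
  end.

(* The inverse of u |-> e(u): at a point with natural coordinates, the        *)
(* monomial with this exponent vector. *)
Definition point_label (v : V) : 'X_{1..n} :=
  [multinom Num.truncn (v ord0 i) | i < n].

(* Incidence functions also take the empty face into account. *)
Definition incidence X (eps : set V -> set V -> int) : Prop :=
  [/\ forall F G, X F -> X G ->
        face_of G F /\ pdim G = pdim F - 1 -> eps F G = 1 \/ eps F G = -1,
      forall F G, X F -> X G ->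
        ~ (face_of G F /\ pdim G = pdim F - 1) -> eps F G = 0,
      forall v, complex_vertices X v -> eps [set v] set0 = 1 &
      forall F G1 G2 H, X F -> face_of G1 F -> face_of G2 F -> G1 <> G2 ->
        face_of H G1 -> face_of H G2 ->
        pdim G1 = pdim F - 1 -> pdim G2 = pdim F - 1 -> pdim H = pdim F - 2 ->
        eps F G1 * eps G1 H + eps F G2 * eps G2 H = 0].

End Polytopes.

(** * Cellular resolutions *)

Section CellularResolution.
Variables (R : realType) (k : fieldType) (n : nat).
Local Notation V := 'rV[R]_n.
Local Notation S := {mpoly k[n]}.
Variables (lab : V -> 'X_{1..n}) (X : set (set V)).
Implicit Types (F G : set V) (eps : set V -> set V -> int) (c : set V -> S).

Definition cell_label F : 'X_{1..n} :=
  \big[@mlcm n/0%MM]_(v \in vertices F) lab v.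

Definition cells : set (set V) := [set F | X F /\ F !=set0].

(* The component of homological degree i of F_X: c stands for the element     *)
(* \sum_F c F * F, the sum being over the cells of dimension i. *)
Definition chains (i : nat) : set (set V -> S) :=
  [set c | forall F, c F != 0 -> cells F /\ pdim F = i%:Z].

(* The coefficient at G of \sum_F c F * dF. The quotient m_F / m_G is exact   *)
(* whenever eps F G is nonzero, since then G is a face of F; hence the map is *)
(* homogeneous for the Z^n-grading in which F has degree e(m_F). *)
Definition cell_diff eps c : set V -> S := fun G =>
  if `[< cells G >]
  then \sum_(F \in cells)
         c F * ((eps F G)%:~R * 'X_[cell_label F - cell_label G])
  else 0.

(* The map from F_0 to S sending a vertex to its label. *)
Definition augmentation c : S := \sum_(F \in cells) c F * 'X_[cell_label F].

Definition is_free_resolution eps (I : set S) : Prop :=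
  [/\ augmentation @` chains 0 = I,
      forall c, chains 0 c ->
        (augmentation c = 0 <-> exists2 c', chains 1 c' & cell_diff eps c' = c) &
      forall i c, chains i.+1 c ->
        (cell_diff eps c = (fun=> 0) <->
         exists2 c', chains i.+2 c' & cell_diff eps c' = c)].

Definition is_minimal eps : Prop :=
  forall i c, chains i.+1 c ->
    forall G, irrelevant_ideal (cell_diff eps c G).

(* F_X does not depend on the incidence function up to isomorphism: one       *)
(* exists and the complex is required to be a minimal free resolution for     *)
(* every choice. *)
Definition supports_minimal_free_resolution (I : set S) : Prop :=
  [/\ set_bij (complex_vertices X) (mingens I) lab,
      exists eps, incidence X eps &
      forall eps, incidence X eps -> is_free_resolution eps I /\ is_minimal eps].

End CellularResolution.

(* Main.v *)
(* A cell of P_d is a Minkowski sum of simplices on nonempty sets of variables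
   A_1 <= ... <= A_d, encoded as a set of pairs (j, a) with a in A_j; it is a
   product of simplices, its faces correspond to subsets, and its label is the
   product of all the entries of all the A_j.  The cells of Q(m) are those with
   max A_j <= mu_j, where mu is the sorted list of the variables of m.

   Exactness in multidegree alpha: let t_1 be the least variable of x^alpha.
   Toggling t_1 in A_1 is an acyclic matching of the cells whose label divides
   x^alpha, except for those with A_1 = {t_1}, which form the same complex with
   d - 1 rows in multidegree alpha - e_(t_1); in the end a single vertex is left.
   Minimality holds because the label of a facet is that of the cell divided by
   one variable.

   Shelling: the maximal cells are A_j = [c_(j-1), c_j] with c increasing,
   c_j <= mu_j and c_d = mu_d.  In any order refining the sum of c, a cell meets
   the earlier ones in the union of the facets obtained by removing the top
   element c_j of a row j < d with c_(j-1) < c_j.  On the boundary of a product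
   of simplices, any order of the facets is a shelling as soon as the first and
   the last one remove elements of the same row. *)

Require Import Defs.
From mathcomp Require Import all_boot all_order all_algebra.
From mathcomp Require Import boolp classical_sets functions cardinality fsbigop.
From mathcomp Require Import reals.
From mathcomp Require Import mpoly.
From mathcomp Require Import zify ring.

Set Implicit Arguments.
Unset Strict Implicit.
Unset Printing Implicit Defensive.

Import Order.TTheory GRing.Theory Num.Theory.

(** * Boxes and the exactness of their strands *)

(** Geometry reduces to finite sets because a point of a cell determines its weights in every row:
    the rows are ordered, so the total weight below each threshold fixes the weights row by row.
    Hence inclusions and intersections of cells are those of their index sets. The resolution must
    be checked for every incidence function, so exactness uses only what the axioms give:
    coefficients of square 1 and the diamond identities. Explicit signs serve only to show that an
    incidence function exists. The axioms also involve the empty face, and this part of them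
    controls the augmentation. The generators of the ideal come as words [x_(g_1) ... x_(g_d)] with
    [g_j <= mu_j] in any order, while the vertices are increasing words. Sorting a word preserves
    its bounds, and this links the ideal to the complex. *)

Section Boxes.
Variables (d n : nat).
Implicit Types (A B C : {set 'I_d * 'I_n}) (p q : 'I_d * 'I_n) (mu : 'I_d -> 'I_n).

Definition has_rows A := [forall j, [exists a, (j, a) \in A]].

Definition increasing A :=
  [forall p in A, forall q in A, (p.1 < q.1) ==> (p.2 <= q.2)].

Definition staircase A := has_rows A && increasing A.

Definition box (mu : 'I_d -> 'I_n) A :=
  staircase A && [forall p in A, p.2 <= mu p.1].

(* Within a fixed complex, cells of consecutive dimensions have index sets of
   consecutive sizes: the cell of [A] has dimension [#|A| - d]. *)
Definition facet B A := (B \subset A) && (#|A| == #|B|.+1).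

Definition label A : 'X_{1..n} := (\sum_(p in A) U_(p.2))%MM.

Lemma has_rowsP A : reflect (forall j, exists a, (j, a) \in A) (has_rows A).
Proof. by apply: (iffP forallP) => h j; apply/existsP/h. Qed.

Lemma increasingP A :
  reflect {in A &, forall p q, p.1 < q.1 -> p.2 <= q.2} (increasing A).
Proof.
apply: (iffP forall_inP) => [h p q pA qA | h p pA].
  by move/forall_inP: (h p pA) => /(_ q qA)/implyP.
by apply/forall_inP => q qA; apply/implyP/h.
Qed.

Lemma boxP mu A :
  reflect [/\ has_rows A, increasing A & {in A, forall p, p.2 <= mu p.1}]
          (box mu A).
Proof.
rewrite /box /staircase.
apply: (iffP andP) => [[/andP[h1 h2] /forall_inP h3]|[h1 h2 h3]] //.
by split; [apply/andP | apply/forall_inP].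
Qed.

Lemma has_rowsS A B : B \subset A -> has_rows B -> has_rows A.
Proof.
move=> /fintype.subsetP sBA /has_rowsP hB; apply/has_rowsP => j.
by have [a /sBA] := hB j; exists a.
Qed.

Lemma increasingS A B : B \subset A -> increasing A -> increasing B.
Proof.
move=> /fintype.subsetP sBA /increasingP hA; apply/increasingP => p q pB qB.
by apply: hA; apply: sBA.
Qed.

Lemma staircaseS A B : B \subset A -> has_rows B -> staircase A -> staircase B.
Proof. by move=> sBA hB /andP[_ iA]; rewrite /staircase hB (increasingS sBA). Qed.

Lemma boxS mu A B : B \subset A -> has_rows B -> box mu A -> box mu B.
Proof.
move=> sBA hB /boxP[_ iA lA]; apply/boxP; split=> //; first exact: increasingS iA.
by move=> p /(fintype.subsetP sBA)/lA.
Qed.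

Lemma labelE A t : label A t = #|[set q in A | q.2 == t]|.
Proof.
rewrite /label mnm_sumE -sum1_card big_mkcond [RHS]big_mkcond /=.
apply: eq_bigr => q _; rewrite inE mnm1E.
by case: (q \in A) => //=; case: eqP.
Qed.

Lemma labelS A B : B \subset A -> (label B <= label A)%MM.
Proof.
move=> sBA; apply/mnm_lepP => t; rewrite !labelE; apply: subset_leq_card.
by apply/fintype.subsetP => q; rewrite !inE => /andP[/(fintype.subsetP sBA) -> ->].
Qed.

Lemma label_setD1 A p : p \in A -> label A = (U_(p.2) + label (A :\ p))%MM.
Proof. by move=> pA; rewrite /label (big_setD1 p). Qed.

Lemma facetP B A : reflect (exists2 p, p \in A & B = A :\ p) (facet B A).
Proof.
apply: (iffP andP) => [[sBA /eqP cA]|[p pA ->]]; last first.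
  by rewrite subD1set (cardsD1 p A) pA.
have /cards1P[p Dp] : #|A :\: B| == 1 by rewrite cardsDS // cA subSnn.
have : p \in A :\: B by rewrite Dp inE.
rewrite inE => /andP[pB pA]; exists p => //.
by apply/eqP; rewrite eqEcard subsetD1 sBA pB /= -ltnS -cA (cardsD1 p A) pA.
Qed.

Lemma facet_setD1 A p : p \in A -> facet (A :\ p) A.
Proof. by move=> pA; apply/facetP; exists p. Qed.

Lemma has_rows_card A : has_rows A -> d <= #|A|.
Proof.
move=> /has_rowsP hA; suff sT : [set: 'I_d] \subset fst @: A.
  have := leq_trans (subset_leq_card sT) (leq_imset_card _ _).
  by rewrite cardsT card_ord.
by apply/fintype.subsetP => j _; have [a ja] := hA j; apply/imsetP; exists (j, a).
Qed.

Lemma has_rows_setD1 A p a :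
  has_rows A -> (p.1, a) \in A -> a != p.2 -> has_rows (A :\ p).
Proof.
move=> /has_rowsP hA paA nap; apply/has_rowsP => j.
have [->|nj] := eqVneq j p.1.
  by exists a; rewrite finset.in_setD1 paA andbT; apply: contra nap => /eqP <-.
have [b jb] := hA j; exists b; rewrite finset.in_setD1 jb andbT.
by apply: contra nj => /eqP <-.
Qed.

(** Pigeonhole on the row indices. If all rows are nonempty, either of the two elements can then be
    deleted without emptying a row. *)
Lemma wide_row A : d < #|A| ->
  exists p q, [/\ p \in A, q \in A, p.1 = q.1 & p != q].
Proof.
move=> cA; have [/dinjectiveP inj|] := boolP (dinjectiveb fst (mem A)).
  have := max_card (mem (fst @: A)).
  by rewrite card_in_imset // card_ord leqNgt cA.
by case/dinjectivePn => p pA [q /andP[nqp qA] e]; exists p, q; rewrite eq_sym.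
Qed.

Lemma card_has_rows_eq A :
  has_rows A -> #|A| = d -> forall j a b, (j, a) \in A -> (j, b) \in A -> a = b.
Proof.
move=> hA cA j a b ja jb; apply/eqP/negPn/negP => nab.
have := has_rows_card (has_rows_setD1 (p := (j, a)) hA jb _).
rewrite eq_sym nab => /(_ isT); rewrite leqNgt => /negP[].
by rewrite -[X in _ < X]cA (cardsD1 (j, a) A) ja.
Qed.

Lemma facet_trans_card A B C : facet B A -> facet C B -> #|A| = #|C|.+2.
Proof. by move=> /andP[_ /eqP->] /andP[_ /eqP->]. Qed.

End Boxes.

(** * Acyclicity of the multigraded strands *)

Section Strands.
Variables (d n : nat) (mu : 'I_d -> 'I_n) (k : fieldType).
Implicit Types (A B C : {set 'I_d * 'I_n}) (p q : 'I_d * 'I_n).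
Variable E : {set 'I_d * 'I_n} -> {set 'I_d * 'I_n} -> k.

(* The last clause is the diamond condition above the empty face. *)
Definition box_incidence : Prop :=
  [/\ forall A B, E A B != 0 -> [/\ box mu A, box mu B & facet B A],
      forall A B, box mu A -> box mu B -> facet B A -> E A B * E A B = 1,
      forall A B1 B2 C, box mu A -> box mu C -> B1 != B2 ->
        facet B1 A -> facet B2 A -> facet C B1 -> facet C B2 ->
        E A B1 * E B1 C + E A B2 * E B2 C = 0 &
      forall A B1 B2, box mu A -> box mu B1 -> box mu B2 -> B1 != B2 ->
        facet B1 A -> facet B2 A -> #|A| = d.+1 -> E A B1 + E A B2 = 0]%R.

Definition boundary (z : {set 'I_d * 'I_n} -> k) B : k := (\sum_A z A * E A B)%R.

Hypothesis incE : box_incidence.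

Local Open Scope ring_scope.

(** Between [B] and [A] in codimension two lie only two sets, each lacking one of the two missing
    elements. Both contain [B], hence keep all rows, so the diamond identity covers the whole
    sum. *)
Lemma boundary_boundary z B : boundary (boundary z) B = 0.
Proof.
have [E0 _ EE _] := incE; have D B0 : boundary (boundary z) B0 = \sum_A z A * \sum_C
  E A C * E C B0.
  rewrite /boundary; under eq_bigr do rewrite mulr_suml.
  rewrite exchange_big; apply: eq_bigr => A _ /=.
  by rewrite mulr_sumr; apply: eq_bigr => C _; rewrite mulrA.
rewrite D big1 // => A _; suff -> : \sum_C E A C * E C B = 0 by rewrite mulr0.
have [/existsP[C nz]|/existsPn hz] := boolP [exists C, E A C * E C B != 0];
  last by apply: big1 => C _; apply/eqP; rewrite -[_ == 0]negbK hz.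
have [/E0[bA bC fAC] /E0[_ bB fCB]] : E A C != 0 /\ E C B != 0.
  by move: nz; rewrite mulf_eq0 => /norP[].
have [p pA DC] := facetP _ _ fAC; have [q qC DB] := facetP _ _ fCB.
move: (qC); rewrite DC finset.in_setD1 => /andP[nqp qA].
have sBC : B \subset A :\ q by rewrite DB DC !finset.setDDl finset.setUC
  -!finset.setDDl subD1set.
have bq : box mu (A :\ q).
  by apply: boxS bA; [exact: subD1set | apply: has_rowsS sBC _; case/boxP: bB].
have fBq : facet B (A :\ q).
  by apply/facetP; exists p; rewrite ?DB ?DC ?finset.setDDl 1?finset.setUC // !inE
    eq_sym nqp.
have nC : C != A :\ q by rewrite DC; apply: contraTneq qC => DC';
  rewrite DC DC' !inE eqxx.
rewrite (bigD1 C) // (bigD1 (A :\ q)) 1?eq_sym //= big1 ?addr0.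
  by apply: EE => //; exact: facet_setD1.
move=> C' /andP[nC' nC'q]; apply/eqP/negPn/negP => nz'.
have [/E0[_ _ fC'] /E0[_ _ fB]] : E A C' != 0 /\ E C' B != 0.
  by move: nz'; rewrite mulf_eq0 => /norP[].
have [p' p'A DC'] := facetP _ _ fC'.
have : p' \notin B by apply/negP => /(fintype.subsetP (andP fB).1);
  rewrite DC' !inE eqxx.
rewrite DB DC !inE p'A andbT negb_and !negbK => /orP[] /eqP Dp.
  by rewrite DC' Dp eqxx in nC'q.
by rewrite DC' Dp DC eqxx in nC'.
Qed.

(** A box with [d.+1] elements has exactly one row with two elements, and only these can be deleted:
    an edge has two ends, with opposite coefficients. This says that the augmentation kills
    boundaries. *)
Lemma sum_boundary z : (forall A, z A != 0 -> #|A| = d.+1) ->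
  \sum_B boundary z B = 0.
Proof.
have [E0 _ _ Ee] := incE => zd; rewrite exchange_big big1 //= => A _.
rewrite -mulr_sumr; have [->|/zd cA] := eqVneq (z A) 0; first by rewrite mul0r.
suff -> : \sum_B E A B = 0 by rewrite mulr0.
have [/existsP[B nz]|/existsPn hz] := boolP [exists B, E A B != 0];
  last by apply: big1 => B _; apply/eqP; rewrite -[_ == 0]negbK hz.
have [bA bB fBA] := E0 _ _ nz; have [hA _ _] := boxP _ _ bA.
have [|p [q [pA qA epq npq]]] := @wide_row _ _ A; first by rewrite cA.
have nq2 : q.2 != p.2.
  apply: contraNneq npq => e2.
  by rewrite [p]surjective_pairing [q]surjective_pairing epq e2.
have hp : has_rows (A :\ p).
  by apply: (has_rows_setD1 hA) nq2; rewrite epq -surjective_pairing.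
have hq : has_rows (A :\ q).
  by apply: (has_rows_setD1 hA) (_ : p.2 != _);
    rewrite 1?eq_sym // -epq -surjective_pairing.
have bp : box mu (A :\ p) := boxS (subD1set _ _) hp bA.
have bq : box mu (A :\ q) := boxS (subD1set _ _) hq bA.
have npq' : A :\ q != A :\ p.
  apply/eqP => e; have : p \in A :\ q by rewrite !inE npq.
  by rewrite e !inE eqxx.
rewrite (bigD1 (A :\ p)) // (bigD1 (A :\ q)) //= big1 ?addr0.
  by apply: Ee bA bp bq _ _ _ cA => //; rewrite ?facet_setD1 // eq_sym.
move=> C /andP[nCp nCq]; apply/eqP/negPn/negP => /E0[_ bC /facetP[r rA DC]].
have nr x : A :\ x != C -> x != r by move=> h; apply: contraNneq h => ->; rewrite DC.
have cC : #|C| = d.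
  by apply/eqP; have := cA; rewrite (cardsD1 r A) rA add1n DC => -[->].
have [hC _ _] := boxP _ _ bC.
have := card_has_rows_eq hC cC (j := p.1) (a := p.2) (b := q.2).
rewrite {2}epq -!surjective_pairing DC !finset.in_setD1 pA qA !andbT !nr 1?eq_sym //.
by move=> /(_ isT isT) e2; rewrite e2 eqxx in nq2.
Qed.

Implicit Types (alpha : 'X_{1..n}) (T : 'I_d -> 'I_n) (z : {set 'I_d * 'I_n} -> k).

(** Chains of dimension [N - d] on the subcomplex of cells whose label divides [x^alpha]; this is
    the part of multidegree [alpha] of the cellular complex. *)
Definition strand alpha N z : Prop :=
  forall A, z A != 0 -> [/\ box mu A, #|A| = N & (label A <= alpha)%MM].

(** On vertices, where [N = d], [boundary] vanishes identically because [E] does not see the empty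
    face; the cycle condition there is that of the augmented complex. *)
Definition strand_cycle N z : Prop :=
  if N == d then \sum_A z A = 0 else forall B, boundary z B = 0.

Definition pinned r T A : Prop :=
  forall q, (q.1 < r)%N -> (q \in A) = (q.2 == T q.1).

(** The exponent of [t] in the product of the letters pinned in the rows before [r]. Instead of
    dropping a row and lowering the multidegree, all [d] rows and [alpha] are kept, and the exponent
    left for the remaining rows is [alpha t] minus this number. *)
Definition pin_mult r T t : nat :=
  #|[set q : 'I_d * 'I_n | [&& (q.1 < r)%N, q.2 == T q.1 & q.2 == t]]|.

Lemma label_pinned r T A t : pinned r T A ->
  label A t = (pin_mult r T t + #|[set q in A | (r <= q.1)%N && (q.2 == t)]|)%N.
Proof.
move=> pA; rewrite labelE -(cardsID [set q : 'I_d * 'I_n | (q.1 < r)%N]).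
congr (_ + _)%N; apply: eq_card => q; rewrite !inE.
  by case: (ltnP q.1 r) => [/pA->|_]; rewrite ?andbT ?andbF.
by rewrite -leqNgt andbCA.
Qed.

Lemma boundaryB z y B : boundary (fun A => z A - y A) B = boundary z B - boundary y B.
Proof. by rewrite /boundary -sumrB; apply: eq_bigr => A _; rewrite mulrBl. Qed.

Lemma strand_boundary alpha N y : strand alpha N.+1 y -> strand alpha N (boundary y).
Proof.
have [E0 _ _ _] := incE => sy B.
have [/existsP[A nz] _|/existsPn hz] := boolP [exists A, y A * E A B != 0]; last first.
  by rewrite /boundary big1 ?eqxx // => A _; apply/eqP; rewrite -[_ == 0]negbK hz.
move: nz; rewrite mulf_eq0 => /norP[/sy[bA cA lA] /E0[_ bB /andP[sBA cB]]].
split=> //; first by apply/eqP; move: cB; rewrite cA eqSS eq_sym.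
exact: lepm_trans (labelS sBA) lA.
Qed.

Lemma strand_cycleB alpha N z y : strand alpha N.+1 y ->
  strand_cycle N z -> strand_cycle N (fun A => z A - boundary y A).
Proof.
move=> sy; rewrite /strand_cycle; case: eqP => [Nd hz|_ hz B].
  by rewrite sumrB hz sum_boundary ?subr0 // => A /sy[_ ->]; rewrite Nd.
by rewrite boundaryB hz boundary_boundary subr0.
Qed.

(* [T' r] is the least letter of [alpha] not yet used by the first [r] rows.
   Toggling the element [(r, T' r)] is always possible, and cancels everything
   except the boxes whose row [r] is [{T' r}]. *)
Lemma strand_step alpha N z r T : (r < d)%N ->
    strand alpha N z -> strand_cycle N z -> (exists A, z A != 0) ->
    (forall A, z A != 0 -> pinned r T A) ->
    (forall (j : 'I_d) (t : 'I_n), (j < r)%N -> (t < T j)%N ->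
      (alpha t <= pin_mult r T t)%N) ->
  exists T' y, [/\ strand alpha N.+1 y,
    forall A, z A - boundary y A != 0 -> pinned r.+1 T' A &
    forall (j : 'I_d) (t : 'I_n), (j < r.+1)%N -> (t < T' j)%N ->
      (alpha t <= pin_mult r.+1 T' t)%N].
Proof.
have [E0 E1 _ _] := incE => rd sz cz [A0 nzA0] pz pre.
pose j0 := Ordinal rd.
have free A q : z A != 0 -> q \in A -> (r <= q.1)%N ->
    (pin_mult r T q.2 < alpha q.2)%N.
  move=> nzA qA rq; have [_ _ /mnm_lepP/(_ q.2)] := sz A nzA.
  apply: leq_trans; rewrite (label_pinned _ (pz A nzA)) -addn1 leq_add2l card_gt0.
  by apply/finset.set0Pn; exists q; rewrite inE qA rq eqxx.
have row A : z A != 0 -> exists2 a, (j0, a) \in A & (pin_mult r T a < alpha a)%N.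
  move=> nzA; have [/boxP[/has_rowsP/(_ j0)[a ja] _ _] _ _] := sz A nzA.
  by exists a => //; apply: (free A (j0, a)) => //=.
have [a0 _ ha0] := row A0 nzA0.
(* The least letter with some exponent left. By [free] it is at most every entry of the rows from
   [r] on, and by [pre] at least every pinned letter, so adding it to row [r] keeps the rows
   increasing. *)
have [t ht tmin] := @arg_minnP _ a0 (fun a => pin_mult r T a < alpha a)%N val ha0.
pose p := (j0, t).
have tfree A q : z A != 0 -> q \in A -> (r <= q.1)%N -> (t <= q.2)%N.
  by move=> nzA qA rq; apply: tmin; apply: free nzA _ _.
have Tt (j : 'I_d) : (j < r)%N -> (T j <= t)%N.
  by move=> jr; rewrite leqNgt; apply: contraL ht => /(pre _ _ jr); rewrite leqNgt.
have grow A : z A != 0 -> p \notin A -> box mu (p |: A).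
  move=> nzA pA; have [/boxP[hA /increasingP iA lA] _ _] := sz A nzA.
  apply/boxP; split; first exact: has_rowsS (finset.subsetUr _ _) hA.
    apply/increasingP => q1 q2 /finset.setU1P[->|q1A] /finset.setU1P[->|q2A] //=.
    - by move=> rq; apply: tfree nzA q2A (ltnW rq).
    - by move=> qr; move: q1A; rewrite (pz A nzA) // => /eqP->; apply: Tt.
    - exact: iA.
  move=> q /finset.setU1P[->|/lA //] /=; have [a ja _] := row A nzA.
  exact: leq_trans (tfree A (j0, a) nzA ja (leqnn r)) (lA _ ja).
(* The homotopy of the matching, coning [A :\ p] to [A]. As the coefficient has square 1,
   [boundary y] agrees with [z] on the sets that avoid [p]. *)
pose y A := if p \in A then E A (A :\ p) * z (A :\ p) else 0.
have y0 A : y A != 0 -> [/\ p \in A, E A (A :\ p) != 0 & z (A :\ p) != 0].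
  rewrite /y; case: ifP => [pA|_]; last by rewrite eqxx.
  by rewrite mulf_eq0 => /norP[].
have sy : strand alpha N.+1 y.
  move=> A /y0[pA /E0[bA _ _] nz]; split=> //.
    by have [_ cA _] := sz _ nz; rewrite (cardsD1 p) pA cA.
  have [/boxP[_ /increasingP iA _] _ /mnm_lepP lA] := sz _ nz.
  apply/mnm_lepP => a; rewrite (label_setD1 pA) mnmDE mnm1E /=.
  have [<-|_] := eqVneq t a; last exact: lA.
  (* The letter [t] is absent from the rows of [A :\ p] from [r] on: row [r] contains some [b > t]
     and later rows lie above [b]. Its multiplicity is thus [pin_mult], and one more still fits in
     [alpha]. *)
  rewrite add1n (label_pinned t (pz _ nz)) [X in (_ + X)%N](_ : _ = 0%N) ?addn0 //.
  apply/eqP; rewrite cards_eq0; apply/eqP/setP => q;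
    rewrite finset.in_set0 finset.in_set.
  apply/negP => /and3P[qA rq /eqP qt]; have [b jb _] := row _ nz.
  have tb : (t < b)%N.
    rewrite ltn_neqAle (tfree _ (j0, b) nz jb) //= andbT.
    by apply: contraTneq jb => /val_inj <-; rewrite !inE eqxx.
  move: rq; rewrite leq_eqVlt => /orP[/eqP rq|rq].
    move: qA; rewrite finset.in_setD1 => /andP[/negP[]]; apply/eqP.
    by rewrite [q]surjective_pairing qt; congr pair; apply: val_inj.
  by have := iA _ _ jb qA rq; rewrite /= qt leqNgt tb.
pose T' j := if j == j0 then t else T j; pose z1 A := z A - boundary y A.
have T'E (j : 'I_d) : (j < r)%N -> T' j = T j.
  by move=> jr; rewrite /T'; case: eqP jr => // ->; rewrite /= ltnn.
have z1p A : p \notin A -> z1 A = 0.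
  move=> pA; rewrite /z1 /boundary (bigD1 (p |: A)) //= big1 => [|A' nA'].
    rewrite /y setU11 finset.setU1K // addr0.
    have [->|nzA] := eqVneq (z A) 0; first by rewrite mulr0 mul0r subrr.
    have [bA _ _] := sz A nzA; rewrite mulrAC E1 ?mul1r ?subrr ?grow //.
    by apply/facetP; exists p; rewrite ?setU11 ?finset.setU1K.
  apply/eqP/negPn/negP; rewrite mulf_eq0 =>
    /norP[/y0[pA' _ _] /E0[_ _ /facetP[x xA' DA]]].
  have px : p = x by apply/eqP/negPn/negP => npx; rewrite DA !inE npx pA' in pA.
  by rewrite DA px finset.setD1K ?eqxx in nA'.
have sz1 : strand alpha N z1.
  move=> A; rewrite /z1; have [->|/sz //] := eqVneq (z A) 0.
  by rewrite sub0r oppr_eq0; apply: strand_boundary.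
(* In the cycle condition at [A :\ p] only the term of [A] can be nonzero, since every other set
   with this facet avoids [p]. *)
have z1row A : p \in A -> has_rows (A :\ p) -> z1 A = 0.
  move=> pA hA; apply/eqP/negPn/negP => nz; have [bA cA _] := sz1 A nz.
  have bp := boxS (subD1set A p) hA bA.
  have : strand_cycle N z1 := strand_cycleB sy cz; rewrite /strand_cycle.
  have /gtn_eqF -> : (d < N)%N by rewrite -cA (cardsD1 p) pA ltnS has_rows_card.
  move/(_ (A :\ p)); rewrite /boundary (bigD1 A) //= big1 => [/eqP|A' nA'].
    rewrite addr0 mulf_eq0 (negPf nz) /= => /eqP e0.
    by have := E1 _ _ bA bp (facet_setD1 pA); rewrite e0 mul0r => /esym/eqP;
      rewrite oner_eq0.
  have [pA'|/z1p-> //] := boolP (p \in A'); last by rewrite mul0r.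
  apply/eqP/negPn/negP; rewrite mulf_eq0 => /norP[_ /E0[_ _ /facetP[x xA' DA]]].
  have px : p = x.
    apply/eqP/negPn/negP => npx; have := setD11 p A.
    by rewrite DA !inE npx pA'.
  by rewrite -[A](finset.setD1K pA) DA px finset.setD1K ?eqxx in nA'.
(* A surviving set contains [p] and cannot lose it without emptying a row, so its row [r] is
   [{t}]. *)
exists T', y; split=> // [A nz|j a].
  have [/boxP[hA _ _] _ _] := sz1 A nz.
  have pA : p \in A by apply: contraR nz => /z1p/eqP.
  have pin : pinned r T A.
    have [zA|/pz //] := eqVneq (z A) 0.
    move: nz; rewrite /z1 zA sub0r oppr_eq0.
    have [/existsP[A' nz _]|/existsPn hz] := boolP [exists A', y A' * E A' A != 0];
      last first.
      by rewrite /boundary big1 ?eqxx // => A' _; apply/eqP; rewrite -[_ == 0]negbK hz.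
    move: nz; rewrite mulf_eq0 => /norP[/y0[_ _ nz] /E0[_ _ /andP[sAA' _]]].
    have sub q : (q.1 < r)%N -> q \in A -> q.2 == T q.1.
      move=> qr qA; rewrite -(pz _ nz) // finset.in_setD1 (fintype.subsetP sAA') //
        andbT.
      by apply: contraTneq qr => ->; rewrite ltnn.
    move=> q qr; apply/idP/idP => [|/eqP qT]; first exact: sub.
    have /has_rowsP/(_ q.1)[a qa] := hA.
    by rewrite [q]surjective_pairing qT -(eqP (sub (q.1, a) qr qa)).
  move=> q; rewrite ltnS leq_eqVlt => /orP[/eqP qr|qr].
    have Dq : q = (j0, q.2) by rewrite [q]surjective_pairing; congr pair;
      apply: val_inj.
    rewrite Dq /T' /= eqxx; apply/idP/eqP => [qA|-> //].
    apply: contraNeq nz => nqt; apply/eqP/z1row => //.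
    exact: (has_rows_setD1 hA (p := p) qA nqt).
  by rewrite pin // T'E.
have le_pin : (pin_mult r T a <= pin_mult r.+1 T' a)%N.
  apply: subset_leq_card; apply/fintype.subsetP => q;
    rewrite !inE => /and3P[qr /eqP qT qa].
  by rewrite ltnS (ltnW qr) qa T'E // qT eqxx.
rewrite ltnS leq_eqVlt => /orP[/eqP jr|jr].
  have -> : j = j0 by apply: val_inj.
  rewrite /T' eqxx => ta; apply: leq_trans le_pin; rewrite leqNgt.
  by apply: contraL ta => /tmin; rewrite -leqNgt.
by rewrite T'E // => aT; apply: leq_trans le_pin; apply: pre aT.
Qed.

(** Each use of [strand_step] pins one more row and changes the cycle by a boundary. Once all rows
    are pinned at most one vertex is left, and a vanishing sum of coefficients forces its
    coefficient to be zero. *)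
Lemma strand_exact alpha N z : (d <= N)%N -> strand alpha N z -> strand_cycle N z ->
  exists2 y, strand alpha N.+1 y & forall B, boundary y B = z B.
Proof.
move=> dN sz cz.
suff main r : (r <= d)%N -> forall T z', strand alpha N z' -> strand_cycle N z' ->
    (forall A, z' A != 0 -> pinned r T A) ->
    (forall (j : 'I_d) (t : 'I_n), (j < r)%N -> (t < T j)%N ->
      (alpha t <= pin_mult r T t)%N) ->
    exists2 y, strand alpha N.+1 y & forall B, boundary y B = z' B.
  (* No row is pinned at the start, so the conditions hold vacuously; [mu] is just some function of
     the right type. *)
  exact: (main 0 _ mu).
elim: {r}(d - r)%N {-2}r (erefl (d - r)%N) => [|c IHc] r Dc rd T z' sz' cz' pz' pre;
  have [/existsP ex|/existsPn z0] := boolP [exists A, z' A != 0]; last 1 first.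
- exists (fun=> 0) => [A|B]; first by rewrite eqxx.
  rewrite /boundary big1 => [|A _]; last by rewrite mul0r.
  by apply/esym/eqP; rewrite -[_ == 0]negbK z0.
- have rd' : r = d by apply/eqP; rewrite eqn_leq rd -subn_eq0 Dc eqxx.
  case: ex => A nz; pose A1 := [set (j, T j) | j : 'I_d].
  have DA B : z' B != 0 -> B = A1.
    move=> /pz' pB; apply/setP => q; rewrite pB ?rd' //.
    apply/eqP/imsetP => [qT|[j _ ->] //].
    by exists q.1; rewrite // -qT -surjective_pairing.
  have cA : #|A1| = d by rewrite card_imset ?card_ord // => i j [].
  have [_ cN _] := sz' _ nz; move: cz'; rewrite /strand_cycle -cN (DA _ nz) cA eqxx.
  rewrite (bigD1 A1) //= big1 => [|B nB]; last first.
    by apply/eqP; apply: contraNT nB => /DA->.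
  by rewrite -(DA _ nz) addr0 => /eqP; rewrite (negPf nz).
- exists (fun=> 0) => [A|B]; first by rewrite eqxx.
  rewrite /boundary big1 => [|A _]; last by rewrite mul0r.
  by apply/esym/eqP; rewrite -[_ == 0]negbK z0.
have rd' : (r < d)%N by rewrite -subn_gt0 Dc.
have [T' [y [sy pz1 pre1]]] := strand_step rd' sz' cz' ex pz' pre.
have sz1 : strand alpha N (fun A => z' A - boundary y A).
  move=> A; have [->|/sz' //] := eqVneq (z' A) 0.
  by rewrite sub0r oppr_eq0; apply: strand_boundary.
have [|y' sy' Dy'] := IHc r.+1 _ rd' T' _ sz1 (strand_cycleB sy cz') pz1 pre1.
  by rewrite subnS Dc.
exists (fun A => y' A + y A) => [A|B].
  have [->|/sy' //] := eqVneq (y' A) 0; rewrite add0r; exact: sy.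
rewrite /boundary (eq_bigr (fun A => y' A * E A B + y A * E A B)) => [|A _].
  by rewrite big_split /= -/(boundary y' B) Dy' subrK.
by rewrite mulrDl.
Qed.

End Strands.

Local Open Scope classical_set_scope.
Local Open Scope ring_scope.

(** * Monomial ideals *)

Section MonomialIdeals.
Variables (k : fieldType) (n : nat).
Local Notation S := {mpoly k[n]}.
Implicit Types (I J : set S) (A B : set 'X_{1..n}) (u v m : 'X_{1..n}) (f g : S).

Lemma ideal_gen_ideal (B : set S) : is_ideal (ideal_gen B).
Proof.
split=> [J [[J0 _ _] _]|f g hf hg J JP|f g hg J JP] //; have [[_ JD JM] _] := JP.
  by apply: JD; [apply: hf | apply: hg].
by apply: JM; apply: hg.
Qed.

Lemma sub_ideal_gen (B : set S) : B `<=` ideal_gen B.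
Proof. by move=> f Bf J [_]; apply. Qed.

Lemma ideal_gen_min (B I : set S) : is_ideal I -> B `<=` I -> ideal_gen B `<=` I.
Proof. by move=> idI sBI f; apply. Qed.

Lemma ideal_sum I (T : Type) (r : seq T) (P : pred T) (F : T -> S) :
  is_ideal I -> (forall i, P i -> I (F i)) -> I (\sum_(i <- r | P i) F i).
Proof. by move=> [I0 ID _] h; elim/big_ind: _. Qed.

Definition divisible A m : Prop := exists2 a, A a & (a <= m)%MM.

Lemma support_ideal A : is_ideal [set f : S | forall m, m \in msupp f -> divisible A m].
Proof.
split=> [m|f g hf hg m|f g hg m]; first by rewrite msupp0.
  by move/msuppD_le; rewrite mem_cat => /orP[/hf|/hg].
move/msuppM_le => /allpairsP[[m1 m2] /= [_ /hg[a Aa am2] ->]].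
by exists a => //; apply: lepm_trans am2 (lem_addl _ _).
Qed.

(** A generated ideal lies in every ideal containing the generators, and the polynomials with
    divisible support form such an ideal. *)
Lemma monomial_genP A f :
  monomial_gen A f <-> (forall m, m \in msupp f -> divisible A m).
Proof.
split=> [|h].
  move: f; apply: (ideal_gen_min (support_ideal A)).
  move=> _ [a Aa <-] m; rewrite msuppX inE => /eqP->.
  by exists a; rewrite ?lepm_refl.
rewrite [f]mpolyE big_seq; apply: ideal_sum; first exact: ideal_gen_ideal.
move=> m /h[a Aa am]; have [_ _ gM] := ideal_gen_ideal [set ('X_[m] : S) | m in A].
rewrite -(submK am) mpolyXD -mul_mpolyC mulrA.
by apply: gM; apply: sub_ideal_gen; exists a.
Qed.

Lemma monomial_genX A u : monomial_gen A ('X_[u] : S) <-> divisible A u.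
Proof.
rewrite monomial_genP; split=> [|h m]; last by rewrite msuppX inE => /eqP->.
by apply; rewrite msuppX inE.
Qed.

Lemma ideal_mul_monomial_gen A B :
  ideal_mul (monomial_gen A) (monomial_gen B) =
  monomial_gen [set (a + b)%MM | a in A & b in B] :> set S.
Proof.
apply/seteqP; split; apply: ideal_gen_min; try exact: ideal_gen_ideal.
  move=> _ [f /monomial_genP hf [g /monomial_genP hg <-]]; apply/monomial_genP => m.
  move/msuppM_le => /allpairsP[[m1 m2] /= [/hf[a Aa am1] /hg[b Bb bm2] ->]].
  exists (a + b)%MM; first by exists a => //; exists b.
  by apply/mnm_lepP => i; rewrite !mnmDE leq_add ?(mnm_lepP am1) ?(mnm_lepP bm2).
move=> _ [_ [a Aa [b Bb <-]] <-]; rewrite mpolyXD; apply: sub_ideal_gen.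
exists 'X_[a]; first by apply: sub_ideal_gen; exists a.
by exists 'X_[b] => //; apply: sub_ideal_gen; exists b.
Qed.

Lemma mingens_mem I m : monomial_ideal I -> mingens I m -> I 'X_[m].
Proof. by move=> [A DI] h; rewrite DI; apply: sub_ideal_gen; exists m => //;
  apply: h. Qed.

(** [mingens] is an intersection over all generating sets. A divisor of [u] in [I] that has no
    proper divisor in [I] must belong to each of them. *)
Lemma mingens_divisor I u : monomial_ideal I -> I 'X_[u] ->
  exists2 m, mingens I m & (m <= u)%MM.
Proof.
move=> mI; have [c] := ubnP (mdeg u); elim: c u => // c IHc u le_uc Iu.
have [[v [vu nvu Iv]]|none] := pselect (exists v, [/\ (v <= u)%MM, v != u & I 'X_[v]]).
  have [|m gm mv] := IHc v _ Iv; last by exists m => //; apply: lepm_trans mv vu.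
  apply: (@leq_trans (mdeg u)) => //; rewrite -(submK vu) mdegD -[ltnLHS]add0n
    ltn_add2r.
  rewrite lt0n mdeg_eq0; apply: contra nvu => /eqP uv0.
  by rewrite -(submK vu) uv0 add0m.
exists u; last exact: lepm_refl.
move=> A DI; move: (Iu); rewrite -DI => /monomial_genX[a Aa au].
suff <- : a = u by [].
apply/eqP/negPn/negP => nau; apply: none; exists a; split=> //.
by rewrite -DI; apply: sub_ideal_gen; exists a.
Qed.

(** The definition exchanges variables in minimal generators only. Take a generator [m] dividing
    [u]: if [t] occurs in [m], exchange there; otherwise [m] still divides the exchanged
    monomial. *)
Lemma borel_fixed_exchange I u (t s : 'I_n) : borel_fixed I -> I 'X_[u] ->
  (0 < u t)%N -> (s < t)%N -> I 'X_[u - U_(t) + U_(s)].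
Proof.
move=> [mI bI] Iu ut st; have [m gm mu] := mingens_divisor mI Iu.
have mIm := mingens_mem mI gm; have [A DI] := mI; rewrite DI in mIm *.
have step v : (v <= u - U_(t) + U_(s))%MM -> monomial_gen A ('X_[v] : S) ->
    monomial_gen A ('X_[u - U_(t) + U_(s)] : S).
  move=> vu /monomial_genX[a Aa av]; apply/monomial_genX.
  by exists a => //; apply: lepm_trans av vu.
have [mt|mt] := posnP (m t); last first.
  apply: (step (m - U_(t) + U_(s))%MM); last by rewrite -DI; apply: bI.
  by apply/mnm_lepP => i; rewrite !mnmDE !mnmBE leq_add2r leq_sub2r ?(mnm_lepP mu).
apply: step mIm; apply/mnm_lepP => i; rewrite mnmDE mnmBE !mnm1E.
by have := mnm_lepP mu i; have [<-|] := eqVneq t i; rewrite ?mt //; lia.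
Qed.

(** Monomials of equal degree do not properly divide one another, so every generating set must
    contain all of [A]. *)
Lemma mingens_equigenerated A c : (forall m, A m -> mdeg m = c) ->
  mingens (monomial_gen A : set S) = A.
Proof.
move=> hA; apply/seteqP; split=> [m|m Am B DB]; first by apply.
have /monomial_genX[b Bb bm] : monomial_gen B ('X_[m] : S).
  by rewrite DB; apply: sub_ideal_gen; exists m.
have /monomial_genX[a Aa ab] : monomial_gen A ('X_[b] : S).
  by rewrite -DB; apply: sub_ideal_gen; exists b.
suff <- : b = m by [].
have := congr1 mdeg (submK bm); have := congr1 mdeg (submK ab).
rewrite !mdegD (hA _ Am) (hA _ Aa) => e1 e2.
have /eqP : mdeg (m - b) = 0%N by lia.
by rewrite mdeg_eq0 => /eqP mb; rewrite -(submK bm) mb add0m.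
Qed.

(** The word [g] need not be increasing: this is the form obtained by multiplying out a product of
    variable ideals, and it is stable under lowering a letter. *)
Definition dominated d (mu : 'I_d -> 'I_n) : set 'X_{1..n} :=
  [set m | exists2 g : 'I_d -> 'I_n, forall j, (g j <= mu j)%N &
     m = (\sum_(j < d) U_(g j))%MM].

Lemma dominated_mdeg d (mu : 'I_d -> 'I_n) m : dominated mu m -> mdeg m = d.
Proof.
move=> [g _ ->]; rewrite mdeg_sum (eq_bigr (fun=> 1%N)) => [|j _]; last exact: mdeg1.
by rewrite sum1_card card_ord.
Qed.

(** Lowering a letter preserves domination, which gives Borel fixedness. Conversely, every dominated
    word is reached from [mu] by lowering one letter at a time, and each change is a Borel move. *)
Lemma principal_borel_dominated d (mu : 'I_d -> 'I_n) :
  is_principal_borel (\sum_(j < d) U_(mu j))%MM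
    (monomial_gen (dominated mu) : set S).
Proof.
have gensE : mingens (monomial_gen (dominated mu) : set S) = dominated mu.
  exact: mingens_equigenerated (@dominated_mdeg d mu).
split=> [||J bJ gJ].
- split; first by exists (dominated mu).
  rewrite gensE => _ [g gmu ->] t s gt st.
  apply: sub_ideal_gen; exists (\sum_j U_(g j) - U_(t) + U_(s))%MM => //.
  have [j /eqP gj] : exists j, g j == t.
    apply/existsP; apply: contraTT gt => /existsPn h; rewrite -leqNgt leqn0 mnm_sumE.
    by rewrite big1 // => j _; rewrite mnm1E (negPf (h j)).
  exists (fun i => if i == j then s else g i) => [i|].
    by case: eqP => // ->; apply: ltnW; apply: leq_trans st _; rewrite -gj.
  rewrite (bigD1 j) //= [in RHS](bigD1 j) //= eqxx gj.
  rewrite [(U_(t) + _)%MM]addmC addmK addmC; congr (_ + _)%MM.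
  by apply: eq_bigr => i /negPf->.
- by rewrite gensE; exists mu.
have mJ := bJ.1; have Jmu := mingens_mem mJ gJ.
suff sub (g : 'I_d -> 'I_n) : (forall j, (g j <= mu j)%N) ->
  J 'X_[\sum_(j < d) U_(g j)].
  apply: ideal_gen_min; first by have [A ->] := mJ; apply: ideal_gen_ideal.
  by move=> _ [_ [g gmu ->] <-]; apply: sub.
move=> gmu; pose h c (j : 'I_d) := if (j < c)%N then g j else mu j.
suff Jh c : (c <= d)%N -> J 'X_[\sum_(j < d) U_(h c j)].
  have := Jh d (leqnn d); congr (J 'X_[_]); apply: eq_bigr => j _.
  by rewrite /h ltn_ord.
elim: c => [_|c IHc cd]; first by rewrite (eq_bigr (fun j => U_(mu j)%MM)).
pose j := Ordinal cd; have hj : h c j = mu j by rewrite /h ltnn.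
have hS : h c.+1 j = g j by rewrite /h ltnSn.
have hh i : i != j -> h c.+1 i = h c i.
  by move=> nij; rewrite /h ltnS leq_eqVlt -(inj_eq val_inj) /= in nij *;
    rewrite (negPf nij).
have Jc := IHc (ltnW cd).
have [e|ne] := eqVneq (g j) (mu j).
  rewrite (eq_bigr (fun i => U_(h c i)%MM)) // => i _.
  by have [->|/hh->//] := eqVneq i j; rewrite hS hj e.
have -> : (\sum_i U_(h c.+1 i) = U_(g j) + \sum_(i | i != j) U_(h c i))%MM.
  by rewrite (bigD1 j) //= hS; congr (_ + _)%MM; apply: eq_bigr => i /hh->.
have := borel_fixed_exchange (t := mu j) (s := g j) bJ Jc.
rewrite (bigD1 j) //= hj mnmDE mnm1E eqxx => /(_ isT).
rewrite ltn_neqAle gmu (inj_eq val_inj) ne => /(_ isT).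
by rewrite [(U_(mu j) + _)%MM]addmC addmK addmC.
Qed.

(** Lists replace functions on ['I_d] so that a product of ideals becomes a concatenation of
    words. *)
Definition dominated_seq (l : seq 'I_n) : set 'X_{1..n} :=
  [set m | exists2 g : seq 'I_n, all2 (fun a b : 'I_n => (a <= b)%N) g l &
     m = (\sum_(i <- g) U_(i))%MM].

Lemma dominated_seq_cat l1 l2 :
  [set (a + b)%MM | a in dominated_seq l1 & b in dominated_seq l2] =
  dominated_seq (l1 ++ l2).
Proof.
apply/seteqP; split=> [_ [_ [g1 h1 ->] [_ [g2 h2 ->] <-]]|_ [g h ->]].
  exists (g1 ++ g2); last by rewrite big_cat.
  move: h1 h2; rewrite !all2E => /andP[/eqP s1 a1] /andP[/eqP s2 a2].
  by rewrite !size_cat s1 s2 eqxx zip_cat //= all_cat a1 a2.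
move: h; rewrite -{1}[g](cat_take_drop (size l1)) => h.
have sg : size g = (size l1 + size l2)%N.
  by move: h; rewrite cat_take_drop all2E size_cat => /andP[/eqP].
have st : size (take (size l1) g) = size l1 by rewrite size_takel // sg leq_addr.
move: h; rewrite all2E size_cat st size_drop sg addKn size_cat eqxx zip_cat //
  all_cat /=.
move=> /andP[a1 a2]; exists (\sum_(i <- take (size l1) g) U_(i))%MM.
  by exists (take (size l1) g); rewrite // all2E st eqxx a1.
exists (\sum_(i <- drop (size l1) g) U_(i))%MM; last by rewrite -big_cat cat_take_drop.
by exists (drop (size l1) g); rewrite // all2E size_drop sg addKn eqxx a2.
Qed.

Lemma var_idealE (i : 'I_n) :
  var_ideal i = monomial_gen (dominated_seq [:: i]) :> set S.
Proof.
congr ideal_gen; apply/seteqP; split=> [_ [j ji ->]|_ [_ [g h ->] <-]].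
  exists U_(j)%MM => //; exists [:: j]; rewrite ?big_seq1 //= ji //.
by case: g h => [|j [|? ?]] //=; rewrite ?andbF ?andbT // => ji; exists j;
  rewrite ?big_seq1.
Qed.

Lemma setT_monomial_gen : [set: S] = monomial_gen (dominated_seq [::]).
Proof.
apply/seteqP; split=> // f _; apply/monomial_genP => m _.
exists 0%MM; first by exists [::]; rewrite ?big_nil.
by apply/mnm_lepP => i; rewrite mnm0E.
Qed.

Lemma ideal_exp_var (i : 'I_n) c :
  ideal_exp (var_ideal i) c = monomial_gen (dominated_seq (nseq c i)) :> set S.
Proof.
elim: c => [|c IHc]; first exact: setT_monomial_gen.
by rewrite /ideal_exp iterS -/(ideal_exp _ _) IHc var_idealE ideal_mul_monomial_gen
  dominated_seq_cat.
Qed.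

Lemma prod_var_ideals (T : Type) (r : seq T) (la : T -> 'I_n) (e : T -> nat) :
  \big[@ideal_mul k n/setT]_(j <- r) ideal_exp (var_ideal (la j)) (e j) =
  monomial_gen (dominated_seq (flatten [seq nseq (e j) (la j) | j <- r])).
Proof.
elim: r => [|j r IHr]; first by rewrite big_nil setT_monomial_gen.
by rewrite big_cons IHr ideal_exp_var ideal_mul_monomial_gen dominated_seq_cat.
Qed.

Lemma dominated_seqE d (mu : 'I_d -> 'I_n) l :
  l = [seq mu j | j <- enum 'I_d] -> dominated_seq l = dominated mu.
Proof.
move=> Dl; have sl : size l = d by rewrite Dl size_map size_enum_ord.
apply/seteqP; split=> [_ [g h ->]|_ [g gmu ->]]; last first.
  exists [seq g j | j <- enum 'I_d]; last by rewrite big_map big_enum.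
  rewrite Dl all2E !size_map eqxx zip_map all_map; apply/allP => j _ /=; exact: gmu.
move: h; rewrite all2E => /andP[/eqP sg a].
have sg' : size g = d by rewrite sg sl.
exists (fun j => tnth (Tuple (introT eqP sg')) j) => [j|]; last first.
  exact: (big_tuple _ _ (Tuple (introT eqP sg')) xpredT).
have i0 := mu j; rewrite (tnth_nth i0) /=.
have := all_nthP (i0, i0) a j; rewrite size_zip sg minnn sl => /(_ (ltn_ord j)).
by rewrite nth_zip //= Dl (nth_map j) ?size_enum_ord // nth_ord_enum.
Qed.

End MonomialIdeals.

(** * Cells, their faces and intersections *)

Section Cells.
Variables (R : realType) (d n : nat).
Local Notation V := 'rV[R]_n.
Implicit Types (A B C : {set 'I_d * 'I_n}) (w : 'I_d -> 'I_n -> R).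
Implicit Types (x y : V) (f g : 'I_d -> 'I_n).

Definition weights A w : Prop :=
  [/\ forall j a, 0 <= w j a, forall j, \sum_a w j a = 1 &
      forall j a, (j, a) \notin A -> w j a = 0].

(* The Minkowski sum of the simplices spanned by the rows of [A]. *)
Definition cell A : set V :=
  [set x | exists2 w, weights A w & forall a, x ord0 a = \sum_j w j a].

(** The combinatorial form of a vertex of a product of simplices. *)
Definition section A f : Prop := forall j, (j, f j) \in A.

Definition graph f : {set 'I_d * 'I_n} := [set (j, f j) | j : 'I_d]%SET.

Definition vertex f : V := \row_a \sum_j (f j == a)%:R.

Lemma in_graph f j a : ((j, a) \in graph f) = (f j == a).
Proof. by apply/imsetP/eqP => [[i _ [-> ->]]|<-] //; exists j. Qed.

Lemma graph_sub A f : section A f -> graph f \subset A.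
Proof. by move=> sf; apply/fintype.subsetP => _ /imsetP[j _ ->]. Qed.

Lemma graph_has_rows f : has_rows (graph f).
Proof. by apply/has_rowsP => j; exists (f j); rewrite in_graph. Qed.

Lemma card_graph f : #|graph f| = d.
Proof. by rewrite card_imset ?card_ord // => i j []. Qed.

Lemma has_rows_section A : has_rows A -> exists f, section A f.
Proof. by move=> /has_rowsP h; have [f hf] := choice h; exists f. Qed.

Lemma has_rows_section_at A j a : has_rows A -> (j, a) \in A ->
  exists2 f, section A f & f j = a.
Proof.
move=> /has_rows_section[f sf] ja; exists (fun i => if i == j then a else f i).
  by move=> i; case: eqP => [->|_].
by rewrite eqxx.
Qed.

Lemma sum_delta f j : \sum_a (f j == a)%:R = 1 :> R.
Proof.
rewrite (bigD1 (f j)) //= eqxx big1 ?addr0 // => a.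
by rewrite eq_sym => /negPf->.
Qed.

Lemma weights_section A f : section A f -> weights A (fun j a => (f j == a)%:R).
Proof.
move=> sf; split=> [j a|j|j a]; [exact: ler0n | exact: sum_delta|].
by case: eqP => // <-; rewrite sf.
Qed.

Lemma weights_sub A B w : A \subset B -> weights A w -> weights B w.
Proof.
move=> sAB [w0 w1 wA]; split=> // j a nB; apply: wA.
by apply: contra nB => /(fintype.subsetP sAB).
Qed.

Lemma weights_has_rows A w : weights A w -> has_rows A.
Proof.
move=> [_ w1 wA]; apply/has_rowsP => j.
have [/existsP //|/existsPn h] := boolP [exists a, (j, a) \in A].
have := w1 j; rewrite big1 => [|a _]; last exact: wA.
by move/esym/eqP; rewrite oner_eq0.
Qed.

Lemma cell_sub A B : A \subset B -> cell A `<=` cell B.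
Proof. by move=> sAB x [w hw wx]; exists w => //; apply: weights_sub hw. Qed.

Lemma cell_vertex A f : section A f -> cell A (vertex f).
Proof.
move=> sf; exists (fun j a => (f j == a)%:R); first exact: weights_section.
by move=> a; rewrite mxE.
Qed.

Lemma cell_nonempty A : cell A !=set0 <-> has_rows A.
Proof.
split=> [[x [w /weights_has_rows //]]|/has_rows_section[f sf]].
by exists (vertex f); apply: cell_vertex.
Qed.

Lemma cell_eq0 A : ~~ has_rows A -> cell A = set0.
Proof.
by move=> /negP nA; apply/eqP; apply: contrapT => /negP/set0P/cell_nonempty.
Qed.

Lemma cell_neq0 A : has_rows A -> cell A <> set0.
Proof. by move=> /cell_nonempty/set0P/eqP. Qed.

Lemma graph_increasing A f : section A f -> increasing A -> increasing (graph f).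
Proof. by move=> sf; apply: increasingS; apply: graph_sub. Qed.

(* As the rows of [A] are increasing, the partial sums of the weights below any
   threshold form a sequence 1, ..., 1, theta, 0, ..., 0, which is determined by
   its total. *)
Lemma weights_unique A B w w' : increasing A -> increasing B ->
  weights A w -> weights B w' ->
  (forall a, \sum_j w j a = \sum_j w' j a) -> forall j a, w j a = w' j a.
Proof.
move=> iA iB hw hw' e; pose W (u : 'I_d -> 'I_n -> R) j (t : nat) :=
  \sum_(a : 'I_n | (a < t)%N) u j a.
have W0 C u : weights C u -> forall j t, 0 <= W u j t.
  by move=> [u0 _ _] j t; apply: sumr_ge0.
have WD C u : weights C u -> forall j t, W u j t + \sum_(a : 'I_n | ~~ (a < t)%N) u
  j a = 1.
  by move=> [_ u1 _] j t; rewrite -(u1 j) [RHS](bigID (fun a : 'I_n => (a < t)%N)).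
have W1 C u : weights C u -> forall j t, W u j t <= 1.
  move=> hu j t; rewrite -(WD _ _ hu j t) lerDl; case: hu => u0 _ _.
  exact: sumr_ge0.
have step C u (i j : 'I_d) t : increasing C -> weights C u -> (i < j)%N ->
  0 < W u j t -> W u i t = 1.
  move=> iC hu ij; have [u0 u1 uC] := hu => /lt0r_neq0 nz.
  have [/existsP[a /andP[ta ja]]|/existsPn h] :=
      boolP [exists a : 'I_n, (a < t)%N && ((j, a) \in C)].
    rewrite -(WD _ _ hu i t) [X in _ = _ + X]big1 ?addr0 // => b nbt; apply: uC.
    apply: contra nbt => ib; apply: leq_ltn_trans ta.
    exact: ((increasingP _ iC) (i, b) (j, a)).
  case/eqP: nz; apply: big1 => a ta; apply: uC; have := h a; by rewrite ta.
(* Suppose row [j] has more weight below [t] for [u'] than for [u]. Rows before [j] are then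
   entirely below [t] for [u']; a later row with weight below [t] for [u] would put row [j] entirely
   below [t] for [u]. So no other row compensates, and the totals differ. *)
have leW C C' u u' : increasing C -> increasing C' -> weights C u -> weights C' u' ->
    (forall a, \sum_j u j a = \sum_j u' j a) -> forall j t, W u' j t <= W u j t.
  move=> iC iC' hu hu' eu j t; rewrite leNgt; apply/negP => lt.
  suff : \sum_i W u i t < \sum_i W u' i t.
    by rewrite exchange_big [ltRHS]exchange_big (eq_bigr _ (fun a _ => eu a)) ltxx.
  rewrite (bigD1 j) //= [ltRHS](bigD1 j) //=; apply: ltr_leD => //.
  apply: ler_sum => i nij; have [ij|ji] : (i < j)%N \/ (j < i)%N.
    by apply/orP; rewrite -neq_ltn -(inj_eq val_inj) in nij *.
    rewrite (step _ _ i j t iC' hu' ij); first exact: (W1 C).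
    exact: le_lt_trans (W0 _ _ hu j t) lt.
  have [h|h] := ltP 0 (W u i t); last exact: le_trans h (W0 _ _ hu' i t).
  by have := lt; rewrite (step _ _ _ _ _ iC hu ji h) ltNge (W1 C').
have WW j t : W w j t = W w' j t.
  by apply: le_anti; apply/andP; split; [exact: (leW B A) | exact: (leW A B)].
move=> j a; have [WS wS] : W w j a.+1 = w j a + W w j a /\ W w' j a.+1 = w' j a + W
  w' j a.
  have D u : W u j a.+1 = u j a + W u j a.
    rewrite /W (bigD1 a) //=; congr (_ + _); apply: eq_bigl => b.
    by rewrite ltnS ltn_neqAle -(inj_eq val_inj) andbC.
  by rewrite !D.
by apply: (addIr (W w j a)); rewrite -WS WW wS WW.
Qed.

(** By [weights_unique] a common point has the same weights in both cells, so these vanish outside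
    both index sets. *)
Lemma cellI A B : increasing A -> increasing B -> cell A `&` cell B = cell (A :&: B).
Proof.
move=> iA iB; apply/seteqP; split=> [x [[w hw wx] [w' hw' wx']]|x [w hw wx]].
  exists w => //; have ww' := weights_unique iA iB hw hw'.
  have [[w0 w1 wA] [_ _ wB]] := (hw, hw'); split=> // j a;
    rewrite finset.in_setI negb_and.
  case/orP => [/wA //|/wB <-]; apply: ww' => b; by rewrite -wx -wx'.
by split; exists w => //; apply: weights_sub hw;
  rewrite ?finset.subsetIl ?finset.subsetIr.
Qed.

Lemma cell_vertexE A f : staircase A -> increasing (graph f) ->
  cell A (vertex f) -> section A f.
Proof.
move=> /andP[hA iA] ig [w hw wx] j.
have hg := weights_section (A := graph f) (f := f) (fun j => _).
have sg : section (graph f) f by move=> i; rewrite in_graph.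
have e a : \sum_j w j a = \sum_j (f j == a)%:R by rewrite -wx mxE.
have := weights_unique iA ig hw (hg (fun j => sg j)) e j (f j); rewrite eqxx.
have [_ _ wA] := hw; case: (boolP ((j, f j) \in A)) => // /wA ->.
by move/eqP; rewrite eq_sym oner_eq0.
Qed.

Lemma cell_subset A B : staircase A -> staircase B -> cell A `<=` cell B -> A \subset B.
Proof.
move=> sA sB sAB; have [hA iA] := andP sA; apply/fintype.subsetP => -[j a] ja.
have [f sf <-] := has_rows_section_at hA ja.
by apply: cell_vertexE sB (graph_increasing sf iA) _ _; apply/sAB/cell_vertex.
Qed.

Lemma cell_inj A B : staircase A -> staircase B -> cell A = cell B -> A = B.
Proof.
by move=> sA sB e; apply/eqP; rewrite finset.eqEsubset !cell_subset // e.
Qed.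

Lemma cell_graph f : cell (graph f) = [set vertex f].
Proof.
apply/seteqP; split=> [x [w hw wx]|_ ->]; last first.
  by apply: cell_vertex => j; rewrite in_graph.
have [w0 w1 wg] := hw; apply/rowP => a; rewrite wx mxE; apply: eq_bigr => j _.
have w0' b : f j != b -> w j b = 0 by move=> nb; apply: wg; rewrite in_graph.
case: (eqVneq (f j) a) => [<-|/w0'-> //].
rewrite -(w1 j) (bigD1 (f j)) //= big1 ?addr0 // => b; rewrite eq_sym; exact: w0'.
Qed.

(** Turns the slack of a linear inequality into a weighted sum of slacks at the entries, so that its
    sign and its vanishing can be read entry by entry. *)
Lemma dot_weights A w x (u : 'cV[R]_n) (M : 'I_d -> R) :
  weights A w -> (forall a, x ord0 a = \sum_j w j a) ->
  \sum_j M j - (x *m u) ord0 ord0 = \sum_j \sum_a w j a * (M j - u a ord0).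
Proof.
move=> [_ w1 _] wx; rewrite mxE (eq_bigr (fun a => \sum_j w j a * u a ord0));
  last first.
  by move=> a _; rewrite wx mulr_suml.
rewrite exchange_big -sumrB; apply: eq_bigr => j _ /=.
rewrite -[M j in LHS]mul1r -(w1 j) mulr_suml -sumrB; apply: eq_bigr => a _.
by rewrite mulrBr.
Qed.

(** A functional is maximal on a Minkowski sum exactly where it is maximal on each summand: the
    slack is a sum of nonnegative terms, zero only if all weight sits where the row bound is
    attained. *)
Lemma cell_max_face A B (u : 'cV[R]_n) (M : 'I_d -> R) :
  B \subset A -> (forall j a, (j, a) \in A -> u a ord0 <= M j) ->
  (forall j a, (j, a) \in A -> ((j, a) \in B) = (u a ord0 == M j)) ->
  (forall x, cell A x -> (x *m u) ord0 ord0 <= \sum_j M j) /\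
  cell B = [set x | cell A x /\ (x *m u) ord0 ord0 = \sum_j M j].
Proof.
move=> sBA leM eqM.
have ge0 w : weights A w -> forall j a, 0 <= w j a * (M j - u a ord0).
  move=> [w0 _ wA] j a; have [ja|/wA->] := boolP ((j, a) \in A); last by rewrite mul0r.
  by rewrite mulr_ge0 ?subr_ge0 ?leM.
split=> [x [w hw wx]|].
  rewrite -subr_ge0 (dot_weights _ _ hw wx); apply: sumr_ge0 => j _.
  by apply: sumr_ge0 => a _; apply: ge0.
apply/seteqP; split=> [x [w hw wx]|x [[w hw wx] /eqP]].
  have hwA := weights_sub sBA hw; split; first by exists w.
  apply/esym/eqP; rewrite -subr_eq0 (dot_weights _ _ hwA wx); apply/eqP.
  apply: big1 => j _; apply: big1 => a _; have [_ _ wB] := hw.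
  have [ja|/wB->] := boolP ((j, a) \in B); last by rewrite mul0r.
  by move: (ja); rewrite eqM ?(fintype.subsetP sBA) // => /eqP->; rewrite subrr mulr0.
rewrite eq_sym -subr_eq0 (dot_weights _ _ hw wx) psumr_eq0 => [|j _]; last first.
  by apply: sumr_ge0 => a _; apply: ge0.
move/allP => h; exists w => //; have [w0 w1 wA] := hw; split=> // j a nja.
have := h j (mem_index_enum _); rewrite psumr_eq0 =>
  [/allP/(_ a (mem_index_enum _))|b _]; last exact: ge0.
rewrite mulf_eq0 => /orP[/eqP //|]; rewrite subr_eq0 eq_sym.
have [ja|/wA //] := boolP ((j, a) \in A).
by rewrite -eqM // (negPf nja).
Qed.

Lemma empty_face (P : set V) : face_of set0 P.
Proof.
exists 0, 1; split=> [x _|]; first by rewrite mulmx0 mxE ler01.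
by apply/seteqP; split=> // x [_]; rewrite mulmx0 mxE => /esym/eqP; rewrite oner_eq0.
Qed.

(** Keep in each row the entries where [u] is maximal. If the face is nonempty, the bound [c] is
    attained, hence equal to the sum of the row maxima, and the face is the cell of the kept
    entries. *)
Lemma face_of_cell_sub A F : face_of F (cell A) ->
  F = set0 \/ exists B, [/\ B \subset A, has_rows B & F = cell B].
Proof.
move=> [u [c [lec ->]]].
have [hA|/cell_eq0 A0] := boolP (has_rows A); last first.
  by left; apply/seteqP; split=> // x []; rewrite A0.
have [[x [Ax xc]]|ne] := pselect ([set x | cell A x /\ (x *m u) ord0 ord0 = c] !=set0);
  last by left; apply/eqP; apply: contra_notT ne => /set0P.
right; have maxrow j : exists b, (j, b) \in A /\
    forall a, (j, a) \in A -> u a ord0 <= u b ord0.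
  have /has_rowsP/(_ j)[a0 ja0] := hA.
  have [a ja amax] := @arg_maxP _ _ _ a0 (fun a => (j, a) \in A) (fun a =>
    u a ord0) ja0.
  by exists a.
have [f fP] := choice maxrow.
pose B := [set p in A | u p.2 ord0 == u (f p.1) ord0]%SET.
have sBA : B \subset A by apply/fintype.subsetP => p; rewrite inE => /andP[].
have sf : section B f by move=> j; rewrite inE eqxx (fP j).1.
have hB : has_rows B by apply/has_rowsP => j; exists (f j).
have [|j a ja|le DB] := @cell_max_face A B u (fun j => u (f j) ord0) sBA.
- by move=> j a /(fP j).2.
- by rewrite inE ja.
exists B; split=> //; rewrite DB; suff -> : c = \sum_j u (f j) ord0 by [].
apply: le_anti; rewrite -{1}xc le //=.
have : cell B (vertex f) by apply: cell_vertex.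
by rewrite DB => -[fA <-]; apply: lec.
Qed.

(* The functional [u] takes a constant value on row [i] of [A], plus 1 exactly
   on row [i] of [B]: the contribution [v j] of any other row [j] is constant
   there, as row [i] lies on one side of row [j]. *)
Lemma cell_sub_face A B : increasing A -> B \subset A -> face_of (cell B) (cell A).
Proof.
move=> iA sBA; have [hB|/cell_eq0->] := boolP (has_rows B); last exact: empty_face.
have hA := has_rowsS sBA hB.
have ext j : exists l, [/\ (j, l.1) \in A, (j, l.2) \in A &
    forall a, (j, a) \in A -> (l.1 <= a <= l.2)%N].
  have /has_rowsP/(_ j)[a0 ja0] := hA.
  have [lo jlo lomin] := @arg_minnP _ a0 (fun a => (j, a) \in A) val ja0.
  have [hi jhi himax] := @arg_maxnP _ a0 (fun a => (j, a) \in A) val ja0.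
  by exists (lo, hi); split=> // a ja; rewrite [(_ <= a)%N]lomin //= [(a <= _)%N]himax.
have [l hl] := choice ext.
(* The point nearest to [a] in the interval spanned by row [j]: it fixes the entries of that row and
   is constant on either side of the interval. *)
pose clamp j (a : 'I_n) := if (a <= (l j).1)%N then (l j).1 else
  if ((l j).2 <= a)%N then (l j).2 else a.
pose v (j : 'I_d) (a : 'I_n) : R := ((j, clamp j a) \in B)%:R.
pose K (i : 'I_d) : R := \sum_(j | j != i) if (i < j)%N then v j (l j).1 else v j (l
  j).2.
pose u : 'cV[R]_n := \col_a \sum_j v j a.
have clampA j a : (j, a) \in A -> clamp j a = a.
  have [_ _ h] := hl j; move=> /h; rewrite /clamp => /andP[h1 h2].
  case: ifP => h3; first by apply: val_inj; apply/eqP; rewrite eqn_leq h1 h3.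
  by case: ifP => // h4; apply: val_inj; apply/eqP; rewrite eqn_leq h4 h2.
have uE i a : (i, a) \in A -> u a ord0 = ((i, a) \in B)%:R + K i.
  move=> ia; rewrite mxE (bigD1 i) //= {1}/v clampA //; congr (_ + _).
  apply: eq_bigr => j nji; rewrite /v /clamp; have [lo hi lh] := hl j.
  have le12 : ((l j).1 <= (l j).2)%N by have /andP[] := lh _ lo.
  case: ltnP => ij; first by rewrite leqnn [(a <= _)%N](increasingP _ iA (i, a) (j,
    (l j).1)).
  have h2a : ((l j).2 <= a)%N.
    apply: (increasingP _ iA (j, (l j).2) (i, a)) => //=.
    by rewrite ltn_neqAle ij -(inj_eq val_inj) in nji *; rewrite nji.
  rewrite h2a leqnn; case: ifP => h3; case: ifP => h4 //.
  - by rewrite (leq_trans h2a h3) in h4.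
  have -> // : (l j).2 = (l j).1.
  by apply: val_inj; apply/eqP; rewrite eqn_leq h4 le12.
have [||le DB] := @cell_max_face A B u (fun i => 1 + K i) sBA.
- by move=> i a ia; rewrite (uE i) // lerD2r; case: (_ \in B); rewrite ?ler01.
- move=> i a ia; rewrite (uE i) // (inj_eq (addIr _)).
  by case: (_ \in B); rewrite ?eqxx // eq_sym oner_eq0.
by exists u, (\sum_i (1 + K i)).
Qed.

Lemma face_of_cell A F : increasing A ->
  face_of F (cell A) <->
  F = set0 \/ exists B, [/\ B \subset A, has_rows B & F = cell B].
Proof.
move=> iA; split=> [/face_of_cell_sub //|[->|[B [sBA _ ->]]]]; first exact: empty_face.
exact: cell_sub_face.
Qed.

Lemma face_cellP A B : staircase A -> staircase B ->
  face_of (cell B) (cell A) <-> B \subset A.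
Proof.
move=> sA sB; have [hA iA] := andP sA; have [hB iB] := andP sB.
split=> [|sBA]; last exact: cell_sub_face.
case/face_of_cell_sub => [/cell_neq0 //|[C [sCA hC /cell_inj->]] //].
exact: staircaseS sCA hC sA.
Qed.

Lemma vertices_cell A : staircase A ->
  vertices (cell A) = [set vertex f | f in section A].
Proof.
move=> /andP[hA iA]; apply/seteqP; split=>
  [v /face_of_cell_sub[|[B [sBA hB DB]]]|_ [f sf <-]].
- by move/seteqP => [/(_ v erefl)].
- have [f sf] := has_rows_section hB; exists f => [j|];
  first exact: (fintype.subsetP sBA).
  by have := cell_vertex sf; rewrite -DB.
- by rewrite /vertices /= -cell_graph; apply: cell_sub_face => //; apply: graph_sub.
Qed.

End Cells.

(** * Polytopes, dimensions and labels *)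

Section Polytopes.
Variables (R : realType) (d n : nat).
Local Notation V := 'rV[R]_n.
Implicit Types (A B C : {set 'I_d * 'I_n}) (w : 'I_d -> 'I_n -> R).
Implicit Types (x y : V) (f g : 'I_d -> 'I_n).

Lemma conv_hull_polytope (J : finType) (p : J -> V) : polytope (conv_hull p).
Proof.
have bij : {on xpredT, bijective (@enum_val J xpredT)} := onW_bij _ (@enum_val_bij J).
exists #|J|, (fun i => p (enum_val i)).
apply/seteqP; split=> x [w [w0 w1 ->]].
  exists (fun i => w (enum_val i)); split=> //;
    first by rewrite -w1 [RHS](reindex _ bij).
  by rewrite (reindex _ bij).
exists (fun j => w (enum_rank j)); split=> //.
  by rewrite -w1 (reindex _ bij); apply: eq_bigr => i _; rewrite enum_valK.
by rewrite [RHS](reindex _ bij); apply: eq_bigr => i _; rewrite enum_valK.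
Qed.

(** Choosing the entries of the rows independently, with probabilities [w j], gives the marginals
    [w j]. A function that is not a section of [A] has product weight zero, so replacing it by [f0]
    is harmless. *)
Lemma sum_prod_weights A w f0 : weights A w -> section A f0 ->
  let s (f : {ffun 'I_d -> 'I_n}) := if [forall j, (j, f j) \in A] then f : _ ->
    _ else f0 in
  forall j a, \sum_(f : {ffun 'I_d -> 'I_n}) (\prod_i w i (f i)) * (s f j == a)%:R =
    w j a.
Proof.
move=> [_ w1 wA] sf0 s j a; pose u i b := w i b * (if i == j then (b == a)%:R else 1).
transitivity (\sum_(f : {ffun 'I_d -> 'I_n}) \prod_i u i (f i)).
  apply: eq_bigr => f _; rewrite /u big_split /= -big_mkcond big_pred1_eq.
  rewrite /s; case: ifP => // /forallPn[i nA].
  by rewrite (bigD1 i) //= wA // !mul0r.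
rewrite -bigA_distr_bigA (bigD1 j) //= [X in _ * X]big1 => [|i /negPf nij].
  rewrite mulr1 /u eqxx (bigD1 a) //= eqxx mulr1 big1 ?addr0 // => b /negPf->.
  exact: mulr0.
by rewrite -[RHS](w1 i) /u nij; apply: eq_bigr => b _; rewrite mulr1.
Qed.

(** Products of row weights are the coefficients of a convex combination of vertices; marginals lead
    back to row weights. *)
Lemma cell_conv_hull A f0 : section A f0 ->
  cell A = conv_hull (fun f : {ffun 'I_d -> 'I_n} =>
    vertex R (if [forall j, (j, f j) \in A] then f : _ -> _ else f0)).
Proof.
move=> sf0; pose s (f : {ffun 'I_d -> 'I_n}) :=
  if [forall j, (j, f j) \in A] then f : _ -> _ else f0.
have ss (f : {ffun 'I_d -> 'I_n}) : section A (s f) by rewrite /s;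
  case: ifP => [/forallP|].
apply/seteqP; split=> x.
  move=> [w hw wx]; have sw := sum_prod_weights hw sf0; have [w0 w1 wA] := hw.
  exists (fun f : {ffun 'I_d -> 'I_n} => \prod_i w i (f i)); split=> [f||];
    first exact: prodr_ge0.
    by rewrite -bigA_distr_bigA big1.
  apply/rowP => a; rewrite summxE wx; under [RHS]eq_bigr do rewrite !mxE mulr_sumr.
  by rewrite exchange_big; apply: eq_bigr => j _; rewrite -[LHS]sw.
move=> [c [c0 c1 ->]]; exists (fun j a => \sum_(f : {ffun 'I_d ->
  'I_n}) c f * (s f j == a)%:R).
  split=> [j a|j|j a nja].
  - by apply: sumr_ge0 => f _; rewrite mulr_ge0 ?ler0n.
  - rewrite exchange_big -[RHS]c1; apply: eq_bigr => f _.
    by rewrite -mulr_sumr sum_delta mulr1.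
  apply: big1 => f _; case: eqP => [e|_]; last exact: mulr0.
  by have := ss f j; rewrite e (negPf nja).
move=> a; rewrite summxE exchange_big; apply: eq_bigr => f _.
by rewrite !mxE mulr_sumr.
Qed.

Lemma cell_polytope A : polytope (cell A : set V).
Proof.
have [/has_rows_section[f0 sf0]|/cell_eq0->] := boolP (has_rows A).
  by rewrite (cell_conv_hull sf0); apply: conv_hull_polytope.
have -> : set0 = conv_hull (fun _ : void => 0 : V).
  apply/seteqP; split=> // x [w [_ + _]]; rewrite big1 => [/esym/eqP|[]//].
  by rewrite oner_eq0.
exact: conv_hull_polytope.
Qed.

End Polytopes.

(** * Dimension of a cell *)

Section Dimension.
Variables (R : realType) (d n : nat).
Local Notation V := 'rV[R]_n.
Implicit Types (A B C : {set 'I_d * 'I_n}) (w : 'I_d -> 'I_n -> R).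

Lemma row_minima A : has_rows A -> exists2 f : 'I_d -> 'I_n, section A f &
  forall j a, (j, a) \in A -> (f j <= a)%N.
Proof.
move=> /has_rowsP hA; have h j : exists b, (j, b) \in A /\
    forall a, (j, a) \in A -> (b <= a)%N.
  have [a0 ja0] := hA j.
  have [b jb bmin] := @arg_minnP _ a0 (fun a => (j, a) \in A) val ja0.
  by exists b.
by have [f hf] := choice h; exists f => j *; [exact: (hf j).1 | apply: (hf j).2].
Qed.

Section AboveMinima.
Variables (A : {set 'I_d * 'I_n}) (f : 'I_d -> 'I_n).
Hypotheses (iA : increasing A) (sf : section A f).
Hypothesis fmin : forall j a, (j, a) \in A -> (f j <= a)%N.

(** The entries other than the row minima. Each gives an edge direction at the vertex of the row
    minima, and their number will be the dimension. *)
Definition above : {set 'I_d * 'I_n} := (A :\: graph f)%SET.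

Lemma card_above : #|A| = (d + #|above|)%N.
Proof.
by rewrite -(cardsID (graph f) A) (finset.setIidPr (graph_sub sf)) card_graph.
Qed.

Lemma aboveP j a : (j, a) \in above -> (j, a) \in A /\ (f j < a)%N.
Proof.
rewrite finset.in_setD in_graph => /andP[nfa ja]; split=> //.
by rewrite ltn_neqAle fmin // andbT.
Qed.

(** If [a] occurs in row [i] and strictly above the minimum of row [j], then [i < j] would put an
    entry of row [j] below an entry of row [i]. *)
Lemma above_inj : {in above &, injective snd}.
Proof.
have lt i j a : (i, a) \in above -> (j, a) \in above -> (j <= i)%N.
  move=> /aboveP[ia _] /aboveP[_ fja]; rewrite leqNgt; apply/negP => ij.
  have := increasingP _ iA (i, a) (j, f j) ia (sf j) ij.
  by rewrite leqNgt fja.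
move=> [i a] [j b] iD jD /= ab; rewrite ab in iD *.
by have /eqP -> : i == j by rewrite -val_eqE eqn_leq !(lt _ _ b).
Qed.

Lemma card_above_le : (#|above| <= n)%N.
Proof.
by rewrite -(card_in_imset above_inj) -[X in (_ <= X)%N]card_ord max_card.
Qed.

(* The matrix of the vectors [e_(q.2) - e_(f q.1)] is triangular, by [above_inj]. *)
Lemma above_free (c : 'I_d * 'I_n -> R) :
  (forall t, \sum_(q in above) c q * ((q.2 == t)%:R - (f q.1 == t)%:R) = 0) ->
  {in above, forall q, c q = 0}.
Proof.
move=> h; suff main m (q : 'I_d * 'I_n) : (n - q.2 <= m)%N -> q \in above -> c q = 0.
  by move=> q; apply: (main (n - q.2)%N).
(* Induction from the largest letter down: in coordinate [q.2] another entry [p] contributes only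
   through its row minimum, and then [p.2] exceeds [q.2]. *)
elim: m q => [|m IHm] q; first by rewrite leqn0 subn_eq0 leqNgt ltn_ord.
move=> qm qD; have := h q.2; rewrite (bigD1 q) //= eqxx big1 => [|p /andP[pD npq]].
  case: q qD {qm} => j a /aboveP[_ /=].
  by rewrite ltn_neqAle => /andP[/negPf fa _]; rewrite -val_eqE fa subr0 mulr1 addr0.
have -> : p.2 == q.2 = false by apply: contraNF npq => /eqP/above_inj->.
have [fp|_] := eqVneq (f p.1) q.2; last by rewrite subr0 mulr0.
rewrite IHm ?mul0r //; case: p pD fp {npq} => i b /aboveP[_ /=] + fp.
rewrite fp => ab; have := ltn_ord b; lia.
Qed.

(** Take the vertex of the row minima and its neighbours, each moving one row to an entry of
    [above]. *)
Lemma aff_indep_above : exists p : 'I_#|above|.+1 -> V,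
  (forall i, cell A (p i)) /\ aff_indep p.
Proof.
pose g (q : 'I_d * 'I_n) j := if j == q.1 then q.2 else f j.
pose p (i : 'I_#|above|.+1) : V :=
  if unlift ord0 i is Some i' then vertex R (g (enum_val i')) else vertex R f.
have p0 : p ord0 = vertex R f by rewrite /p unlift_none.
have pS i : p (lift ord0 i) = vertex R (g (enum_val i)) by rewrite /p liftK.
have vg q t : vertex R (g q) ord0 t =
    vertex R f ord0 t + ((q.2 == t)%:R - (f q.1 == t)%:R).
  rewrite !mxE (bigD1 q.1) //= [in RHS](bigD1 q.1) //= {1}/g eqxx.
  rewrite (eq_bigr (fun j => (f j == t)%:R)) => [|j /negPf nj]; last by rewrite /g nj.
  ring.
exists p; split=> [i|a].
  rewrite /p; case: unliftP => [i' _|_]; apply: cell_vertex => //.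
  have /finset.setDP[qA _] := enum_valP i'; move=> j; rewrite /g; case: eqP => // ->.
  by rewrite -surjective_pairing.
rewrite !big_ord_recl => a1 ap.
pose c q := \sum_(i < #|above|) a (lift ord0 i) * (enum_val i == q)%:R.
have ca i : c (enum_val i) = a (lift ord0 i).
  rewrite /c (bigD1 i) //= eqxx mulr1 big1 ?addr0 // => i' ni'.
  by rewrite (inj_eq enum_val_inj) (negPf ni') mulr0.
have c0 : {in above, forall q, c q = 0}.
  apply: above_free => t; rewrite big_enum_val /=.
  move/rowP/(_ t): ap; rewrite mxE [X in _ + X]summxE p0 [X in X + _]mxE [in RHS]mxE.
  rewrite (eq_bigr (fun i => a (lift ord0 i) * vertex R f ord0 t +
    c (enum_val i) * (((enum_val i).2 == t)%:R - (f (enum_val i).1 == t)%:R))) =>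
      [|i _].
    by rewrite big_split -mulr_suml addrA -mulrDl a1 mul0r add0r.
  by rewrite pS mxE vg ca mulrDr.
have aS i : a (lift ord0 i) = 0 by rewrite -ca c0 // enum_valP.
move=> i; have [j ->|->] := unliftP ord0 i; first exact: aS.
by move: a1; rewrite big1 ?addr0.
Qed.

(** The weights at [above] determine all weights, since each row sums to 1. With more points than
    [#|above|.+1] there is a linear relation killing the constants and these weights, hence all
    coordinates. *)
Lemma aff_indep_cell_le N (p : 'I_N -> V) :
  (forall i, cell A (p i)) -> aff_indep p -> (N <= #|above|.+1)%N.
Proof.
move=> Ap indep; rewrite leqNgt; apply/negP => lt.
have ex i : exists w, weights A w /\ forall a, p i ord0 a = \sum_j w j a.
  by have [w ? ?] := Ap i; exists w.
have [w hw] := choice ex.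
pose M := row_mx (const_mx 1 : 'cV[R]_N) (\matrix_(i < N, k < #|above|) w i
  (enum_val k).1 (enum_val k).2).
have ker0 : kermx M != 0.
  rewrite -mxrank_eq0 mxrank_ker subn_eq0 -ltnNge; apply: leq_ltn_trans lt.
  exact: (rank_leq_col M).
have [v vM nzv] : exists2 v : 'rV[R]_N, v *m M = 0 & v != 0.
  exists (nz_row (kermx M)); last by rewrite nz_row_eq0.
  by apply/sub_kermxP/nz_row_sub.
move: vM; rewrite mul_mx_row -row_mx0 => /eq_row_mx[v1 vw].
have s1 : \sum_i v ord0 i = 0.
  transitivity ((v *m const_mx 1 : 'M_1) ord0 ord0); last by rewrite v1 mxE.
  by rewrite mxE; apply: eq_bigr => i _; rewrite mxE mulr1.
have sD j a : (j, a) \in above -> \sum_i v ord0 i * w i j a = 0.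
  move=> ja; pose k := enum_rank_in ja (j, a).
  transitivity ((v *m \matrix_(i < N, k < #|above|) w i (enum_val k).1 (enum_val
    k).2) ord0 k).
    by rewrite mxE; apply: eq_bigr => i _; rewrite mxE enum_rankK_in.
  by rewrite vw mxE.
have sw j a : \sum_i v ord0 i * w i j a = 0.
  have [/sD //|] := boolP ((j, a) \in above);
    rewrite finset.in_setD negb_and negbK in_graph.
  case/orP => [/eqP <-|nja]; last first.
    by apply: big1 => i _; have [[_ _ ->] //] := hw i; rewrite mulr0.
  have others b : b != f j -> \sum_i v ord0 i * w i j b = 0.
    move=> nb; have [jb|njb] := boolP ((j, b) \in A).
      by apply: sD; rewrite finset.in_setD in_graph jb eq_sym nb.
    by apply: big1 => i _; have [[_ _ ->] //] := hw i; rewrite mulr0.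
  have : \sum_b \sum_i v ord0 i * w i j b = 0.
    rewrite exchange_big -[RHS]s1; apply: eq_bigr => i _.
    by have [[_ w1 _] _] := hw i; rewrite -mulr_sumr w1 mulr1.
  by rewrite (bigD1 (f j)) //= [X in _ + X]big1 ?addr0.
case/eqP: nzv; apply/rowP => i; rewrite [RHS]mxE.
apply: (indep (fun i => v ord0 i)) => //; apply/rowP => a; rewrite summxE mxE.
rewrite (eq_bigr (fun i => \sum_j v ord0 i * w i j a)) => [|i' _].
  by rewrite exchange_big big1.
by rewrite mxE (hw i').2 mulr_sumr.
Qed.

End AboveMinima.

Lemma pdim_cell A : staircase A -> pdim (cell A : set V) = #|A|%:Z - d%:Z.
Proof.
move=> /andP[hA iA]; have [f sf fmin] := row_minima hA.
(* [pdim] takes its maximum over families of at most [n.+1] points, so the optimal family must be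
   shown to be in that range. *)
have Nn : (#|above A f|.+1 < n.+2)%N by rewrite !ltnS card_above_le.
rewrite /pdim (_ : \max_(N < _ | _) N = #|above A f|.+1)%N; last first.
  apply/eqP; rewrite eqn_leq; apply/andP; split.
    by apply/bigmax_leqP => N /asboolP[p [Ap ip]]; apply: aff_indep_cell_le Ap ip.
  apply: (@leq_bigmax_cond _ _ (fun N : 'I_n.+2 => N : nat) (Ordinal Nn)).
  by apply/asboolP; apply: aff_indep_above.
by rewrite (card_above sf); lia.
Qed.

Lemma pdim_set0 : pdim (set0 : set V) = -1.
Proof.
rewrite /pdim (_ : \max_(N < _ | _) N = 0)%N ?sub0r //.
apply/eqP; rewrite -leqn0; apply/bigmax_leqP => N /asboolP[p [h _]].
by case: N p h => [[|N] ?] p h //; case: (h ord0).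
Qed.

End Dimension.

(** * Labels of vertices and cells *)

Section Labels.
Variables (R : realType) (d n : nat).
Local Notation V := 'rV[R]_n.
Implicit Types (A B C : {set 'I_d * 'I_n}) (f : 'I_d -> 'I_n).

Lemma point_label_vertex f : point_label (vertex R f) = (\sum_j U_(f j))%MM.
Proof.
apply/mnmP => a; rewrite mnmE mxE mnm_sumE -natr_sum natrK.
by apply: eq_bigr => j _; rewrite mnm1E.
Qed.

Lemma vertex_label f f' :
  (\sum_j U_(f j) = \sum_j U_(f' j))%MM -> vertex R f = vertex R f'.
Proof.
move=> e; apply/rowP => a; rewrite !mxE -!natr_sum; congr (_%:R).
by move/mnmP/(_ a): e; rewrite !mnm_sumE; under eq_bigr do rewrite mnm1E;
   under [RHS]eq_bigr do rewrite mnm1E.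
Qed.

Lemma label_sum A t : label A t = (\sum_j ((j, t) \in A))%N.
Proof.
rewrite /label mnm_sumE big_mkcond.
transitivity (\sum_j \sum_a ((j, a) \in A) * (a == t))%N.
  rewrite pair_bigA; apply: eq_bigr => -[j a] _ /=.
  by rewrite mnm1E; case: (_ \in A); rewrite ?mul1n.
apply: eq_bigr => j _; rewrite (bigD1 t) //= eqxx muln1 big1 ?addn0 // => a /negPf->.
exact: muln0.
Qed.

Lemma vertices_cell_finite A : staircase A -> finite_set (vertices (cell A : set V)).
Proof.
move=> sA; rewrite vertices_cell //.
apply: (@sub_finite_set _ _ [set vertex R f | f in [set: {ffun 'I_d -> 'I_n}]]).
  move=> _ [f sf <-]; exists (finfun f) => //; congr vertex.
  by apply/funext => j; rewrite ffunE.
exact: finite_image.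
Qed.

(** At a vertex the exponent of [t] is at most the number of rows containing [t]; the section that
    takes [t] wherever possible attains this bound. *)
Lemma cell_label_cell A : staircase A ->
  cell_label (@point_label R n) (cell A) = label A.
Proof.
move=> sA; rewrite /cell_label; set r := finite_support _ _ _.
(* The iterated operation over a classical set runs over the elements whose value is not the unit,
   so a vertex labelled 1 would be missing from [r]. *)
have rE v : (v \in r) = (v \in vertices (cell A : set V)) && (point_label v != 0%MM).
  rewrite /r in_finite_support; last exact/finite_setIl/vertices_cell_finite.
  by rewrite in_setI; congr (_ && _); apply/idP/idP => /[!inE]/eqP.
have big_ub (s : seq V) v : v \in s ->
    (point_label v <= \big[@mlcm n/0]_(u <- s) point_label u)%MM.
  elim: s => // u s IHs; rewrite inE big_cons => /predU1P[->|/IHs h];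
    first exact: lem_mlcml.
  exact: lepm_trans h (lem_mlcmr _ _).
have [hA iA] := andP sA; have [f0 sf0] := has_rows_section hA.
apply/mnmP => t; apply/eqP; rewrite eqn_leq; apply/andP; split.
  suff /mnm_lepP : (\big[@mlcm n/0]_(u <- r) point_label u <= label A)%MM by [].
  rewrite big_seq; elim/big_ind: _ => [|x y|v].
  - by apply/mnm_lepP => i; rewrite mnm0E.
  - by rewrite lem_mlcm => -> ->.
  rewrite rE => /andP[/[!inE]]; rewrite vertices_cell // => -[f sf <-] _;
    rewrite point_label_vertex.
  apply/mnm_lepP => i; rewrite mnm_sumE label_sum; apply: leq_sum => j _.
  by rewrite mnm1E; case: eqP => // <-; rewrite sf.
pose f j := if (j, t) \in A then t else f0 j.
have sf : section A f by move=> j; rewrite /f; case: ifP.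
apply: (@leq_trans (point_label (vertex R f) t)).
  rewrite point_label_vertex label_sum mnm_sumE; apply: leq_sum => j _;
    rewrite mnm1E /f.
  by case: ifP => // _; rewrite eqxx.
have [->|nz] := eqVneq (point_label (vertex R f)) 0%MM; first by rewrite mnm0E.
apply: (mnm_lepP (big_ub _ _ _) t); rewrite rE nz andbT inE vertices_cell //.
by exists f.
Qed.

End Labels.

(** * The cells of the subdivision *)

Definition within d n (a b : nat) (A : {set 'I_d * 'I_n}) : Prop :=
  forall p, p \in A -> (a <= p.2 <= b)%N.

Section Concatenation.
Variables (R : realType) (d1 d2 n : nat).
Local Notation V := 'rV[R]_n.
Implicit Types (A : {set 'I_d1 * 'I_n}) (B : {set 'I_d2 * 'I_n}).
Implicit Types (C : {set 'I_(d1 + d2) * 'I_n}).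

Definition cat_rows A B : {set 'I_(d1 + d2) * 'I_n} :=
  [set p : 'I_(d1 + d2) * 'I_n | match fintype.split p.1 with
           | inl i => (i, p.2) \in A
           | inr j => (j, p.2) \in B end]%SET.

Lemma in_cat_rows_l A B i a : ((lshift d2 i, a) \in cat_rows A B) = ((i, a) \in A).
Proof. by rewrite inE /= (unsplitK (inl i : 'I_d1 + 'I_d2)). Qed.

Lemma in_cat_rows_r A B j a : ((rshift d1 j, a) \in cat_rows A B) = ((j, a) \in B).
Proof. by rewrite inE /= (unsplitK (inr j : 'I_d1 + 'I_d2)). Qed.

Lemma cat_rows_surj C : exists A B, C = cat_rows A B.
Proof.
exists [set p : 'I_d1 * 'I_n | (lshift d2 p.1, p.2) \in C]%SET, [set p : 'I_d2 *
  'I_n | (rshift d1 p.1, p.2) \in C]%SET.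
apply/setP => -[i a]; rewrite inE /=.
by case: splitP => j Dj; rewrite inE; congr (_ \in C); congr pair; apply: val_inj.
Qed.

Lemma cat_rows_has_rows A B : has_rows (cat_rows A B) = has_rows A && has_rows B.
Proof.
apply/has_rowsP/andP => [h|[/has_rowsP hA /has_rowsP hB] i].
  split; apply/has_rowsP => j.
    by have [a] := h (lshift d2 j); rewrite in_cat_rows_l; exists a.
  by have [a] := h (rshift d1 j); rewrite in_cat_rows_r; exists a.
rewrite -(splitK i); case: (fintype.split i) => j /=.
  by have [a] := hA j; exists a; rewrite in_cat_rows_l.
by have [a] := hB j; exists a; rewrite in_cat_rows_r.
Qed.

Lemma cat_rows_increasing A B :
  increasing (cat_rows A B) <->
  [/\ increasing A, increasing B & forall p q, p \in A -> q \in B -> (p.2 <= q.2)%N].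
Proof.
split=> [/increasingP h|[/increasingP hA /increasingP hB hAB]].
  split.
  - apply/increasingP => -[i a] [j b] ia jb /= ij.
    by apply: (h (lshift d2 i, a) (lshift d2 j, b)); rewrite ?in_cat_rows_l.
  - apply/increasingP => -[i a] [j b] ia jb /= ij.
    by apply: (h (rshift d1 i, a) (rshift d1 j, b));
      rewrite ?in_cat_rows_r //= ltn_add2l.
  - move=> [i a] [j b] ia jb /=.
    apply: (h (lshift d2 i, a) (rshift d1 j, b));
      rewrite ?in_cat_rows_l ?in_cat_rows_r //=.
    by rewrite ltn_addr.
apply/increasingP => -[i a] [j b].
rewrite -(splitK i) -(splitK j); case: (fintype.split i) (fintype.split j) =>
  [i'|i'] [j'|j'] /=;
  rewrite ?in_cat_rows_l ?in_cat_rows_r /=.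
- exact: (hA (i', a) (j', b)).
- by move=> ia jb _; apply: (hAB (i', a) (j', b)).
- by rewrite ltnNge => _ _ /negP[]; rewrite ltnW // ltn_addr.
- by rewrite ltn_add2l; apply: (hB (i', a) (j', b)).
Qed.

Lemma cat_rows_staircase A B :
  staircase (cat_rows A B) <->
  [/\ staircase A, staircase B & forall p q, p \in A -> q \in B -> (p.2 <= q.2)%N].
Proof.
rewrite /staircase cat_rows_has_rows.
split=> [/andP[/andP[-> ->] /cat_rows_increasing //]|[/andP[-> iA] /andP[-> iB] AB]].
exact/cat_rows_increasing.
Qed.

Lemma cat_rows_within A B a b :
  within a b (cat_rows A B) <-> within a b A /\ within a b B.
Proof.
split=> [h|[hA hB] [i t]].
  split=> -[j t] jt.
    by apply: (h (lshift d2 j, t)); rewrite in_cat_rows_l.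
  by apply: (h (rshift d1 j, t)); rewrite in_cat_rows_r.
rewrite -(splitK i); case: (fintype.split i) => j /=.
  by rewrite in_cat_rows_l => /hA.
by rewrite in_cat_rows_r => /hB.
Qed.

Lemma minkowski_sum_cell A B :
  minkowski_sum (cell A : set V) (cell B) = cell (cat_rows A B).
Proof.
apply/seteqP; split=> [_ [x [w hw wx] [y [u hu uy] <-]]|z [w [w0 w1 wC] wz]].
  exists (fun i a => match fintype.split i with inl j => w j a | inr j => u j a end).
    have [[w0 w1 wA] [u0 u1 uB]] := (hw, hu).
    split=> [i a|i|i a]; first by case: (fintype.split i).
      by case: (fintype.split i).
    rewrite -(splitK i) unsplitK; case: (fintype.split i) => j /=.
      by rewrite in_cat_rows_l; apply: wA.
    by rewrite in_cat_rows_r; apply: uB.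
  move=> a; rewrite mxE wx uy big_split_ord; congr (_ + _); apply: eq_bigr => j _.
    by rewrite (unsplitK (inl j : 'I_d1 + 'I_d2)).
  by rewrite (unsplitK (inr j : 'I_d1 + 'I_d2)).
exists (\row_a \sum_j w (lshift d2 j) a).
  exists (fun j => w (lshift d2 j)) => [|a]; last by rewrite mxE.
  by split=> // j a; rewrite -(in_cat_rows_l A B); apply: wC.
exists (\row_a \sum_j w (rshift d1 j) a).
  exists (fun j => w (rshift d1 j)) => [|a]; last by rewrite mxE.
  by split=> // j a; rewrite -(in_cat_rows_r A B); apply: wC.
by apply/rowP => a; rewrite !mxE wz big_split_ord.
Qed.

End Concatenation.

Section SubdivisionCells.
Variables (R : realType) (n : nat).
Local Notation V := 'rV[R]_n.

Lemma increasing1 (A : {set 'I_1 * 'I_n}) : increasing A.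
Proof. by apply/increasingP => -[i a] [j b] _ _; rewrite /= !ord1. Qed.

Lemma simplex_cell (a b : nat) :
  conv_hull (fun i : {i : 'I_n | (a <= i <= b)%N} => delta_mx ord0 (val i) : V) =
  cell [set p : 'I_1 * 'I_n | (a <= p.2 <= b)%N]%SET.
Proof.
have sumE (F : 'I_n -> R) : \sum_(i : {i : 'I_n | (a <= i <= b)%N}) F (val i) =
    \sum_(i : 'I_n | (a <= i <= b)%N) F i.
  by rewrite (big_sub [pred i : 'I_n | (a <= i <= b)%N] F).
apply/seteqP; split=> [_ [w [w0 w1 ->]]|x [w [w0 w1 wA] wx]].
  exists (fun _ t => \sum_i w i * (val i == t)%:R).
    split=> [_ t|_|j t].
    - by apply: sumr_ge0 => i _; rewrite mulr_ge0 ?ler0n.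
    - rewrite exchange_big -[RHS]w1; apply: eq_bigr => i _ /=.
      by rewrite -mulr_sumr (@sum_delta R 1 n (fun=> val i) ord0) mulr1.
    rewrite inE /= => nt; apply: big1 => i _; case: eqP => [e|_]; last exact: mulr0.
    by have := valP i; rewrite /= e (negPf nt).
  move=> t; rewrite big_ord1 summxE; apply: eq_bigr => i _.
  by rewrite !mxE eqxx /= eq_sym.
have w0' (t : 'I_n) : ~~ (a <= t <= b)%N -> w ord0 t = 0 by move=> nt; apply: wA;
  rewrite inE.
exists (fun i => w ord0 (val i)); split=> //.
  rewrite sumE -[RHS](w1 ord0) [RHS](bigID (fun t : 'I_n => (a <= t <= b)%N)) /=.
  by rewrite [X in _ = _ + X]big1 ?addr0.
apply/rowP => t; rewrite wx big_ord1 summxE.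
rewrite (sumE (fun i => (w ord0 i *: (delta_mx ord0 i : V)) ord0 t)).
rewrite (eq_bigr (fun i => if i == t then w ord0 i else 0)) => [|i _]; last first.
  by rewrite !mxE eqxx /= eq_sym; case: eqP; rewrite ?mulr1 ?mulr0.
rewrite -big_mkcondr /=; have [h|/w0' nt] := boolP (a <= t <= b)%N.
  rewrite (eq_bigl (pred1 t)) ?big_pred1_eq // => i /=.
  by case: eqP => [->|_]; rewrite ?h ?andbF.
by rewrite nt big1 // => i /andP[_ /eqP->].
Qed.

Lemma simplex_complexE (a b : nat) (F : set V) :
  simplex_complex a b F <->
  F = set0 \/ exists A : {set 'I_1 * 'I_n}, [/\ staircase A, within a b A & F = cell A].
Proof.
rewrite /simplex_complex /= simplex_cell face_of_cell; last exact: increasing1.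
split=> -[->|[A]]; try (by left).
  move=> [/fintype.subsetP sA hA ->]; right; exists A; split=> //.
    by rewrite /staircase hA increasing1.
  by move=> p /sA; rewrite inE.
move=> [/andP[hA _] wA ->]; right; exists A; split=> //.
by apply/fintype.subsetP => p /wA; rewrite inE.
Qed.

Lemma minkowski_sum0l (F : set V) : minkowski_sum set0 F = set0.
Proof. by apply/seteqP; split=> // x [? []]. Qed.

Lemma minkowski_sum0r (F : set V) : minkowski_sum F set0 = set0.
Proof. by apply/seteqP; split=> // x [? _ [? []]]. Qed.

(** Peel off the first row. The threshold [k] of the recursive definition is recovered as the
    largest entry of that row, which separates it from the later rows; an empty factor gives the
    empty face. *)
Lemma PcomplexE d (a b : nat) (F : set V) : (a <= b)%N ->
  Pcomplex d.+1 a b F <->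
  F = set0 \/
  exists A : {set 'I_d.+1 * 'I_n}, [/\ staircase A, within a b A & F = cell A].
Proof.
elim: d a F => [|d IHd] a F ab; first exact: simplex_complexE.
split.
  move=> [k /andP[ak kb] [F1 /simplex_complexE h1 [F2 /(IHd _ _ kb) h2 <-]]].
  case: h1 => [->|[A [sA wA ->]]]; first by left; rewrite minkowski_sum0l.
  case: h2 => [->|[B [sB wB ->]]]; first by left; rewrite minkowski_sum0r.
  right; exists (cat_rows A B); split; last exact: minkowski_sum_cell.
    apply: (proj2 (@cat_rows_staircase 1 d.+1 n A B));
      split=> // p q /wA/andP[_ pk] /wB/andP[kq _]; exact: leq_trans pk kq.
  apply: (proj2 (@cat_rows_within 1 d.+1 n A B a b)); split=> p.
    by move=> /wA/andP[-> pk]; apply: leq_trans pk kb.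
  by move=> /wB/andP[kp ->]; rewrite (leq_trans ak kp).
case=> [->|[C [sC wC ->]]].
  exists a; first by rewrite /= leqnn.
  exists set0; first by apply/simplex_complexE; left.
  exists set0; first by apply/(IHd _ _ ab); left.
  exact: minkowski_sum0l.
move: sC wC; have [A [B ->]] := @cat_rows_surj 1 d.+1 n C.
move=> /(proj1 (@cat_rows_staircase 1 d.+1 n A B))[sA sB AB].
move=> /(proj1 (@cat_rows_within 1 d.+1 n A B a b))[wA wB].
have [a0 Aa0] := has_rowsP _ (andP sA).1 ord0.
have [k Ak kmax] := @arg_maxnP _ a0 (fun t => (ord0, t) \in A) val Aa0.
have /andP[ak kb] : (a <= k <= b)%N := wA _ Ak.
have wAk : within a k A.
  move=> [i t] it; have /andP[-> _] := wA _ it.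
  by apply: kmax; have <- : i = ord0 by exact: ord1.
have wBk : within k b B.
  move=> [j t] jt; have /andP[_ ->] := wB _ jt.
  by rewrite (AB (ord0, k) (j, t)).
exists k; first by rewrite /= ak kb.
exists (cell A).
  by apply/simplex_complexE; right; exists A.
exists (cell B).
  by apply/(IHd _ _ kb); right; exists B.
exact: minkowski_sum_cell.
Qed.

End SubdivisionCells.

(** * The complex of boxes and its incidence functions *)

Lemma codim1_natE (a b c : nat) :
  (b%:Z - c%:Z = a%:Z - c%:Z - 1) <-> (a = b.+1).
Proof. by split; lia. Qed.

Lemma codim1_nat0E (a c : nat) : (- (1 : int) = a%:Z - c%:Z - 1) <-> (a = c).
Proof. by split; lia. Qed.

Lemma codim2_codim1 (a b c : int) : b = a - 1 -> c = a - 2 -> c = b - 1.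
Proof. by lia. Qed.

Section BoxComplex.
Variables (R : realType) (d n : nat) (mu : 'I_d -> 'I_n).
Local Notation V := 'rV[R]_n.
Implicit Types (A B C : {set 'I_d * 'I_n}) (F G H : set V) (p q : 'I_d * 'I_n).

Definition box_complex : set (set V) :=
  [set F | F = set0 \/ exists2 A, box mu A & F = cell A].

Lemma box_staircase A : box mu A -> staircase A.
Proof. by case/andP. Qed.

Lemma box_has_rows A : box mu A -> has_rows A.
Proof. by case/boxP. Qed.

Lemma box_increasing A : box mu A -> increasing A.
Proof. by case/boxP. Qed.

Lemma box_complex_cell A : box mu A -> box_complex (cell A).
Proof. by move=> bA; right; exists A. Qed.

Lemma box_complex_face F G : box_complex F -> face_of G F -> box_complex G.
Proof.
case=> [->|[A bA ->]].
  move=> [u [c [_ ->]]]; left; by apply/seteqP; split=> // x [].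
case/face_of_cell_sub => [->|[B [sBA hB ->]]]; first by left.
exact/box_complex_cell/(boxS sBA hB bA).
Qed.

Lemma box_complex_polyhedral : polyhedral_complex box_complex.
Proof.
split.
- apply: (@sub_finite_set _ _ ([set set0] `|` [set cell A | A in [set: {set 'I_d *
  'I_n}]])).
    by move=> F [->|[A _ ->]]; [left | right; exists A].
  by rewrite finite_setU; split; [exact: finite_set1 | exact: finite_image].
- by exists set0; left.
- move=> F [->|[A _ ->]]; last exact: cell_polytope.
  rewrite -(@cell_eq0 R 1 n finset.set0); first exact: cell_polytope.
  by apply/negP => /has_rowsP/(_ ord0)[a]; rewrite inE.
- exact: box_complex_face.
move=> F G [->|[A bA ->]] hG; first by rewrite set0I; split; exact: empty_face.
case: hG => [->|[B bB ->]]; first by rewrite setI0; split; exact: empty_face.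
have [iA iB] := (box_increasing bA, box_increasing bB); rewrite cellI //.
by split; apply: cell_sub_face; rewrite ?finset.subsetIl ?finset.subsetIr.
Qed.

Lemma cell_point A : has_rows A -> #|A| = d -> exists2 f, section A f & A = graph f.
Proof.
move=> hA cA; have [f sf] := has_rows_section hA; exists f => //.
by apply/esym/eqP; rewrite eqEcard graph_sub //= card_graph cA.
Qed.

Lemma card_cell_point A v : staircase A -> cell A = [set v] :> set V -> #|A| = d.
Proof.
move=> sA DA; have [f sf] := has_rows_section (andP sA).1.
have fA := cell_vertex R sf; rewrite DA in fA.
suff -> : A = graph f by rewrite card_graph.
apply: (@cell_inj R _ _ _ _ sA); last by rewrite DA cell_graph fA.
exact: staircaseS (graph_sub sf) (graph_has_rows f) sA.
Qed.

Lemma cell_facetP A B : box mu A -> box mu B ->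
  (face_of (cell B) (cell A : set V) /\ pdim (cell B : set V) = pdim (cell A : set
    V) - 1) <-> facet B A.
Proof.
move=> /box_staircase sA /box_staircase sB; rewrite !pdim_cell // face_cellP //.
rewrite codim1_natE /facet.
by split=> [[-> ->]|/andP[-> /eqP]] //=; rewrite eqxx.
Qed.

Lemma pdim_cell_point A : box mu A ->
  (pdim (set0 : set V) = pdim (cell A : set V) - 1) <-> #|A| = d.
Proof.
move=> /box_staircase sA; rewrite pdim_set0 pdim_cell //.
exact: codim1_nat0E.
Qed.

(** * An explicit incidence function *)

Section Signs.

(** In row-major order the elements of one row are consecutive, which [box_sign_edge] relies on. *)
Definition lex_lt p q := (p.1 < q.1)%N || (p.1 == q.1) && (p.2 < q.2)%N.

Lemma lex_lt_total p q : p != q -> lex_lt p q || lex_lt q p.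
Proof.
case: p q => [i a] [j b]; rewrite /lex_lt /= xpair_eqE negb_and.
by rewrite -!val_eqE /=; lia.
Qed.

Lemma lex_ltNge p q : lex_lt p q -> ~~ lex_lt q p.
Proof.
case: p q => [i a] [j b]; rewrite /lex_lt /=.
by rewrite -!val_eqE /=; lia.
Qed.

Lemma lex_lt_trans p q r : lex_lt p q -> lex_lt q r -> lex_lt p r.
Proof.
case: p q r => [i a] [j b] [l c]; rewrite /lex_lt /=.
by rewrite -!val_eqE /=; lia.
Qed.

Definition rank A p := #|[set q in A | lex_lt q p]%SET|.

Lemma rank_setD1 A p q : p \in A -> lex_lt p q ->
  rank A q = (rank (A :\ p) q).+1 /\ rank (A :\ q) p = rank A p.
Proof.
move=> pA pq; split; last first.
  apply: eq_card => r; rewrite !inE; case: eqP => // ->.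
  by rewrite (negPf (lex_ltNge pq)) !andbF.
rewrite /rank (cardsD1 p) inE pA pq add1n; congr _.+1.
by apply: eq_card => r; rewrite !inE andbA.
Qed.

(* The empty set of indices stands for the empty face. *)
Definition box_sign A B : int :=
  if B == finset.set0 then (#|A| == d)%:R
  else if facet B A then \sum_(p in A :\: B) (-1) ^+ rank A p else 0.

Lemma box_sign_setD1 A p : p \in A -> has_rows (A :\ p) -> (0 < d)%N ->
  box_sign A (A :\ p) = (-1) ^+ rank A p.
Proof.
move=> pA hA d0; rewrite /box_sign facet_setD1 // ifF; last first.
  by apply/negbTE; rewrite -card_gt0 (leq_trans d0) ?has_rows_card.
by rewrite (_ : A :\: (A :\ p) = [set p]%SET) ?big_set1 // finset.setDDr
  finset.setDv finset.set0U;
   apply/finset.setIidPr; rewrite finset.sub1set.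
Qed.

(** As for simplices: deleting the smaller element lowers the rank of the larger by one, while
    deleting the larger keeps the rank of the smaller, so the two products are opposite. *)
Lemma box_sign_diamond A p q : p \in A -> q \in A -> p != q -> (0 < d)%N ->
  has_rows (A :\ p :\ q) ->
  box_sign A (A :\ p) * box_sign (A :\ p) (A :\ p :\ q) +
  box_sign A (A :\ q) * box_sign (A :\ q) (A :\ p :\ q) = 0.
Proof.
move=> pA qA npq d0 h.
have hp : has_rows (A :\ p) by apply: has_rowsS h; apply: subD1set.
have Dpq : A :\ p :\ q = A :\ q :\ p by rewrite !finset.setDDl finset.setUC.
have hq : has_rows (A :\ q) by apply: has_rowsS h; rewrite Dpq; apply: subD1set.
rewrite [in X in _ + X]Dpq !box_sign_setD1 -?Dpq // ?inE ?npq ?pA ?qA 1?eq_sym ?npq //.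
wlog pq : p q pA qA npq {d0 h hp hq Dpq} / lex_lt p q.
  move=> W; have /orP[|] := lex_lt_total npq; first exact: W.
  by move/(W q p qA pA); rewrite eq_sym npq addrC; apply.
have [-> ->] := rank_setD1 pA pq.
by rewrite exprS mulN1r mulrC mulNr subrr.
Qed.

(** Here [p] and [q] form the only two-element row and are consecutive, so their ranks differ by
    one. As vertices have incidence 1 with the empty face, this is the diamond identity at the
    bottom. *)
Lemma box_sign_edge A p q : p \in A -> q \in A -> p != q -> (0 < d)%N ->
  has_rows (A :\ p) -> has_rows (A :\ q) -> #|A| = d.+1 ->
  box_sign A (A :\ p) + box_sign A (A :\ q) = 0.
Proof.
move=> pA qA npq d0 hp hq cA; rewrite !box_sign_setD1 //.
wlog pq : p q pA qA npq hp hq / lex_lt p q.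
  move=> W; have /orP[|] := lex_lt_total npq; first exact: W.
  by move/(W q p qA pA); rewrite eq_sym npq addrC; apply.
have cq : #|A :\ q| = d by have := cardsD1 q A; rewrite qA cA add1n => -[].
have row r s : r \in A -> s \in A -> r != q -> s != q -> r.1 = s.1 -> r = s.
  case: r s => [i a] [j b] ia jb niq njq /= e; rewrite e in ia niq *; congr pair.
  by apply: (card_has_rows_eq hq cq (j := j)); rewrite !inE ?ia ?jb ?niq ?njq.
have e : p.1 = q.1.
  have /has_rowsP/(_ p.1)[b] := hp; rewrite !inE => /andP[nb bA].
  apply/eqP; apply: contraNT nb => n1; apply/eqP; apply: row => //.
  by apply: contra n1 => /eqP <-.
have [-> _] := rank_setD1 pA pq.
suff -> : rank (A :\ p) q = rank A p by rewrite exprS mulN1r subrr.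
apply: eq_card => r; rewrite !inE; have [->|nrp] := eqVneq r p.
  by rewrite pA /= /lex_lt ltnn eqxx ltnn.
rewrite /=; case: (boolP (r \in A)) => //= rA; apply/idP/idP => [rq|rp]; last first.
  exact: lex_lt_trans rp pq.
have /orP[//|pr] := lex_lt_total nrp.
have nrq : r != q by apply: contraTneq rq => ->; rewrite /lex_lt ltnn eqxx ltnn.
have e1 : r.1 = p.1.
  by move: pr rq; rewrite /lex_lt -!val_eqE /= => pr rq; apply: val_inj => /=;
     have := congr1 val e; rewrite /=; lia.
by rewrite (row r p) ?eqxx in nrp.
Qed.

End Signs.

(** The default value doubles as the code of the empty face, in agreement with [box_sign]. *)
Definition code F : {set 'I_d * 'I_n} :=
  xget finset.set0 [set A | staircase A /\ F = cell A].

Lemma code_cell A : staircase A -> code (cell A) = A.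
Proof.
move=> sA; apply: xget_unique => //= B [sB e]; exact: (cell_inj sB sA (esym e)).
Qed.

Lemma code_set0 : code set0 = finset.set0.
Proof. by apply: xgetPN => A [/andP[hA _]] /esym; apply: cell_neq0. Qed.

Lemma box_complex_incidence : (0 < d)%N ->
  exists eps, incidence box_complex eps.
Proof.
move=> d0; exists (fun F G => box_sign (code F) (code G)).
(* As [d > 0], no nonempty cell has an empty index set, which is therefore free to represent the
   empty face. *)
have neq0 A : has_rows A -> A == finset.set0 = false.
  by move=> hA; apply/negbTE; rewrite -card_gt0 (leq_trans d0) ?has_rows_card.
have face0 (F : set V) : face_of F set0 -> F = set0.
  by move=> [u [c [_ ->]]]; apply/seteqP; split=> // x [].
split.
- move=> F G [->|[A bA ->]] hG [fG dG].
    by move: dG; rewrite (face0 _ fG) pdim_set0.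
  case: hG fG dG => [->|[B bB ->]] fG dG;
    rewrite ?code_set0 ?code_cell ?box_staircase //.
    by left; rewrite /box_sign eqxx; have /pdim_cell_point -> // := dG; rewrite eqxx.
  have /facetP[p pA DB] := (cell_facetP bA bB).1 (conj fG dG).
  rewrite DB box_sign_setD1 // -?DB ?box_has_rows //.
  by rewrite -signr_odd; case: odd; [right | left].
- move=> F G [->|[A bA ->]] [->|[B bB ->]] nf;
  rewrite ?code_set0 ?code_cell ?box_staircase //.
  + by rewrite /box_sign eqxx cards0 eq_sym -(prednK d0).
  + rewrite /box_sign neq0 ?box_has_rows // ifF //; apply/negbTE.
    by rewrite /facet negb_and cards0 orbT.
  + rewrite /box_sign eqxx; case: eqP => // cA; case: nf.
    by split; [exact: empty_face | apply/pdim_cell_point].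
  rewrite /box_sign neq0 ?box_has_rows // ifF //; apply/negbTE/negP => fBA.
  by apply: nf; apply/cell_facetP.
- move=> v [/seteqP[/(_ v erefl)] //|[A bA DA]].
  rewrite code_set0 DA code_cell ?box_staircase // /box_sign eqxx.
  by rewrite (card_cell_point (box_staircase bA) (esym DA)) eqxx.
move=> F G1 G2 H [->|[A bA ->]] f1 f2 n12;
  first by rewrite (face0 _ f1) (face0 _ f2) in n12.
have XA := box_complex_cell bA.
have X1 := box_complex_face XA f1; have X2 := box_complex_face XA f2.
move=> h1 h2 d1 d2 dH; have XH := box_complex_face X1 h1.
case: X1 => [D1|[B1 b1 D1]].
  by rewrite D1 in h1 d1; rewrite (face0 _ h1) in dH; lia.
case: X2 => [D2|[B2 b2 D2]].
  by rewrite D2 in h2 d2; rewrite (face0 _ h2) in dH; lia.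
rewrite D1 D2 in f1 f2 n12 h1 h2 d1 d2 *.
have fB1 := (cell_facetP bA b1).1 (conj f1 d1).
have fB2 := (cell_facetP bA b2).1 (conj f2 d2).
have [p pA Dp] := facetP _ _ fB1; have [q qA Dq] := facetP _ _ fB2.
have npq : p != q by apply: contra_notN n12 => /eqP e; rewrite Dp Dq e.
have [hB1 hB2] := (box_has_rows b1, box_has_rows b2).
case: XH => [DH|[C bC DH]].
  rewrite DH code_set0 !code_cell ?box_staircase //.
  have c1 : #|B1| = d by apply/(pdim_cell_point b1); rewrite -DH;
    apply: codim2_codim1 d1 dH.
  have c2 : #|B2| = d by apply/(pdim_cell_point b2); rewrite -DH;
    apply: codim2_codim1 d2 dH.
  rewrite [X in _ * X](_ : _ = 1) ?mulr1; last by rewrite /box_sign eqxx c1 eqxx.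
  rewrite [X in _ + _ * X](_ : _ = 1) ?mulr1; last by rewrite /box_sign eqxx c2 eqxx.
  rewrite Dp Dq; apply: box_sign_edge => //; rewrite -?Dp -?Dq //.
  by move/andP: fB1 => [_ /eqP ->]; rewrite c1.
rewrite DH !code_cell ?box_staircase //; rewrite DH in h1 h2 dH.
have fC1 : facet C B1 by apply/(cell_facetP b1 bC); split=> //;
  apply: codim2_codim1 d1 dH.
have fC2 : facet C B2 by apply/(cell_facetP b2 bC); split=> //;
  apply: codim2_codim1 d2 dH.
have DC : C = A :\ p :\ q.
  have [sC1 sC2] := ((andP fC1).1, (andP fC2).1).
  apply/eqP; rewrite eqEcard; apply/andP; split.
    apply/fintype.subsetP => r rC; rewrite in_setD1 -Dp (fintype.subsetP sC1) // andbT.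
    by have := fintype.subsetP sC2 r rC; rewrite Dq in_setD1 => /andP[].
  have := facet_trans_card fB1 fC1.
  by rewrite (cardsD1 p A) pA (cardsD1 q (A :\ p)) in_setD1 qA eq_sym npq !add1n =>
    -[->].
by rewrite DC Dp Dq; apply: box_sign_diamond => //; rewrite -DC box_has_rows.
Qed.

(** * Scalar coefficients of an arbitrary incidence function *)

Section FromIncidence.
Variables (k : fieldType) (eps : set V -> set V -> int).
Hypothesis inc : incidence box_complex eps.

Definition box_coefficient A B : k :=
  if box mu A && box mu B then (eps (cell A) (cell B))%:~R else 0.

Lemma box_coefficientE A B : box mu A -> box mu B ->
  box_coefficient A B = (eps (cell A) (cell B))%:~R.
Proof. by rewrite /box_coefficient => -> ->. Qed.

(** The coefficients are indexed by boxes, without the empty face; their edge clause is the diamond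
    identity of [eps] with [H] empty, where each vertex has incidence 1. *)
Lemma box_coefficient_incidence : box_incidence mu box_coefficient.
Proof.
have [i1 i2 i3 i4] := inc; split.
- move=> A B; rewrite /box_coefficient; case: ifP => [/andP[bA bB]|_];
  last by rewrite eqxx.
  move=> nz; split=> //; apply: contraNT nz => nf.
  rewrite i2 ?mulr0z //; try exact: box_complex_cell.
  by move=> /(cell_facetP bA bB); rewrite (negPf nf).
- move=> A B bA bB fBA; rewrite box_coefficientE //.
  have [->|->] := i1 _ _ (box_complex_cell bA) (box_complex_cell bB)
    ((cell_facetP bA bB).2 fBA); first by rewrite mulr1.
  by rewrite mulrNz mulrNN mulr1.
- move=> A B1 B2 C bA bC n12 f1 f2 g1 g2.
  have b1 : box mu B1.
    by apply: boxS bA; [exact: (andP f1).1 | apply: has_rowsS (andP g1).1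
      (box_has_rows bC)].
  have b2 : box mu B2.
    by apply: boxS bA; [exact: (andP f2).1 | apply: has_rowsS (andP g2).1
      (box_has_rows bC)].
  rewrite !box_coefficientE // -!intrM -intrD (i4 _ _ _ _ (box_complex_cell bA)) //.
  + exact: ((cell_facetP bA b1).2 f1).1.
  + exact: ((cell_facetP bA b2).2 f2).1.
  + by move/(cell_inj (box_staircase b1) (box_staircase b2))/eqP; rewrite (negPf n12).
  + exact: ((cell_facetP b1 bC).2 g1).1.
  + exact: ((cell_facetP b2 bC).2 g2).1.
  + exact: ((cell_facetP bA b1).2 f1).2.
  + exact: ((cell_facetP bA b2).2 f2).2.
  by rewrite ((cell_facetP b1 bC).2 g1).2 ((cell_facetP bA b1).2 f1).2 -addrA.
move=> A B1 B2 bA b1 b2 n12 f1 f2 cA.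
have cB B : facet B A -> #|B| = d by move=> /andP[_]; rewrite cA => /eqP[].
have point B : box mu B -> facet B A -> eps (cell B) set0 = 1.
  move=> bB fB; have [f _ DB] := cell_point (box_has_rows bB) (cB _ fB).
  rewrite DB cell_graph; apply: i3; rewrite /complex_vertices /= -cell_graph -DB.
  exact: box_complex_cell.
have dimB B : box mu B -> facet B A -> pdim (set0 : set V) = pdim (cell B : set V) - 1.
  by move=> bB fB; apply: (pdim_cell_point bB).2; exact: cB.
rewrite !box_coefficientE // -intrD.
have := i4 (cell A) (cell B1) (cell B2) set0 (box_complex_cell bA).
rewrite !point // !mulr1 => -> //.
+ exact: ((cell_facetP bA b1).2 f1).1.
+ exact: ((cell_facetP bA b2).2 f2).1.
+ by move/(cell_inj (box_staircase b1) (box_staircase b2))/eqP; rewrite (negPf n12).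
+ exact: empty_face.
+ exact: empty_face.
+ exact: ((cell_facetP bA b1).2 f1).2.
+ exact: ((cell_facetP bA b2).2 f2).2.
by rewrite (dimB _ b1 f1) ((cell_facetP bA b1).2 f1).2 -addrA.
Qed.

End FromIncidence.

End BoxComplex.

(** * Shellings *)

Lemma bigcup_nth_take (T : eqType) (V : Type) (h : T -> set V) (s : seq T) e :
  (e <= size s)%N ->
  \bigcup_(i in `I_e) nth set0 (map h s) i = \bigcup_(p in [set` take e s]) h p.
Proof.
move=> es; apply/seteqP; split=> x.
  move=> [i /= ie hx]; have is_ : (i < size s)%N := leq_trans ie es.
  case: s es is_ hx => // p0 s es is_ hx; exists (nth p0 (p0 :: s) i).
    by rewrite /= -(nth_take p0 ie) mem_nth // size_takel.
  by move: hx; rewrite (nth_map p0).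
move=> [p /= ps hx]; have ip := ps; rewrite -index_mem in ip.
have ie : (index p (take e s) < e)%N by rewrite (leq_trans ip) // size_take_min
  geq_minl.
exists (index p (take e s)) => //; rewrite (nth_map p).
  by rewrite -(nth_take p ie) nth_index.
exact: leq_trans ie es.
Qed.

Section BoundaryShelling.
Variables (R : realType) (d n : nat).
Local Notation V := 'rV[R]_n.
Implicit Types (A B C T : {set 'I_d * 'I_n}) (F G H : set V) (p q : 'I_d * 'I_n).

Definition removable A : {set 'I_d * 'I_n} := [set p in A | has_rows (A :\ p)]%SET.

Lemma removableP A p : reflect (p \in A /\ has_rows (A :\ p)) (p \in removable A).
Proof. by rewrite inE; apply: andP. Qed.

Lemma removable_row A p q : has_rows A -> p \in A -> q \in A -> p.1 = q.1 -> p != q ->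
  p \in removable A.
Proof.
move=> hA pA qA e npq; apply/removableP; split=> //.
apply: (has_rows_setD1 (a := q.2) hA); first by rewrite e -surjective_pairing.
by apply: contra npq => /eqP e2; rewrite [p]surjective_pairing [q]surjective_pairing
  e e2.
Qed.

Lemma boundary_cellE A F : staircase A ->
  boundary_complex (cell A) F <->
  F = set0 \/ exists B, [/\ B \proper A, has_rows B & F = cell B].
Proof.
move=> sA; have [hA iA] := andP sA; split.
  move=> [/face_of_cell_sub[->|[B [sBA hB DF]]] nF]; [by left | right].
  exists B; split=> //; rewrite finset.properEneq sBA andbT.
  by apply: contra_notN nF => /eqP <-.
case=> [->|[B [pBA hB ->]]]; split.
- exact: empty_face.
- by move/esym; apply: cell_neq0.
- exact: cell_sub_face iA (proper_sub pBA).
move/(cell_inj (staircaseS (proper_sub pBA) hB sA) sA) => e.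
by rewrite e fintype.properxx in pBA.
Qed.

(** The bound [d < #|A|] excludes a point, whose boundary has the empty face as its maximal face. In
    positive dimension a row with two elements provides a nonempty facet. *)
Lemma maximal_boundary_cell A F : staircase A -> (d < #|A|)%N ->
  maximal_faces (boundary_complex (cell A)) F <->
  exists2 p, p \in removable A & F = cell (A :\ p).
Proof.
move=> sA cA; have [hA iA] := andP sA.
have sD p : p \in removable A -> staircase (A :\ p).
  by move=> /removableP[pA hp]; apply: staircaseS (subD1set _ _) hp sA.
have bD p : p \in removable A -> boundary_complex (cell A) (cell (A :\ p) : set V).
  move=> /removableP[pA hp]; apply/boundary_cellE => //; right; exists (A :\ p).
  by split=> //; apply: properD1.
split=> [[/(boundary_cellE _ sA)[->|[B [pBA hB ->]]] maxF]|[p pA ->]].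
- have [p [q [pA qA e npq]]] := wide_row cA.
  have pr := removable_row hA pA qA e npq.
  case: (@cell_neq0 R d n (A :\ p)); first by have [] := removableP _ _ pr.
  by apply: maxF; [exact: bD | exact: classical_sets.sub0set].
- have [/fintype.subsetP sBA [p pA npB]] := properP pBA.
  have sBp : B \subset A :\ p by rewrite subsetD1 npB andbT (proper_sub pBA).
  have pr : p \in removable A by apply/removableP; split=> //; apply: has_rowsS hB.
  by exists p => //; apply/esym/maxF; [exact: bD | exact: cell_sub].
split=> [|G /(boundary_cellE _ sA)[->|[B [pBA hB ->]]] sub]; first exact: bD.
  have [_ hp] := removableP _ _ pA.
  by case: (cell_neq0 (R := R) hp); apply/seteqP; split=> // x /sub.
have sB := staircaseS (proper_sub pBA) hB sA.
have sAB := cell_subset (sD _ pA) sB sub.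
congr cell; apply/eqP; rewrite eq_sym eqEcard sAB /=.
have [pA' _] := removableP _ _ pA.
by have := proper_card pBA; rewrite (cardsD1 p A) pA' add1n ltnS.
Qed.

Lemma orders_boundary_facets A s : staircase A -> (d < #|A|)%N ->
  uniq s -> s =i removable A ->
  orders_maximal_faces [seq (cell (A :\ p) : set V) | p <- s] (boundary_complex
    (cell A)).
Proof.
move=> sA cA us sE; split.
  rewrite map_inj_in_uniq // => p q; rewrite !sE => pr qr.
  have [[pA hp] [qA hq]] := (removableP _ _ pr, removableP _ _ qr).
  move/(cell_inj (staircaseS (subD1set _ _) hp sA) (staircaseS (subD1set _ _) hq
    sA)) => e.
  apply/eqP/negPn/negP => npq; have : p \in A :\ q by rewrite !inE npq.
  by rewrite -e !inE eqxx.
apply/seteqP; split=> F /=.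
  move/mapP => [p ps ->]; apply/maximal_boundary_cell => //; exists p => //.
  by rewrite -sE.
move/(maximal_boundary_cell _ sA cA) => [p pr ->].
by apply: map_f; rewrite sE.
Qed.

(* A sufficient condition for the facets [A :\ p], [p \in T], to be an initial
   segment of a shelling of the boundary of [cell A]. *)
Definition initial_facets A T : Prop :=
  T \subset removable A /\
  exists p q, [/\ p \in T, q \in A, p.1 = q.1, p != q &
    q \in T -> removable A \subset T].

Lemma initial_facets_all A : has_rows A -> (d < #|A|)%N ->
  initial_facets A (removable A).
Proof.
move=> hA cA; split; first exact: subxx.
have [p [q [pA qA e npq]]] := wide_row cA.
by exists p, q; split=> //; exact: removable_row hA pA qA e npq.
Qed.

(** Unless [T] is everything, list [p], the rest of [T], the other facets, and [q] last. The cell of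
    [A :\ r] meets the earlier facets in cells of sets [A :\ r :\ t], and these elements [t] again
    satisfy [initial_facets], now in [A :\ r]: induction on the cardinality applies. *)
Lemma shelling_initial_facets A T : staircase A -> (d < #|A|)%N -> initial_facets A T ->
  exists b, shelling (boundary_complex (cell A : set V)) b /\
    exists2 e, (e <= size b)%N &
      \bigcup_(i in `I_e) nth set0 b i = \bigcup_(p in [set` T]) cell (A :\ p).
Proof.
have [m] := ubnP #|A|; elim: m A T => // m IHm A T le_Am sA cA.
have [hA iA] := andP sA.
suff order p s q : p \in A -> q \in A -> p.1 = q.1 ->
    uniq (p :: rcons s q) -> p :: rcons s q =i removable A ->
    shelling (boundary_complex (cell A : set V))
      [seq cell (A :\ r) | r <- p :: rcons s q].
  move=> [sT [p [q [pT qA e npq qT]]]].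
  have pA : p \in A by have /removableP[] := fintype.subsetP sT p pT.
  have qr : q \in removable A by apply: removable_row hA qA pA (esym e) _;
    rewrite eq_sym.
  pose s1 := enum (T :\ p :\ q); pose s2 := enum (removable A :\: T :\ q).
  have perm : p :: rcons (s1 ++ s2) q =i removable A.
    move=> r; rewrite inE mem_rcons inE mem_cat !mem_enum !inE.
    have [->|nrp] := eqVneq r p; first by have := fintype.subsetP sT p pT;
      rewrite inE => ->.
    have [->|nrq] := eqVneq r q; first by move: qr; rewrite inE /= => ->.
    by have := fintype.subsetP sT r; rewrite inE /=; case: (r \in T) => //= ->.
  have us : uniq (p :: rcons (s1 ++ s2) q).
    rewrite /= rcons_uniq mem_rcons inE (negPf npq) cat_uniq !enum_uniq !mem_cat
      !mem_enum.
    rewrite !inE pT !eqxx ?andbF /= andbT.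
    by apply/hasPn => r; rewrite !mem_enum !inE => /and3P[_ /negPf -> _];
      rewrite !andbF.
  exists [seq cell (A :\ r) | r <- p :: rcons (s1 ++ s2) q]; split; first exact: order.
  have [/qT Tall|nqT] := boolP (q \in T).
    exists (size (p :: rcons (s1 ++ s2) q)); first by rewrite size_map.
    rewrite bigcup_nth_take // take_size; congr (\bigcup_(r in _) _).
    apply/seteqP; split=> r /=; rewrite perm;
      [exact: (fintype.subsetP Tall) | exact: (fintype.subsetP sT)].
  have sz : (size (p :: s1) <= size (p :: rcons (s1 ++ s2) q))%N.
    by rewrite /= size_rcons size_cat ltnS leqW ?leq_addr.
  exists (size (p :: s1)); first by rewrite size_map.
  rewrite bigcup_nth_take //.
  rewrite -cats1 -catA -cat_cons take_size_cat //; congr (\bigcup_(r in _) _).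
  apply/seteqP; split=> r /=; rewrite inE mem_enum !inE.
    by case/predU1P => [->|/and3P[]].
  move=> rT; rewrite rT; have [//|nrp] := eqVneq r p.
  by rewrite /= andbT; apply: contraNneq nqT => <-.
move=> pA qA epq us sE; have npq : p != q.
  by move: us => /=; rewrite mem_rcons inE negb_or => /andP[/andP[]].
have ord := orders_boundary_facets sA cA us sE.
(* The cell is an edge and its facets are points. *)
have [cA1|cA1] := leqP #|A| d.+1.
  apply: shelling_points => // F /mapP[r]; rewrite sE => /removableP[rA hr] ->.
  have [|f _ ->] := cell_point hr; last by exists (vertex R f); rewrite cell_graph.
  apply/eqP; rewrite eqn_leq (has_rows_card hr) andbT -ltnS (leq_trans _ cA1) //.
  by rewrite [ltnRHS](cardsD1 r) rA.
have sub r : r \in removable A -> [/\ staircase (A :\ r), (d < #|A :\ r|)%N & (#|A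
  :\ r| < m)%N].
  move=> /removableP[rA hr]; split; first exact: staircaseS (subD1set _ _) hr sA.
    by move: cA1; rewrite (cardsD1 r) rA.
  by move: le_Am; rewrite (cardsD1 r) rA.
rewrite map_cons; apply: shelling_polytopes; first exact: ord.
  have [|s1 c1 m1] := sub p; first by rewrite -sE mem_head.
  have [b [sb _]] := IHm _ _ m1 s1 c1 (initial_facets_all (andP s1).1 c1).
  by exists b.
move=> j; rewrite size_map size_rcons => /andP[j0 js].
rewrite -[cell (A :\ p) :: _]/([seq (cell (A :\ r) : set V) | r <- p :: rcons s q]).
set r := nth p (p :: rcons s q) j.
have js' : (j < size (p :: rcons s q))%N by rewrite /= size_rcons.
have FjE : nth set0 [seq (cell (A :\ t) : set V) | t <- p :: rcons s q] j = cell (A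
  :\ r).
  exact: (nth_map p).
have prevE := @bigcup_nth_take _ _ (fun t => cell (A :\ t) : set V) _ _ (ltnW js').
cbv zeta; rewrite FjE prevE.
have rs : r \in p :: rcons s q by apply: mem_nth.
have rr : r \in removable A by rewrite -sE.
have [s1 c1 m1] := sub r rr; have [rA hr] := removableP _ _ rr.
have [_ iAr] := andP s1.
(* An earlier [t] that is not removable in [A :\ r] forms with [r] a whole row of [A]; the two
   facets are then disjoint and [t] contributes nothing. *)
pose T1 := [set t in removable (A :\ r) | t \in take j (p :: rcons s q)]%SET.
have ntake t : t \in take j (p :: rcons s q) -> t != r.
  move=> tj; apply: contraTneq tj => ->; rewrite in_take // /r index_uniq // ltnn //.
have meetE : cell (A :\ r) `&` \bigcup_(t in [set` take j (p :: rcons s q)]) cell (A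
  :\ t) =
    \bigcup_(t in [set` T1]) cell (A :\ r :\ t) :> set V.
  have DI t : cell (A :\ r) `&` cell (A :\ t) = cell (A :\ r :\ t) :> set V.
    rewrite cellI //; last exact: increasingS (subD1set _ _) iA.
    by congr cell; apply/setP => u; rewrite !inE; case: (u \in A);
      rewrite ?andbF ?andbT 1?andbC.
  apply/seteqP; split=> x.
    move=> [xr [t /= tj xt]]; exists t => /=; last by rewrite -DI.
    have xrt : cell (A :\ r :\ t) x by rewrite -DI.
    rewrite inE tj andbT; apply/removableP; split; last by apply/cell_nonempty;
      exists x.
    have : t \in removable A by rewrite -sE (mem_take tj).
    by move=> /removableP[tA _]; rewrite !inE tA andbT ntake.
  by move=> [t /=]; rewrite inE => /andP[_ tj]; rewrite -DI => -[xr xt]; split=> //;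
    exists t.
rewrite meetE.
have iT : initial_facets (A :\ r) T1.
  split; first by apply/fintype.subsetP => t; rewrite inE => /andP[].
  have qs : q \notin p :: s by move: us; rewrite -rcons_cons rcons_uniq => /andP[].
  (* Before the last position [p] is already listed, [q] is not, and both remain in [A :\ r], so
     they are witnesses again. At the last position [r = q] and all facets of [A :\ q] are met. *)
  have [jS|jS] := ltnP j (size (p :: s)).
    have nrq : r != q.
      apply: contraNneq qs => <-; rewrite /r -rcons_cons nth_rcons jS; exact: mem_nth.
    have nrp : r != p by rewrite -[p in X in _ != X]/(nth p (p :: rcons s q) 0)
      nth_uniq // -lt0n.
    have pAr : p \in A :\ r by rewrite !inE pA eq_sym nrp.
    have qAr : q \in A :\ r by rewrite !inE qA eq_sym nrq.
    exists p, q; split=> //.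
      rewrite inE (removable_row hr pAr qAr) //=; case: (j) j0 => // j' _;
        exact: mem_head.
    rewrite inE => /andP[_]; rewrite -rcons_cons -cats1 takel_cat ?(ltnW jS) //.
    by move/mem_take; rewrite (negPf qs).
  have jE : j = size (p :: s) by apply/eqP; rewrite eqn_leq jS andbT.
  have rq : r = q by rewrite /r jE -rcons_cons nth_rcons ltnn eqxx.
  have Tall : removable (A :\ r) \subset T1.
    apply/fintype.subsetP => t tr; rewrite inE tr.
    have /removableP[] := tr; rewrite finset.in_setD1 => /andP[ntr tA] ht.
    have : t \in p :: rcons s q.
      rewrite sE; apply/removableP; split=> //.
      by apply: has_rowsS ht; rewrite finset.setDDl finset.setUC -finset.setDDl
        subD1set.
    rewrite -rcons_cons mem_rcons inE -rq; case/predU1P => [tr'|tps].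
      by rewrite tr' eqxx in ntr.
    by rewrite jE -cats1 take_size_cat.
  have [_ [p1 [q1 [pr1 qA1 e1 n1 _]]]] := initial_facets_all (andP s1).1 c1.
  by exists p1, q1; split=> //; apply: (fintype.subsetP Tall).
have [b [sb [e eb De]]] := IHm _ _ m1 s1 c1 iT; split; last first.
  by exists b; split=> //; exists e; rewrite // De.
have [sT [t [_ [tT _ _ _ _]]]] := iT; have /removableP[_ ht] := fintype.subsetP sT t tT.
by have [x xt] := (@cell_nonempty R d n _).2 ht; exists x, t.
Qed.

End BoundaryShelling.

(** * Maximal boxes as lattice paths *)

Section MaximalBoxes.
Variables (R : realType) (d n : nat) (mu : 'I_d -> 'I_n) (last : 'I_d).
Hypothesis mu_mono : forall i j : 'I_d, (i <= j)%N -> (mu i <= mu j)%N.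
Hypothesis lastP : forall j : 'I_d, (j <= last)%N.
Local Notation V := 'rV[R]_n.
Implicit Types (A B C T : {set 'I_d * 'I_n}) (p q : 'I_d * 'I_n).
Implicit Types (c e : {ffun 'I_d -> 'I_n}).

Lemma d_last : d = last.+1.
Proof.
case: d last lastP => [|d'] l lP; first by case: l {lP}.
by apply/eqP; rewrite eqn_leq; apply/andP; split;
  [exact: (lP ord_max) | exact: ltn_ord].
Qed.

(** For increasing [c] this is the corner of the preceding row, and the empty maximum gives 0 in the
    first row; no predecessor on ['I_d] is needed. *)
Definition prev_corner c (j : 'I_d) : nat := \max_(i < d | (i < j)%N) c i.

Definition corners c : bool :=
  [&& [forall j, prev_corner c j <= c j]%N, [forall j, c j <= mu j]%N & c last == mu
    last].

(* Row [j] of the maximal box with corners [c] is the interval [c (j-1), c j],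
   where [c (-1)] stands for 0. *)
Definition corner_box c : {set 'I_d * 'I_n} :=
  [set p : 'I_d * 'I_n | (prev_corner c p.1 <= p.2 <= c p.1)%N]%SET.

Lemma prev_leP c (j : 'I_d) (a : nat) :
  reflect (forall i : 'I_d, (i < j)%N -> (c i <= a)%N) (prev_corner c j <= a)%N.
Proof. exact: bigmax_leqP. Qed.

Lemma le_prev c (i j : 'I_d) : (i < j)%N -> (c i <= prev_corner c j)%N.
Proof. by move: i; apply/prev_leP. Qed.

Lemma cornersP c : reflect
  [/\ forall i j : 'I_d, (i < j)%N -> (c i <= c j)%N,
      forall j, (c j <= mu j)%N & c last = mu last] (corners c).
Proof.
apply: (iffP and3P) => [[/forallP h1 /forallP h2 /eqP h3]|[h1 h2 h3]]; split=> //.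
- by move=> i j; move: i; apply/prev_leP.
- by apply/forallP => j; apply/prev_leP => i; apply: h1.
- exact/forallP.
- exact/eqP.
Qed.

Lemma corner_mem c j : corners c -> (j, c j) \in corner_box c.
Proof. by case/and3P => /forallP h _ _; rewrite inE /= h leqnn. Qed.

Lemma corner_box_box c : corners c -> box mu (corner_box c).
Proof.
move=> hc; have [h1 h2 h3] := cornersP _ hc; apply/boxP; split.
- by apply/has_rowsP => j; exists (c j); apply: corner_mem.
- apply/increasingP => -[i a] [j b]; rewrite !inE /= => /andP[_ ai] /andP[jb _] ij.
  exact: leq_trans ai (leq_trans (le_prev c ij) jb).
by move=> [j a]; rewrite inE /= => /andP[_ aj]; apply: leq_trans aj (h2 j).
Qed.

(** Use the row maxima as corners, raising the last one to [mu last]; as the rows increase, each row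
    starts at or above the earlier maxima. *)
Lemma sub_corner_box A : box mu A -> exists2 c, corners c & A \subset corner_box c.
Proof.
move=> /boxP[/has_rowsP hA iA lA].
have ex j : exists b, (j, b) \in A /\ forall a, (j, a) \in A -> (a <= b)%N.
  have [a0 ja0] := hA j.
  have [b jb bmax] := @arg_maxnP _ a0 (fun a => (j, a) \in A) val ja0.
  by exists b.
have [f hf] := choice ex.
pose c := [ffun j : 'I_d => if j == last then mu last else f j].
have cl (i j : 'I_d) : (i < j)%N -> c i = f i.
  move=> ij; rewrite ffunE ifF //; apply: contraTF ij => /eqP->.
  by rewrite -leqNgt lastP.
exists c.
  apply/cornersP; split=> [i j ij|j|]; last by rewrite ffunE eqxx.
    rewrite (cl _ _ ij) ffunE; case: eqP => [_|_].
      exact: leq_trans (lA _ (hf i).1) (mu_mono (lastP i)).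
    exact: (increasingP _ iA (i, f i) (j, f j) (hf i).1 (hf j).1 ij).
  by rewrite ffunE; case: eqP => [->|_] //; apply: (lA _ (hf j).1).
apply/fintype.subsetP => -[j a] ja; rewrite inE /=; apply/andP; split.
  apply/prev_leP => i ij; rewrite (cl _ _ ij).
  exact: (increasingP _ iA (i, f i) (j, a) (hf i).1 ja ij).
rewrite ffunE; case: eqP => [jl|_]; last exact: (hf j).2.
by rewrite -jl; apply: (lA _ ja).
Qed.

(** On an increasing set [(j, a) -> j + a] is injective: the entries lie on a monotone lattice path
    ending at most at [(last, mu last)]. *)
Lemma card_box_le A : box mu A -> (#|A| <= d + mu last)%N.
Proof.
move=> /boxP[_ iA lA]; rewrite cardE -(size_map (fun p => p.1 + p.2)%N).
rewrite -[X in (_ <= X)%N](size_iota 0); apply: uniq_leq_size.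
  rewrite map_inj_in_uniq ?enum_uniq // => -[i a] [j b];
    rewrite !mem_enum => ia jb /= e.
  have ij : (i : nat) = j.
    case: (ltngtP i j) => // ij.
      by have := increasingP _ iA _ _ ia jb ij; rewrite /=; lia.
    by have := increasingP _ iA _ _ jb ia ij; rewrite /=; lia.
  by congr pair; apply: val_inj => //=; move: e; rewrite ij => /addnI.
move=> s /mapP[[j a]]; rewrite mem_enum => ja -> /=; rewrite mem_iota /= add0n.
have h1 := lA _ ja; have h2 := mu_mono (lastP j); have h3 := ltn_ord j.
by rewrite /= in h1; apply: (@leq_ltn_trans (j + mu last));
  rewrite ?ltn_add2r // leq_add2l (leq_trans h1).
Qed.

(** The map [(j, a) -> j + a] is also onto here: a corner box is a full lattice path, with one entry
    on each antidiagonal. *)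
Lemma card_corner_box c : corners c -> #|corner_box c| = (d + mu last)%N.
Proof.
move=> hc; apply/eqP; rewrite eqn_leq card_box_le ?corner_box_box //=.
have [h1 h2 h3] := cornersP _ hc.
rewrite -[X in (X <= _)%N](size_iota 0) cardE -(size_map (fun p => p.1 + p.2)%N).
apply: uniq_leq_size (iota_uniq _ _) _ => s; rewrite mem_iota /= add0n => sN.
have slast : (s <= last + c last)%N by rewrite h3 -ltnS -addSn -d_last.
(* Antidiagonal [s] is met in the first row whose corner reaches it. *)
have [j sj jmin] := @arg_minnP _ last (fun j : 'I_d => s <= j + c j)%N val slast.
have prevs (i : 'I_d) : (i < j)%N -> (i + c i < s)%N.
  by move=> ij; rewrite ltnNge; apply/negP => /jmin; rewrite leqNgt ij.
have low (i : 'I_d) : (i < j)%N -> (c i + j <= s)%N.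
  move=> ij; have j1 : (j.-1 < d)%N by apply: leq_ltn_trans (leq_pred _) (ltn_ord j).
  pose i1 := Ordinal j1; have i1j : (i1 < j)%N by rewrite /= prednK //
    (leq_ltn_trans _ ij).
  have cii1 : (c i <= c i1)%N.
    have : (i <= i1)%N by rewrite /= -ltnS prednK // (leq_ltn_trans _ ij).
    by rewrite leq_eqVlt => /orP[/eqP/val_inj-> //|]; apply: h1.
  by have := prevs _ i1j; rewrite /=; lia.
have js : (j <= s)%N.
  have [j0|j0] := posnP j; first by rewrite j0.
  have i0 : (0 < d)%N by rewrite d_last.
  exact: leq_trans (leq_addl _ _) (low (Ordinal i0) j0).
have an : (s - j < n)%N by rewrite (leq_ltn_trans _ (ltn_ord (c j))) // leq_subLR.
apply/mapP; exists (j, Ordinal an); last by rewrite /= subnKC.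
rewrite mem_enum inE /=; apply/andP; split; last by rewrite leq_subLR.
by apply/prev_leP => i /low; lia.
Qed.

End MaximalBoxes.

(** * Shelling by the sum of the corners *)

Section BoxComplexShelling.
Variables (R : realType) (d n : nat) (mu : 'I_d -> 'I_n) (last : 'I_d).
Hypothesis mu_mono : forall i j : 'I_d, (i <= j)%N -> (mu i <= mu j)%N.
Hypothesis lastP : forall j : 'I_d, (j <= last)%N.
Local Notation V := 'rV[R]_n.
Implicit Types (A B C T : {set 'I_d * 'I_n}) (p q : 'I_d * 'I_n).
Implicit Types (c e : {ffun 'I_d -> 'I_n}).

Local Notation corners := (corners mu last).

Lemma corners_mu : corners [ffun j => mu j].
Proof.
apply/cornersP; split=> [i j ij|j|]; rewrite !ffunE //.
exact/mu_mono/ltnW.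
Qed.

Lemma corner_box_inj c e : corners c -> corners e ->
  corner_box c = corner_box e -> c = e.
Proof.
move=> hc he ce; apply/ffunP => j; apply: val_inj; apply/eqP; rewrite eqn_leq.
have := corner_mem j hc; rewrite ce inE => /andP[_ /= ->].
by have := corner_mem j he; rewrite -ce inE => /andP[_ /= ->].
Qed.

(** Every box lies in a corner box, and the corner boxes all have the largest cardinality, so none
    can be enlarged. *)
Lemma maximal_box_complex (F : set V) :
  maximal_faces (@box_complex R d n mu) F <->
    exists2 c, corners c & F = cell (corner_box c).
Proof.
split=> [[[->|[A bA ->]] maxF]|[c hc ->]].
- have bm := corner_box_box corners_mu.
  case: (@cell_neq0 R d n (corner_box [ffun j => mu j])); first exact: box_has_rows bm.
  by apply: maxF; [exact: box_complex_cell | exact: classical_sets.sub0set].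
- have [c hc sAc] := sub_corner_box mu_mono lastP bA.
  exists c => //; apply/esym/maxF; last exact: cell_sub.
  exact: box_complex_cell (corner_box_box hc).
have bc := corner_box_box hc; split; first exact: box_complex_cell.
move=> G [->|[B bB ->]] sub.
  have [x xc] := (@cell_nonempty R d n _).2 (box_has_rows bc).
  by have := sub _ xc.
have sAB := cell_subset (box_staircase bc) (box_staircase bB) sub.
congr cell; apply/esym/eqP; rewrite eqEcard sAB.
by rewrite (card_corner_box mu_mono lastP hc) (card_box_le mu_mono lastP bB).
Qed.

Lemma box_complex_pure : pure (@box_complex R d n mu).
Proof.
move=> F G /maximal_box_complex[c hc ->] /maximal_box_complex[e he ->].
have [bc be] := (corner_box_box hc, corner_box_box he).
rewrite !pdim_cell ?(box_staircase bc) ?(box_staircase be) //.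
by rewrite !(card_corner_box mu_mono lastP).
Qed.

Definition weight c : nat := (\sum_j c j)%N.

(* The facets shared with an earlier maximal box: removing the top element of
   row [j] leaves a subset of the box obtained by lowering the corner [c j]. *)
Definition descents c : {set 'I_d * 'I_n} :=
  [set p : 'I_d * 'I_n | [&& (p.1 < last)%N, p.2 == c p.1 & (prev_corner c p.1 <
    p.2)%N]]%SET.

(** Let [j] be the first row with [e j < c j]; it exists because [e] differs from [c] and is not
    heavier. Earlier corners of [c] are at most those of [e], hence at most [e j], so [c j] is a
    descent that row [j] of [e] does not reach. Row [last] is excluded, both corners there being
    [mu last]. *)
Lemma descent_exists c e : corners c -> corners e -> e != c ->
  (weight e <= weight c)%N ->
  exists2 p, p \in descents c & p \notin corner_box e.
Proof.
move=> hc he nec we; have [c1 c2 c3] := cornersP _ _ _ hc;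
  have [e1 e2 e3] := cornersP _ _ _ he.
have ex : [exists j, (e j < c j)%N].
  apply: contraNT nec => /existsPn h; have ge j : (c j <= e j)%N by rewrite leqNgt.
  apply/eqP/ffunP => j; apply: val_inj; apply/eqP; rewrite eqn_leq ge andbT.
  move: we; rewrite /weight (bigD1 j) //= [X in (_ <= X)%N](bigD1 j) //= => we.
  rewrite -(leq_add2r (\sum_(i | i != j) c i)); apply: leq_trans we.
  by rewrite leq_add2l; apply: leq_sum => i _; exact: ge.
have [j0 ej0] := existsP ex.
have [j ej jmin] := @arg_minnP _ j0 (fun j => e j < c j)%N val ej0.
exists (j, c j); last by rewrite inE /= negb_and -!ltnNge ej orbT.
rewrite inE /= eqxx /=; apply/andP; split.
  rewrite ltn_neqAle lastP andbT; apply: contraTneq ej => /val_inj->.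
  by rewrite c3 e3 ltnn.
apply: (@leq_ltn_trans (e j)) => //; apply/prev_leP => i ij.
by apply: leq_trans (e1 _ _ ij); rewrite leqNgt; apply: contraL ij => /jmin /=;
  rewrite -leqNgt.
Qed.

(** The strict inequality in [descents] keeps the corners increasing after [c j] is lowered by one,
    and later rows can only start earlier. *)
Lemma descent_neighbour c p : corners c -> p \in descents c ->
  exists e, [/\ corners e, (weight e < weight c)%N & corner_box c :\ p \subset
    corner_box e].
Proof.
case: p => j a hc; have [c1 c2 c3] := cornersP _ _ _ hc.
rewrite inE /= => /and3P[jl /eqP -> pj].
have cj1 : ((c j).-1 < n)%N by apply: leq_ltn_trans (leq_pred _) (ltn_ord _).
have cj0 : (0 < c j)%N by apply: leq_ltn_trans pj.
pose e := [ffun i : 'I_d => if i == j then Ordinal cj1 else c i].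
have ej : e j = (c j).-1 :> nat by rewrite ffunE eqxx.
have eN i : i != j -> e i = c i by move=> /negPf nij; rewrite ffunE nij.
have le_ec i : (e i <= c i)%N.
  by have [->|/eN-> //] := eqVneq i j; rewrite ej leq_pred.
have prev_le i : (prev_corner e i <= prev_corner c i)%N.
  by apply/prev_leP => i' ii'; apply: leq_trans (le_ec _) (le_prev c ii').
exists e; split.
- apply/cornersP; split=> [i i' ii'|i|]; last 1 first.
  + by rewrite eN // -val_eqE /= neq_ltn jl orbT.
  + have [e'|/eN->] := eqVneq i' j; last exact: leq_trans (le_ec i) (c1 _ _ ii').
    rewrite e' ej in ii' *; apply: leq_trans (le_ec i) _.
    by rewrite -ltnS prednK //; apply: leq_ltn_trans (le_prev c ii') pj.
  + exact: leq_trans (le_ec i) (c2 i).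
- rewrite /weight (bigD1 j) //= [X in (_ < X)%N](bigD1 j) //= ej.
  rewrite (eq_bigr (fun i => c i : nat)) => [|i /eN-> //].
  by rewrite ltn_add2r prednK.
apply/fintype.subsetP => -[i b]; rewrite !inE /= xpair_eqE negb_and =>
  /andP[nb /andP[pb bc]].
rewrite (leq_trans (prev_le i) pb) /=.
have [ij|/eN-> //] := eqVneq i j; rewrite ij eqxx /= in nb bc *.
by rewrite ej -ltnS prednK // ltn_neqAle bc andbT.
Qed.

Lemma box_complex_shellable : shellable (@box_complex R d n mu).
Proof.
split; first exact: box_complex_pure.
have d0 : (0 < d)%N by rewrite (d_last lastP).
pose wle c e := (weight c <= weight e)%N.
have wle_trans : transitive wle by move=> x y z; exact: leq_trans.
have wle_refl : reflexive wle by move=> x; exact: leqnn.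
pose L := sort wle (enum [pred c | corners c]).
pose g c : set V := cell (corner_box c).
have LE c : (c \in L) = corners c by rewrite mem_sort mem_enum.
have uL : uniq L by rewrite sort_uniq enum_uniq.
have ord : orders_maximal_faces [seq g c | c <- L] (@box_complex R d n mu).
  split.
    rewrite map_inj_in_uniq // => c e; rewrite !LE => hc he.
    move/(cell_inj (box_staircase (corner_box_box hc)) (box_staircase
      (corner_box_box he))).
    exact: corner_box_inj.
  apply/seteqP; split=> F /=.
    move/mapP => [c]; rewrite LE => hc ->.
    by apply/maximal_box_complex; exists c.
  by move/maximal_box_complex => [c hc ->]; apply: map_f; rewrite LE.
exists [seq g c | c <- L].
(* When [mu last] is the first variable, the maximal cells are points. *)
have [mu0|mu0] := posnP (mu last).
  apply: shelling_points => // F /mapP[c]; rewrite LE => hc ->.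
  have [|f _ Df] := cell_point (box_has_rows (corner_box_box hc)).
    by rewrite (card_corner_box mu_mono lastP hc) mu0 addn0.
  by exists (vertex R f); rewrite /g Df cell_graph.
have big c : corners c -> (d < #|corner_box c|)%N.
  by move=> hc; rewrite (card_corner_box mu_mono lastP hc) -[X in (X < _)%N]addn0
    ltn_add2l.
case DL : L => [|c1 L']; first by have := corners_mu; rewrite -LE DL.
rewrite DL in LE uL ord; have c1L : corners c1 by rewrite -LE mem_head.
have sorted_L : sorted wle (c1 :: L') by rewrite -DL sort_sorted // => c e;
  exact: leq_total.
rewrite map_cons; apply: shelling_polytopes => //.
  have b1 := corner_box_box c1L.
  have [b [sb _]] := shelling_initial_facets R (box_staircase b1) (big _ c1L)
    (initial_facets_all (box_has_rows b1) (big _ c1L)).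
  by exists b.
move=> j; rewrite size_map => /andP[j0 js].
rewrite -[g c1 :: _]/([seq g c | c <- c1 :: L']).
have js' : (j < size (c1 :: L'))%N by rewrite /= ltnS.
set c := nth c1 (c1 :: L') j.
have FjE : nth set0 [seq g c | c <- c1 :: L'] j = g c by exact: (nth_map c1).
have prevE := @bigcup_nth_take _ _ g _ _ (ltnW js').
cbv zeta; rewrite FjE prevE.
have hc : corners c by rewrite -LE mem_nth.
have bc := corner_box_box hc; have [hrc ic _] := boxP _ _ bc.
have early e : e \in take j (c1 :: L') ->
  [/\ corners e, e != c & (weight e <= weight c)%N].
  move=> ej; have eL := mem_take ej; rewrite in_take // in ej.
  split; first by rewrite -LE.
    by apply: contraTneq ej => ->; rewrite /c index_uniq // ltnn.
  rewrite -(nth_index c1 eL).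
  apply: (sorted_leq_nth wle_trans wle_refl c1 sorted_L) => //; last exact: ltnW.
  by rewrite inE index_mem.
have late e : corners e -> (weight e < weight c)%N -> e \in take j (c1 :: L').
  move=> he we; have eL : e \in c1 :: L' by rewrite LE.
  rewrite in_take // ltnNge; apply: contraL we => je; rewrite -leqNgt.
  rewrite -(nth_index c1 eL).
  apply: (sorted_leq_nth wle_trans wle_refl c1 sorted_L) => //.
  by rewrite inE index_mem.
(* An earlier box misses some descent, so the intersection lies in the facet deleting it; conversely
   the neighbour across a descent has smaller weight, hence comes earlier. *)
have meetE : g c `&` \bigcup_(e in [set` take j (c1 :: L')]) g e =
    \bigcup_(p in [set` descents c]) cell (corner_box c :\ p).
  apply/seteqP; split=> x.
    move=> [xc [e /= ej xe]]; have [he nec we] := early e ej.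
    have [p pc npe] := descent_exists hc he nec we; exists p => //.
    have [_ ie _] := boxP _ _ (corner_box_box he).
    have : cell (corner_box c :&: corner_box e) x by rewrite -cellI.
    apply: cell_sub; apply/fintype.subsetP => q; rewrite finset.in_setI finset.in_setD1.
    by move=> /andP[-> qe]; rewrite andbT; apply: contraNneq npe => <-.
  move=> [p /= pc xp]; have [e [he we sub]] := descent_neighbour hc pc.
  split; first exact: cell_sub (subD1set _ _) _ xp.
  by exists e; [exact: late | exact: cell_sub sub _ xp].
rewrite meetE.
have [p pc] : exists p, p \in descents c.
  have c1j : c1 \in take j (c1 :: L') by case: (j) j0 => // j' _; exact: mem_head.
  by have [he nec we] := early _ c1j; have [p pc _] := descent_exists hc he nec we;
    exists p.
(* The bottom entry of the row lies strictly below the corner, so it is not a descent: it is the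
   companion that [initial_facets] asks for. *)
have wit q : q \in descents c -> exists q', [/\ q \in corner_box c, q' \in corner_box c,
    q.1 = q'.1, q != q' & q' \notin descents c].
  case: q => i a; rewrite inE /= => /and3P[il /eqP -> pi].
  have pn : (prev_corner c i < n)%N by apply: ltn_trans pi _.
  have nci : c i != Ordinal pn by rewrite -val_eqE /= neq_ltn pi orbT.
  exists (i, Ordinal pn); split=> //.
  - exact: corner_mem hc.
  - by rewrite inE /= leqnn ltnW.
  - by rewrite xpair_eqE eqxx.
  by rewrite inE /= eq_sym (negPf nci) andbF.
have init : initial_facets (corner_box c) (descents c).
  split.
    apply/fintype.subsetP => q /wit[q' [qc qc' e1 nq _]].
    exact: removable_row hrc qc qc' e1 nq.
  have [q [pb qb e1 npq nq]] := wit p pc.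
  by exists p, q; split=> //; rewrite (negPf nq).
have [b [sb [e eb De]]] :=
  shelling_initial_facets R (box_staircase bc) (big _ hc) init.
split; last by exists b; split=> //; exists e; rewrite // De.
have /removableP[_ hp] := fintype.subsetP init.1 p pc.
by have [x xp] := (@cell_nonempty R d n _).2 hp; exists x, p.
Qed.

End BoxComplexShelling.

(** * The resolution *)

Section SortedMonomials.
Variables (d n : nat) (mu : 'I_d -> 'I_n).
Hypothesis mu_mono : forall i j : 'I_d, (i <= j)%N -> (mu i <= mu j)%N.
Implicit Types (f g : 'I_d -> 'I_n).

Lemma sort_monomial g : exists2 f : 'I_d -> 'I_n,
  forall i j : 'I_d, (i <= j)%N -> (f i <= f j)%N &
  (\sum_j U_(f j) = \sum_j U_(g j))%MM.
Proof.
pose le (a b : 'I_n) := (a <= b)%N.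
pose s := sort le [seq g j | j <- enum 'I_d].
have ss : size s = d by rewrite size_sort size_map size_enum_ord.
pose t := Tuple (introT eqP ss).
exists (tnth t) => [i j ij|].
  have a0 := tnth t i; rewrite !(tnth_nth a0) /=.
  have sorted_s : sorted le s by apply: sort_sorted => a b; exact: leq_total.
  have le_trans : transitive le by move=> a b c; exact: leq_trans.
  have le_refl : reflexive le by move=> a; exact: leqnn.
  by apply: (sorted_leq_nth le_trans le_refl a0 sorted_s) => //; rewrite inE ss.
rewrite -(big_tuple _ _ t xpredT (fun a =>
  U_(a)%MM)) /= (perm_big _ (permEl (perm_sort le _))).
by rewrite big_map big_enum.
Qed.

(** Count the letters that are at most [mu j], a number depending only on the monomial. The word [g]
    has at least [j.+1] of them, at positions 0 to [j]; if [f j] exceeded [mu j], the increasing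
    word [f] would have at most [j]. *)
Lemma dominated_sorted f : (forall i j : 'I_d, (i <= j)%N -> (f i <= f j)%N) ->
  dominated mu (\sum_j U_(f j))%MM -> forall j, (f j <= mu j)%N.
Proof.
move=> f_mono [g gmu e] j; rewrite leqNgt; apply/negP => lt.
pose N (h : 'I_d -> 'I_n) := (\sum_(i : 'I_d) (h i <= mu j)%N)%N.
have NE h : N h = (\sum_(t : 'I_n | (t <= mu j)%N) (\sum_(i < d) U_(h i))%MM t)%N.
  rewrite /N; under [RHS]eq_bigr do rewrite mnm_sumE.
  rewrite exchange_big; apply: eq_bigr => i _ /=.
  rewrite (eq_bigr (fun t => (h i == t) : nat)) => [|t _]; last by rewrite mnm1E.
  rewrite big_mkcond (bigD1 (h i)) //= eqxx big1 ?addn0; first by case: leqP.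
  by move=> t; rewrite eq_sym => /negPf->; case: ifP.
have Nfg : N f = N g by rewrite !NE e.
have Nj (h : nat) : (h <= d)%N -> (\sum_(i < d) (i < h)%N = h)%N.
  move=> hd; rewrite -(big_mkord xpredT (fun i =>
    (i < h)%N : nat)) (big_cat_nat (leq0n h) hd) /=.
  rewrite [X in (X + _)%N](eq_big_nat _ _ (F2 := fun=> 1%N)) => [|i /andP[_ ->] //].
  rewrite [X in (_ + X)%N]big_nat [X in (_ + X)%N]big1 => [|i /andP[hi _]];
    last by rewrite ltnNge hi.
  by rewrite sum_nat_const_nat subn0 muln1 addn0.
have Nf : (N f <= j)%N.
  rewrite -[X in (_ <= X)%N](Nj j (ltnW (ltn_ord j))); apply: leq_sum => i _.
  case: ltnP => ij; first exact: leq_b1.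
  by rewrite [(f i <= _)%N]leqNgt (leq_trans lt (f_mono _ _ ij)).
have Ng : (j.+1 <= N g)%N.
  rewrite -[X in (X <= _)%N](Nj j.+1 (ltn_ord j)); apply: leq_sum => i _.
  by case: leqP => // ij; rewrite (leq_trans (gmu i)) // mu_mono.
by rewrite -Nfg in Ng; have := leq_trans Ng Nf; rewrite ltnn.
Qed.

Lemma box_graph f : (forall i j : 'I_d, (i <= j)%N -> (f i <= f j)%N) ->
  (forall j, (f j <= mu j)%N) -> box mu (graph f).
Proof.
move=> f_mono fmu; apply/boxP; split; first exact: graph_has_rows.
  apply/increasingP => -[i a] [j b]; rewrite !in_graph => /eqP <- /eqP <- /= ij.
  exact/f_mono/ltnW.
by move=> [i a]; rewrite in_graph => /eqP <-; exact: fmu.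
Qed.

Lemma label_graph f : label (graph f) = (\sum_j U_(f j))%MM.
Proof. by rewrite /label big_imset //= => i j _ _ []. Qed.

End SortedMonomials.

(** * From strands to polynomial chains *)

Section Resolution.
Variables (R : realType) (k : fieldType) (d n : nat) (mu : 'I_d -> 'I_n).
Hypothesis mu_mono : forall i j : 'I_d, (i <= j)%N -> (mu i <= mu j)%N.
Local Notation V := 'rV[R]_n.
Local Notation S := {mpoly k[n]}.
Local Notation X := (@box_complex R d n mu).
Local Notation I := (monomial_gen (dominated mu) : set S).
Local Notation lab := (@point_label R n).
Implicit Types (A B C : {set 'I_d * 'I_n}) (F G : set V) (c : set V -> S).

Lemma cells_box_complex : cells X = [set cell A | A in [set A | box mu A]].
Proof.
apply/seteqP; split=> [F [[->|[A bA ->]]]|_ [A bA <-]].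
- by case=> x [].
- by move=> _; exists A.
split; first exact: box_complex_cell.
by apply/cell_nonempty; apply: box_has_rows bA.
Qed.

Lemma sum_cells (M : nmodType) (h : set V -> M) :
  \sum_(F \in cells X) h F = \sum_(A | box mu A) h (cell A).
Proof.
rewrite cells_box_complex fsbig_image; last first.
  move=> A B; rewrite !inE => bA bB; exact: cell_inj (box_staircase bA)
    (box_staircase bB).
apply/esym; apply: (@bigfs _ _ _ _ _ [pred A | box mu A] (fun A => h (cell A))) =>
  [|A _].
  exact: index_enum_uniq.
by rewrite mem_index_enum.
Qed.

Lemma chainsP i c : chains X i c <->
  forall F, c F != 0 -> exists2 A, box mu A /\ #|A| = (d + i)%N & F = cell A.
Proof.
split=> h F /h; rewrite cells_box_complex.
  move=> [[A bA <-]]; rewrite pdim_cell ?(box_staircase bA) // => e; exists A => //;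
    split=> //.
  by apply/eqP; rewrite -eqz_nat PoszD -e addrC subrK.
move=> [A [bA cA] ->]; split; first by exists A.
by rewrite pdim_cell ?(box_staircase bA) // cA PoszD addrC addKr.
Qed.

Lemma chains_cell i c A : chains X i c -> box mu A -> c (cell A) != 0 ->
  #|A| = (d + i)%N.
Proof.
move=> /chainsP h bA /h[B [bB cB] e].
by rewrite (cell_inj (box_staircase bA) (box_staircase bB) e).
Qed.

Lemma mcoeffMXr (p : S) (m u : 'X_{1..n}) :
  (p * 'X_[m])@_u = if (m <= u)%MM then p@_(u - m) else 0.
Proof.
case: ifP => [mu'|nmu]; first by rewrite -{1}(submK mu') addmC mcoeffMX.
apply/eqP; rewrite mcoeff_eq0; apply/negP => /msuppM_le/allpairsP[[m1 m2] /= [_]].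
by rewrite msuppX inE => /eqP -> e; rewrite e lem_addl in nmu.
Qed.

(* The component of a chain in multidegree [alpha], in the basis of the
   [x^(alpha - label A) A] with [label A] dividing [x^alpha]. *)
Definition strand_part alpha c A : k :=
  if box mu A && (label A <= alpha)%MM then (c (cell A))@_(alpha - label A) else 0.

Lemma strand_part_strand alpha i c : chains X i c ->
  strand mu alpha (d + i)%N (strand_part alpha c).
Proof.
move=> ch A; rewrite /strand_part; case: ifP => [/andP[bA lA] nz|_];
  last by rewrite eqxx.
split=> //; apply: (chains_cell ch bA); apply: contraNneq nz => ->.
by rewrite mcoeff0.
Qed.

Lemma strand_part_inj c1 c2 :
  (forall F, ~ cells X F -> c1 F = c2 F) ->
  (forall alpha A, strand_part alpha c1 A = strand_part alpha c2 A) -> c1 = c2.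
Proof.
move=> off h; apply/funext => F; have [|/off //] := pselect (cells X F).
rewrite cells_box_complex => -[A bA <-]; apply/mpolyP => u.
have := h (u + label A)%MM A.
by rewrite /strand_part (bA : box mu A) lem_addl addmK.
Qed.

(** Identifies the kernel of the augmentation with the case [N = d] of [strand_cycle]. *)
Lemma augmentation_coeff c alpha :
  (augmentation lab X c)@_alpha = \sum_A strand_part alpha c A.
Proof.
rewrite /augmentation sum_cells raddf_sum /= big_mkcond /=; apply: eq_bigr => A _.
rewrite /strand_part; case: (boolP (box mu A)) => //= bA.
by rewrite cell_label_cell ?(box_staircase bA) // mcoeffMXr.
Qed.

Section Differential.
Variable eps : set V -> set V -> int.
Hypothesis inc : incidence X eps.
Local Notation E := (box_coefficient mu k eps).

Lemma cell_diff_off c F : ~ cells X F -> cell_diff lab X eps c F = 0.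
Proof. by rewrite /cell_diff; case: asboolP. Qed.

Lemma cell_diff_cell c B : box mu B ->
  cell_diff lab X eps c (cell B) =
  \sum_(A | box mu A) c (cell A) * ((eps (cell A) (cell B))%:~R * 'X_[label A -
    label B]).
Proof.
move=> bB; rewrite /cell_diff; case: asboolP => [_|[]]; last first.
  by rewrite cells_box_complex; exists B.
rewrite sum_cells; apply: eq_bigr => A bA.
by rewrite !cell_label_cell ?(box_staircase bA) ?(box_staircase bB).
Qed.

(** In the basis of [strand_part] the quotients of labels in the differential are absorbed, leaving
    the scalar matrix [E]. *)
Lemma strand_part_diff alpha c B :
  strand_part alpha (cell_diff lab X eps c) B = boundary E (strand_part alpha c) B.
Proof.
have [E0 _ _ _] := box_coefficient_incidence k inc.
rewrite {1}/strand_part; case: ifP => [/andP[bB lB]|nB]; last first.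
  rewrite /boundary big1 // => A _; apply/eqP/negPn/negP; rewrite mulf_eq0.
  move=> /norP[]; rewrite /strand_part; case: ifP => [/andP[bA lA] _|_];
    last by rewrite eqxx.
  move=> /E0[_ bB /andP[sBA _]]; rewrite bB (lepm_trans (labelS sBA) lA) in nB.
  by [].
rewrite cell_diff_cell // raddf_sum /= big_mkcond; apply: eq_bigr => A _.
rewrite /strand_part; case: (boolP (box mu A)) => bA; last by rewrite mul0r.
rewrite box_coefficientE //=.
have [e0|nz] := eqVneq (eps (cell A) (cell B)) 0.
  by rewrite e0 !mulr0z mul0r mulr0 mcoeff0 mulr0.
have sBA : B \subset A.
  have [_ i2 _ _] := inc; apply: contraNT nz => nsub; apply/eqP/i2;
    try exact: box_complex_cell.
  by move=> /(cell_facetP R bA bB)/andP[]; rewrite (negPf nsub).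
have lBA := labelS sBA; rewrite mulrCA mulrzl raddfMz /= mcoeffMXr mulrzr.
have -> : (alpha - label B - (label A - label B) = alpha - label A)%MM.
  apply/mnmP => i; have := mnm_lepP lBA i; have := mnm_lepP lB i; rewrite !mnmBE; lia.
suff -> : (label A - label B <= alpha - label B)%MM = (label A <= alpha)%MM by [].
apply/mnm_lepP/mnm_lepP => h i; have := h i; have := mnm_lepP lBA i;
  have := mnm_lepP lB i; rewrite !mnmBE; lia.
Qed.

Lemma cell_diff_eq c c' i : chains X i c ->
  (forall alpha B, boundary E (strand_part alpha c') B = strand_part alpha c B) ->
  cell_diff lab X eps c' = c.
Proof.
move=> ch h; apply: strand_part_inj => [F nF|alpha B]; last by rewrite strand_part_diff.
rewrite cell_diff_off //; apply/esym/eqP; apply: contra_notT nF.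
by move=> /ch[].
Qed.

Lemma augmentation_cell_diff c : chains X 1 c ->
  augmentation lab X (cell_diff lab X eps c) = 0.
Proof.
move=> ch; apply/mpolyP => alpha; rewrite augmentation_coeff mcoeff0.
rewrite (eq_bigr (boundary E (strand_part alpha c))) => [|B _];
  last exact: strand_part_diff.
apply: (sum_boundary (box_coefficient_incidence k inc)) => A nz.
by have [_ -> _] := strand_part_strand ch nz; rewrite addn1.
Qed.

Lemma cell_diff_cell_diff c : cell_diff lab X eps (cell_diff lab X eps c) = fun=> 0.
Proof.
apply: strand_part_inj => [F nF|alpha B]; first by rewrite cell_diff_off.
rewrite strand_part_diff /boundary.
rewrite (eq_bigr (fun A => boundary E (strand_part alpha c) A * E A B)) => [|A _].
  rewrite -/(boundary E _ B) (boundary_boundary (box_coefficient_incidence k inc)).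
  by rewrite /strand_part mcoeff0 if_same.
by rewrite strand_part_diff.
Qed.

Lemma chain_exact i c : chains X i c ->
  (forall alpha, strand_cycle E (d + i)%N (strand_part alpha c)) ->
  exists2 c', chains X i.+1 c' & cell_diff lab X eps c' = c.
Proof.
move=> ch cyc.
have ex alpha : exists y, strand mu alpha (d + i)%N.+1 y /\
    forall B, boundary E y B = strand_part alpha c B.
  have [y sy Dy] := strand_exact (box_coefficient_incidence k inc) (leq_addr i d)
    (strand_part_strand ch) (cyc alpha).
  by exists y.
have [y hy] := choice ex.
(* There is a solution in every multidegree, but polynomial coefficients need finitely many: only
   the multidegrees occurring in [c] are kept. In the others both [c] and [c'] have zero
   component. *)
pose degrees : seq 'X_{1..n} := undup (flatten
  [seq [seq (u + label A)%MM | u <- msupp (c (cell A))] | A <- index_enum {set 'I_d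
    * 'I_n}]).
have degreesP alpha A : strand_part alpha c A != 0 -> alpha \in degrees.
  rewrite /strand_part; case: ifP => [/andP[bA lA]|_]; last by rewrite eqxx.
  rewrite -mcoeff_msupp => um; rewrite mem_undup; apply/flattenP.
  exists [seq (u + label A)%MM | u <- msupp (c (cell A))]; first by apply: map_f;
    rewrite mem_index_enum.
  by apply/mapP; exists (alpha - label A)%MM; rewrite // submK.
pose z A : S := \sum_(alpha <- degrees) y alpha A *: 'X_[alpha - label A].
have zc alpha A : box mu A -> (label A <= alpha)%MM ->
    (z A)@_(alpha - label A) = if alpha \in degrees then y alpha A else 0.
  move=> bA lA; rewrite /z raddf_sum /=.
  have zero beta : beta != alpha -> (y beta A *: 'X_[beta - label A])@_(alpha -
    label A) = 0.
    move=> nba; have [->|/((hy beta).1 A)[_ _ lb]] := eqVneq (y beta A) 0.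
      by rewrite scale0r mcoeff0.
    rewrite mcoeffZ mcoeffX; case: eqP => [e|_]; last exact: mulr0.
    by move: nba; rewrite -(submK lb) e submK ?eqxx.
  case: ifP => [ad|nad].
    rewrite (bigD1_seq alpha) ?undup_uniq //= mcoeffZ mcoeffX eqxx mulr1.
    by rewrite big1 ?addr0 // => beta; exact: zero.
  rewrite big_seq big1 // => beta bd; apply: zero.
  by apply: contraFneq nad => <-.
pose c' F : S := if `[< cells X F >] then z (@code R d n F) else 0.
have c'E A : box mu A -> c' (cell A) = z A.
  move=> bA; rewrite /c' code_cell ?(box_staircase bA) //; case: asboolP => // -[].
  by rewrite cells_box_complex; exists A.
exists c'; last apply: cell_diff_eq ch _ => alpha B.
  apply/chainsP => F; rewrite /c'; case: asboolP => [|_]; last by rewrite eqxx.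
  rewrite cells_box_complex => -[A bA <-];
    rewrite code_cell ?(box_staircase bA) // => nz.
  exists A; split=> //.
  have [alpha nz'] : exists alpha, y alpha A != 0.
    apply: contrapT => none; case/eqP: nz; rewrite /z big1_seq // => alpha _.
    have [->|nz'] := eqVneq (y alpha A) 0; first by rewrite scale0r.
    by case: none; exists alpha.
  by have [_ -> _] := (hy alpha).1 A nz'; rewrite addnS.
have [ad|nad] := boolP (alpha \in degrees).
  rewrite -(hy alpha).2; apply: eq_bigr => A _; congr (_ * _).
  rewrite /strand_part; case: ifP => [/andP[bA lA]|nA];
    first by rewrite c'E // zc // ad.
  apply/esym/eqP; apply: contraFT nA => /((hy alpha).1 A)[-> _ ->]; by [].
rewrite /boundary big1 => [|A _].
  by apply/esym/eqP; apply: contraNT nad => /degreesP.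
rewrite /strand_part; case: ifP => [/andP[bA lA]|_]; last by rewrite mul0r.
by rewrite c'E // zc // (negPf nad) mul0r.
Qed.

Lemma box_complex_minimal : is_minimal k lab X eps.
Proof.
move=> i c _ G; have [idI D M] := ideal_gen_ideal (range (fun j : 'I_n => 'X_j : S)).
have [|nG] := pselect (cells X G); last by rewrite cell_diff_off.
rewrite cells_box_complex => -[B bB <-]; rewrite cell_diff_cell //.
apply: ideal_sum => [|A bA]; first exact: ideal_gen_ideal.
have [e0|nz] := eqVneq (eps (cell A) (cell B)) 0.
  by rewrite e0 mulr0z mul0r mulr0.
have [_ i2 _ _] := inc.
have /facetP[p pA ->] : facet B A.
  apply: contraNT nz => nf; apply/eqP/i2; try exact: box_complex_cell.
  by move=> /(cell_facetP R bA bB); rewrite (negPf nf).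
rewrite (label_setD1 pA) addmK; apply: (M); apply: (M).
by apply: sub_ideal_gen; exists p.2.
Qed.

End Differential.

Lemma augmentationD c1 c2 :
  augmentation lab X (fun F => c1 F + c2 F) = augmentation lab X c1 + augmentation
    lab X c2.
Proof.
by rewrite /augmentation !sum_cells -big_split; apply: eq_bigr => A _; rewrite mulrDl.
Qed.

Lemma augmentationM (f : S) c :
  augmentation lab X (fun F => f * c F) = f * augmentation lab X c.
Proof.
by rewrite /augmentation !sum_cells mulr_sumr; apply: eq_bigr => A _; rewrite mulrA.
Qed.

Lemma augmentation_image : augmentation lab X @` chains X 0 = I.
Proof.
have imI : is_ideal (augmentation lab X @` chains X 0 : set S).
  split=> [|_ _ [c1 h1 <-] [c2 h2 <-]|f _ [c hc <-]].
  - exists (fun=> 0); first by move=> F; rewrite eqxx.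
    by rewrite /augmentation sum_cells big1 // => A _; rewrite mul0r.
  - exists (fun F => c1 F + c2 F); last exact: augmentationD.
    move=> F; have [->|/h1 //] := eqVneq (c1 F) 0; rewrite add0r; exact: h2.
  exists (fun F => f * c F); last exact: augmentationM.
  by move=> F nz; apply: hc; apply: contraNneq nz => ->; rewrite mulr0.
apply/seteqP; split=> [_ [c hc <-]|].
  rewrite /augmentation sum_cells; apply: ideal_sum; first exact: ideal_gen_ideal.
  move=> A bA; rewrite cell_label_cell ?(box_staircase bA) //.
  have [I0 _ M] := ideal_gen_ideal [set ('X_[m] : S) | m in dominated mu].
  have [->|nz] := eqVneq (c (cell A)) 0; first by rewrite mul0r.
  apply: (M); have cA : #|A| = d by rewrite (chains_cell hc bA nz) addn0.
  have [f sf DA] := cell_point (box_has_rows bA) cA.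
  apply: sub_ideal_gen; exists (label A) => //; rewrite DA label_graph.
  by exists f => // j; have [_ _ lA] := boxP _ _ bA; apply: (lA _ (sf j)).
apply: ideal_gen_min => // _ [_ [g gmu ->] <-].
(* Vertices are increasing words, so the generator is rewritten in sorted form. *)
have [f f_mono Df] := sort_monomial g.
have fmu : forall j, (f j <= mu j)%N.
  by apply: dominated_sorted => //; rewrite Df; exists g.
have bf := box_graph f_mono fmu.
exists (fun F => if F == cell (graph f) then 1 else 0).
  apply/chainsP => F; have [-> _|_] := eqVneq F (cell (graph f)); last by rewrite eqxx.
  by exists (graph f) => //; split=> //; rewrite addn0 card_graph.
rewrite /augmentation sum_cells (bigD1 (graph f)) //= eqxx mul1r big1 ?addr0.
  by rewrite cell_label_cell ?(box_staircase bf) // label_graph Df.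
move=> A /andP[bA nA]; case: eqP => [|_]; last by rewrite mul0r.
by move/(cell_inj (box_staircase bA) (box_staircase bf))/eqP; rewrite (negPf nA).
Qed.

Lemma complex_verticesE :
  complex_vertices X = [set vertex R f | f in
    [set f : 'I_d -> 'I_n | (forall i j : 'I_d, (i <= j)%N -> (f i <= f j)%N) /\
                            (forall j, (f j <= mu j)%N)]].
Proof.
apply/seteqP; split=> [v [/seteqP[/(_ v erefl)] //|[A bA DA]]|_ [f [f_mono fmu] <-]].
  have [f sf Df] := cell_point (box_has_rows bA)
    (card_cell_point (box_staircase bA) (esym DA)).
  have [_ iA lA] := boxP _ _ bA; exists f.
    split=> [i j|j]; last exact: (lA _ (sf j)).
    rewrite leq_eqVlt => /orP[/eqP/val_inj-> //|ij].
    exact: (increasingP _ iA (i, f i) (j, f j) (sf i) (sf j) ij).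
  have : [set vertex R f] v by rewrite -cell_graph -Df -DA.
  by move=> ->.
rewrite /complex_vertices /= -cell_graph; apply: box_complex_cell.
exact: box_graph.
Qed.

Lemma vertices_bijection : set_bij (complex_vertices X) (mingens I) lab.
Proof.
rewrite (mingens_equigenerated _ (@dominated_mdeg n d mu)) complex_verticesE; split.
- move=> _ [f [_ fmu] <-]; rewrite point_label_vertex; by exists f.
- move=> v v'; rewrite !inE => -[f _ <-] [f' _ <-].
  by rewrite !point_label_vertex; apply: vertex_label.
move=> _ [g gmu ->]; have [f f_mono Df] := sort_monomial g.
exists (vertex R f); last by rewrite point_label_vertex.
by exists f => //; split=> //; apply: dominated_sorted => //; rewrite Df; exists g.
Qed.

Lemma box_complex_resolution : (0 < d)%N ->
  supports_minimal_free_resolution lab X I.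
Proof.
move=> d0; split; [exact: vertices_bijection | exact: box_complex_incidence |].
move=> eps inc; split; last exact: box_complex_minimal.
split; first exact: augmentation_image.
  move=> c ch; split=> [c0|[c' ch' <-]]; last exact: augmentation_cell_diff.
  apply: chain_exact => // alpha; rewrite /strand_cycle addn0 eqxx.
  by rewrite -augmentation_coeff c0 mcoeff0.
move=> i c ch; split=> [c0|[c' ch' <-]]; last exact: cell_diff_cell_diff.
apply: chain_exact => // alpha; rewrite /strand_cycle ifF.
  by move=> B; rewrite -strand_part_diff // c0 /strand_part mcoeff0 if_same.
by apply/negbTE; rewrite neq_ltn -addSnnS leq_addr orbT.
Qed.

End Resolution.

(** * Comparison with the subdivision of the simplex *)

Section Subdivision.
Variables (R : realType) (k : fieldType) (d n : nat) (mu : 'I_d.+1 -> 'I_n).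
Hypothesis mu_mono : forall i j : 'I_d.+1, (i <= j)%N -> (mu i <= mu j)%N.
Local Notation V := 'rV[R]_n.
Local Notation S := {mpoly k[n]}.

(** If all vertices of a staircase cell lie in the ideal, each entry [(j, a)] lies on an increasing
    section [f]. Its monomial has the degree of the generators, so it is one of them, and being
    sorted it satisfies [f j <= mu j]. *)
Lemma box_complex_subdivision :
  @box_complex R d.+1 n mu = [set F | Pcomplex d.+1 0 n.-1 F /\
    forall v, vertices F v -> (monomial_gen (dominated mu) : set S) 'X_[point_label v]].
Proof.
apply/seteqP; split=> [F [->|[A bA ->]]|F [PF hF]]; last 1 first.
  have [->|[A [sA _ DF]]] := (PcomplexE _ _ (leq0n _)).1 PF; first by left.
  rewrite DF in hF *.
  have [hA iA] := andP sA; apply: box_complex_cell; apply/boxP; split=> // -[j a] ja /=.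
  have [f sf <-] := has_rows_section_at hA ja.
  have f_mono (i1 i2 : 'I_d.+1) : (i1 <= i2)%N -> (f i1 <= f i2)%N.
    rewrite leq_eqVlt => /orP[/eqP/val_inj-> //|lt12].
    exact: (increasingP _ iA (i1, f i1) (i2, f i2) (sf i1) (sf i2) lt12).
  apply: (dominated_sorted mu_mono f_mono).
  have : vertices (cell A : set V) (vertex R f) by rewrite vertices_cell //; exists f.
  move/hF/monomial_genX; rewrite point_label_vertex => -[m mD mf].
  suff <- : m = (\sum_j U_(f j))%MM by [].
  have e1 := dominated_mdeg mD.
  have e2 : mdeg (\sum_j U_(f j))%MM = d.+1 by apply: (@dominated_mdeg _ _ f); exists f.
  have := congr1 mdeg (submK mf); rewrite mdegD e1 e2 -[RHS]add0n => /addIn/eqP.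
  by rewrite mdeg_eq0 => /eqP mf0; rewrite -(submK mf) mf0 add0m.
- split; first by apply: (PcomplexE _ _ (leq0n _)).2; left.
  by move=> v [u [c [_]]] /seteqP[/(_ v erefl)[]].
- have sA := box_staircase bA; split.
    apply: (PcomplexE _ _ (leq0n _)).2; right; exists A; split=> // p _.
    by rewrite leq0n -ltnS (leq_trans (ltn_ord _)) ?leqSpred.
  rewrite vertices_cell // => _ [f sf <-]; rewrite point_label_vertex.
  apply: sub_ideal_gen; exists (\sum_j U_(f j))%MM => //.
  by exists f => // j; have [_ _ lA] := boxP _ _ bA; apply: (lA _ (sf j)).
Qed.

End Subdivision.

Theorem theorem3p11 (R : realType) (k : fieldType) (k_char0 : [pchar k] =i pred0)
    (n s : nat) (lambda : 'I_s -> 'I_n) (d : 'I_s -> nat)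
    (s_gt0 : (0 < s)%N)
    (lambda_lt : forall i j : 'I_s, (i < j)%N -> (lambda i < lambda j)%N)
    (d_gt0 : forall j, (0 < d j)%N) :
  let m : 'X_{1..n} := (\sum_(j < s) U_(lambda j) *+ d j)%MM in
  let I : set {mpoly k[n]} :=
    \big[@ideal_mul k n/setT]_(j < s) ideal_exp (var_ideal (lambda j)) (d j) in
  let Pd : set (set 'rV[R]_n) := @Pcomplex R n (mdeg m) 0 n.-1 in
  is_principal_borel m I /\
  exists Q : set (set 'rV[R]_n),
    [/\ polyhedral_complex Q,
        shellable Q,
        supports_minimal_free_resolution (@point_label R n) Q I,
        Q `<=` Pd &
        Q = [set F | Pd F /\ forall v, vertices F v -> I 'X_[point_label v]]].
Proof.
move=> m I Pd.
(* The sorted word of [m]; its letters are the row bounds [mu]. *)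
pose l := flatten [seq nseq (d j) (lambda j) | j <- index_enum 'I_s].
have Dm : m = (\sum_(i <- l) U_(i))%MM.
  rewrite big_flatten big_map; apply: eq_bigr => j _; rewrite big_nseq.
  by elim: (d j) => [|c IHc]; rewrite ?mulm0n // mulmS iterS IHc.
have DI : I = monomial_gen (dominated_seq l) by exact: prod_var_ideals.
have sl : (0 < size l)%N.
  have j0 := Ordinal s_gt0; rewrite -has_predT; apply/hasP.
  exists (lambda j0) => //; apply/flattenP; exists (nseq (d j0) (lambda j0)).
    by apply: map_f; rewrite mem_index_enum.
  by rewrite mem_nseq d_gt0 eqxx.
pose le (a b : 'I_n) := (a <= b)%N.
have sorted_l : sorted le l.
  have le_trans : transitive le by move=> a b c; exact: leq_trans.
  rewrite sorted_pairwise //.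
  have : sorted ltn (map val (index_enum 'I_s)).
    by rewrite [index_enum _]unlock -enumT val_enum_ord iota_ltn_sorted.
  rewrite sorted_map sorted_pairwise; last by move=> a b c; exact: ltn_trans.
  rewrite /l; elim: (index_enum _) => //= j r IHr /andP[jr /IHr pr].
  rewrite pairwise_cat pr andbT; apply/andP; split.
    apply/allrelP => a b; rewrite mem_nseq =>
      /andP[_ /eqP->] /flattenP[_ /mapP[j' j'r ->]].
    rewrite mem_nseq => /andP[_ /eqP->]; apply: ltnW; apply: lambda_lt.
    exact: (allP jr).
  by elim: (d j) => //= c ->; rewrite andbT; apply/allP => a;
    rewrite mem_nseq /le => /andP[_ /eqP->].
(* [Pcomplex] is meaningful in positive degree, so the degree of [m] is written as a successor. *)
have [e De] : exists e, size l = e.+1 by exists (size l).-1; rewrite prednK.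
have i0 : 'I_n by case: (l) sl.
pose mu (j : 'I_e.+1) := nth i0 l j.
have Dl : l = [seq mu j | j <- enum 'I_e.+1].
  by rewrite /mu (map_comp (nth i0 l) val) val_enum_ord -De map_nth_iota0 ?take_size.
have mu_mono (i j : 'I_e.+1) : (i <= j)%N -> (mu i <= mu j)%N.
  move=> ij; have le_trans : transitive le by move=> a b c; exact: leq_trans.
  have le_refl : reflexive le by move=> a; exact: leqnn.
  by apply: (sorted_leq_nth le_trans le_refl i0 sorted_l) => //; rewrite inE De.
have Dm' : m = (\sum_j U_(mu j))%MM by rewrite Dm Dl big_map big_enum.
have DI' : I = monomial_gen (dominated mu) by rewrite DI (dominated_seqE Dl).
have mdeg_m : mdeg m = e.+1 by apply: (@dominated_mdeg _ _ mu); exists mu.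
split; first by rewrite DI' Dm'; apply: principal_borel_dominated.
have QE := box_complex_subdivision R k mu_mono.
exists (@box_complex R e.+1 n mu); rewrite /Pd mdeg_m DI'; split=> //.
- exact: box_complex_polyhedral.
- by apply: (@box_complex_shellable R e.+1 n mu ord_max) => // j; rewrite -ltnS ltn_ord.
- exact: box_complex_resolution.
by rewrite QE => F [].
Qed.
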